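(* Consider a Branching Random Walk in Random Environment on the Cayley graph $X(G,S)$ whose environment has law $\Theta$ with one-dimensional marginal $Q\times\widetilde Q$ satisfying the standing assumptions, and let $\rho$ denote the $\Theta$-almost surely constant value of the spectral radius $\rho(P_\omega)$. If $m^*\le \frac1\rho$, then for $\Theta$-almost all realizations $(\omega,\mu)$ the Branching Markov Chain $(X,P_\omega,\mu)$ is transient. Otherwise (i.e. if $m^*>\frac1\rho$), for $\Theta$-almost all realizations $(\omega,\mu)$ the Branching Markov Chain $(X,P_\omega,\mu)$ is strongly recurrent.
   Context: Setting. $G$ is an infinite finitely generated group, $S$ a finite symmetric set of generators of $G$, and $X=G$ is the vertex set of the Cayley graph $X(G,S)$ ($x,y$ adjacent iff $x^{-1}y\in S$). $\mathcal M$ is the set of probability measures on $S$, and $\mathcal B$ is the set of sequences $\mu=(\mu_k)_{k\ge1}$ of non-negative numbers with $\sum_k\mu_k=1$ and $m(\mu):=\sum_k k\mu_k<\infty$. $Q$ is a probability distribution on $\mathcal M$ and $\widetilde Q$ a probability distribution on $\mathcal B$. The environment is $(\omega,\mu)=(\omega_x,\mu_x)_{x\in X}$, where $(\omega_x)_{x\in X}$ are iid with law $Q$, $(\mu_x)_{x\in X}$ are iid with law $\widetilde Q$, and the two families are independent; $\Theta$ is the resulting product measure, with one-dimensional marginal $Q\times\widetilde Q$. Given $\omega$, $P_\omega$ is the transition kernel on $X$ with $p_\omega(x,y)=\omega_x(x^{-1}y)$ if $x^{-1}y\in S$ and $0$ otherwise. Standing assumptions. (a) There are $\gamma>0$ and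 a minimal set of generators $S'\subseteq S$ (generating $G$ as a semigroup, so that the walks considered are irreducible) with $Q\{\omega:\omega(s)>\gamma\ \forall s\in S'\}=1$. (b) $m^*>1$, where $m^*:=\sup\{m(\mu):\mu\in\mathrm{supp}(\widetilde Q)\}\in(1,\infty]$. Spectral radius. For an irreducible Markov chain $(X,P)$, $\rho(P):=\limsup_{n\to\infty}(p^{(n)}(x,x))^{1/n}\in(0,1]$, which does not depend on $x$. The value $\rho(P_\omega)$ is the same constant, denoted $\rho$, for almost all $\omega$. Branching Markov Chain $(X,P_\omega,\mu)$, for fixed $(\omega,\mu)$: at time $0$ there is one particle at a starting position. At each time step, every particle, located at $x$ say, is replaced by $k$ offspring at $x$ with probability $\mu_x(k)=(\mu_x)_k$, and then each offspring makes one step according to $P_\omega$; all particles branch and move independently of each other and of the past. $\eta(n)$ is the number of particles at time $n$, $x_i(n)$ the position of the $i$th one, and $\mathbb P_{\omega,\mu,x}$ the law of the process started at $x$. With $\alpha(x):=\mathbb P_{\omega,\mu,x}\big(\sum_{n\ge1}\sum_{i=1}^{\eta(n)}\mathbf 1\{x_i(n)=x\}=\infty\big)$, the chain is transient if $\alpha(x)=0$ for all $x\in X$ and strongly recurrent if $\alpha(x)=1$ for all $x\in X$ (each holds for all $x$ as soon as it holds for one $x$). *)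

(* Defs.v *)
From HB Require Import structures.
From mathcomp Require Import all_boot all_order all_algebra finmap.
From mathcomp Require Import all_classical all_reals all_analysis.
Set Implicit Arguments.
Unset Strict Implicit.
Unset Printing Implicit Defensive.
Import Order.TTheory GRing.Theory Num.Theory.
Import numFieldNormedType.Exports.
Local Open Scope classical_set_scope.
Local Open Scope ring_scope.

Section product_space.
Context (I : Type) d (T : measurableType d).

Definition coordinate_events : set (set (I -> T)) :=
  \bigcup_(i in [set: I]) preimage_set_system setT (fun f => f i) measurable.

(* The function type I -> T with the product sigma-algebra. *)
Definition prod_space := g_sigma_algebraType coordinate_events.

HB.instance Definition _ := Measurable.on prod_space.

End product_space.
Arguments prod_space I {d} T.

(* By the pi-lambda theorem these identities determine Theta uniquely. *)
Definition is_iid_product (I : choiceType) d (T : measurableType d)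
    (R : realType) (m : set T -> \bar R)
    (Theta : probability (prod_space I T) R) :=
  forall (F : {fset I}) (A : I -> set T),
    (forall i, i \in F -> measurable (A i)) ->
    Theta [set e | forall i, i \in F -> A i (e i)] =
      \big[*%E/1%E]_(i <- F) m (A i).

Section cayley_graph.
Context (G : groupType).
Local Open Scope group_scope.

Definition symmetric_set (A : {fset G}) := forall s, s \in A -> s^-1 \in A.

(* Products without inverses; since G will be infinite, hence nontrivial,
   allowing the empty product does not change the notion. *)
Definition generates (A : {fset G}) :=
  forall x : G, exists2 l : seq G,
    {subset l <= A} & x = \big[*%g/1]_(s <- l) s.

Definition minimal_generates (A : {fset G}) :=
  generates A /\ forall B : {fset G}, (B `<` A)%fset -> ~ generates B.

End cayley_graph.

(* Step distributions on S are vectors indexed by the finite type S. *)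
Notation step_space R S := (prod_space S (measurableTypeR R)).
Notation offspring_space R := (prod_space nat (measurableTypeR R)).
Notation env_space R G S :=
  (prod_space G (step_space R S * offspring_space R)%type).

Section environment.
Context (R : realType) (G : groupType) (S : {fset G}).

Definition step_laws : set (step_space R S) :=
  [set w : S -> R | (forall s, 0 <= w s) /\ \sum_(s : S) w s = 1].

Definition mean (nu : nat -> R) : \bar R := (\sum_(k <oo) (k%:R * nu k)%:E)%E.

(* nu k is the probability of k children; nu 0 = 0 encodes that the sequences
   are indexed by k >= 1. *)
Definition offspring_laws : set (offspring_space R) :=
  [set nu : nat -> R | [/\ nu 0%N = 0, forall k, 0 <= nu k,
     (\sum_(k <oo) (nu k)%:E = 1)%E & (mean nu < +oo)%E]].

(* Topological support inside offspring_laws, for the topology of pointwise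
   convergence. *)
Definition offspring_support (Qt : probability (offspring_space R) R) :
    set (nat -> R) :=
  [set nu | offspring_laws nu /\
     forall U : set {ptws nat -> R}, open U -> U nu -> (0 < Qt U)%E].

Definition mstar (Qt : probability (offspring_space R) R) : \bar R :=
  ereal_sup [set mean nu | nu in offspring_support Qt].

Definition env_step (e : env_space R G S) (x : G) : S -> R := (e x).1.

Definition env_offspring (e : env_space R G S) (x : G) : nat -> R := (e x).2.

Definition env_kernel (e : env_space R G S) (x y : G) : R :=
  if insub (x^-1 * y)%g is Some s then env_step e x s else 0.

(* n-step probabilities of a kernel whose row x is supported on x S. *)
Fixpoint nstep (P : G -> G -> R) (n : nat) (x y : G) : R :=
  if n is n'.+1 then
    \sum_(s <- S) P x (x * s)%g * nstep P n' (x * s)%g y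
  else (x == y)%:R.

(* For irreducible P the limsup does not depend on the base point, here 1. *)
Definition spectral_radius (P : G -> G -> R) : \bar R :=
  limn_esup (fun n => (nstep P n 1%g 1%g `^ n%:R^-1)%:E).

End environment.
Arguments step_laws R {G} S.
Arguments offspring_laws R : clear implicits.

Section branching_markov_chain.
Context (R : realType) (G : groupType).
Variables (P : G -> G -> R) (mu : G -> nat -> R).

(* Probability that the particles produced in one time step by a particle at x
   are, listed in order, at the positions l. *)
Definition litter_prob (x : G) (l : seq G) : R :=
  mu x (size l) * \prod_(y <- l) P x y.

(* Transition probabilities of the list of particle positions: the new list is
   the concatenation of the independent litters of the old particles. *)
Fixpoint generation_prob (z z' : seq G) : R :=
  if z is x :: z1 then
    \sum_(j < (size z').+1)
      litter_prob x (take j z') * generation_prob z1 (drop j z')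
  else (z' == [::])%:R.

(* Z n lists the positions x_1(n), ..., x_eta(n)(n) of the particles at time n;
   seq G carries the discrete sigma-algebra (G will be countable). *)
Definition is_BMC d (T : measurableType d) (Pr : probability T R)
    (x : G) (Z : nat -> T -> seq G) :=
  (forall n z, measurable [set t | Z n t = z]) /\
  forall n (z : nat -> seq G),
    Pr [set t | forall i, (i <= n)%N -> Z i t = z i] =
    ((z 0%N == [:: x])%:R *
     \prod_(i < n) generation_prob (z i) (z i.+1))%:E.

Definition infinitely_many_visits (T : Type) (Z : nat -> T -> seq G) (x : G) :
    set T :=
  [set t | (\sum_(1 <= n <oo) (count_mem x (Z n t))%:R%:E = +oo :> \bar R)%E].

(* alpha(x) = a.  When the P x and mu x are probabilities, is_BMC is the system
   of finite-dimensional distributions of a Markov chain on a countable space: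
   realizations exist by Kolmogorov's extension theorem, and all of them give
   this event the same probability. *)
Definition return_prob_eq (x : G) (a : \bar R) :=
  forall d (T : measurableType d) (Pr : probability T R)
    (Z : nat -> T -> seq G),
    is_BMC Pr x Z -> Pr (infinitely_many_visits Z x) = a.

Definition transient := forall x, return_prob_eq x 0%E.

Definition strongly_recurrent := forall x, return_prob_eq x 1%E.

End branching_markov_chain.

(* Main.v *)
(* Let u(x) be the probability that the process started at x visits b infinitely
   often, and g_x the generating function of the offspring law at x. The branching
   property gives 1 - u <= g_x(P(1 - u)) and a matching upper bound for u.

   Transience. Almost surely every mean m(x) is at most 1/rho, so K = m P has
   spectral radius at most 1 and its Green function damped by t < 1 is finite.
   The damped Green functions dominate the hitting probabilities, which gives
   K^N u(b) <= 1 for all N. Since u <= K u - (1 - mu_x(1)) (P u)^2, telescoping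
   together with the recurrence or transience of K forces u = 0, because the
   quadratic defect is positive at some x.

   Recurrence. If m* > 1/rho, then for some n a fixed, positive probability
   pattern of the environment on the ball of radius n makes the process killed
   outside that ball supercritical; at the centre of such a seed u is bounded
   below. Tile the group by disjoint cells of this shape. A random walk meets
   infinitely many cells, and when it enters a new one this is a seed with a
   fixed probability independent of the past, so in almost every environment
   the walk reaches a seed. As 1 - u is subharmonic for P, its supremum V is then
   the supremum over cells containing a seed, where the strict convexity of g
   gives V <= V - c V (1 - V); as 1 - u is bounded away from 1 there, V = 0. *)
Require Import Defs.
From HB Require Import structures.
From mathcomp Require Import all_boot all_order all_algebra finmap.
From mathcomp Require Import all_classical all_reals all_analysis.
From mathcomp Require Import measurable_realfun lra ring.
Import Order.TTheory GRing.Theory Num.Theory.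
Import numFieldNormedType.Exports.
Set Implicit Arguments.
Unset Strict Implicit.
Unset Printing Implicit Defensive.
Local Open Scope classical_set_scope.
Local Open Scope ring_scope.

(** Three obstacles shape the argument. At m* = 1/rho the kernel K may be recurrent, so first
    moments do not decide, and only damped Green functions are known to be finite. The remedy is to
    compare over a finite horizon: the damping is removed before the horizon grows, and the
    quadratic term of the generating function settles the recurrent case. A seed must have positive
    probability although Q and the offspring law may be diffuse and the mean is not continuous for
    pointwise convergence. Seeds are therefore given by lower bounds only: rational bounds on step
    weights, of which there are countably many patterns, and bounds on finitely many offspring
    weights. The survival estimate is monotone in these. The walk that looks for seeds moves in the
    very environment that contains them, and no rate of escape is available. So the search is
    measured by the number of new cells instead of time, and the weight of fruitless paths is
    averaged over the environment, cell by cell, before a single environment is fixed. *)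

(** * Finite-range kernels acting on functions *)

Section kernel.
Context (R : realType) (G : groupType) (S : {fset G}).
Implicit Types (P : G -> G -> R) (h : G -> R).

Definition avg P h (x : G) : R := \sum_(s <- S) P x (x * s)%g * h (x * s)%g.

Definition ind (b : G) : G -> R := fun x => (x == b)%:R.

Lemma nstepE P n x y : nstep S P n x y = iter n (avg P) (ind y) x.
Proof.
elim: n x => [//|n IH] x /=; apply: eq_bigr => s _.
by rewrite IH.
Qed.

Lemma avgZ P a h x : avg P (fun y => a * h y) x = a * avg P h x.
Proof. by rewrite /avg mulr_sumr; apply: eq_bigr => s _; rewrite mulrCA. Qed.

Lemma avgB P h h' x : avg P (fun y => h y - h' y) x = avg P h x - avg P h' x.
Proof.
by rewrite /avg -sumrB; apply: eq_bigr => s _; rewrite mulrBr.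
Qed.

Lemma iter_avgB P n h h' x :
  iter n (avg P) (fun y => h y - h' y) x =
  iter n (avg P) h x - iter n (avg P) h' x.
Proof.
elim: n x => //= n IH x; rewrite -avgB; congr avg; exact/funext.
Qed.

Lemma avg_sum P (I : Type) (r : seq I) (h : I -> G -> R) x :
  avg P (fun y => \sum_(i <- r) h i y) x = \sum_(i <- r) avg P (h i) x.
Proof.
rewrite /avg exchange_big /=; apply: eq_bigr => s _; exact: mulr_sumr.
Qed.

Section nonneg.
Variable P : G -> G -> R.
Hypothesis P0 : forall x y, 0 <= P x y.

Lemma avg_le h h' x : (forall y, h y <= h' y) -> avg P h x <= avg P h' x.
Proof. by move=> hh; apply: ler_sum => s _; exact: ler_wpM2l. Qed.

Lemma avg_ge0 h x : (forall y, 0 <= h y) -> 0 <= avg P h x.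
Proof. by move=> hh; apply: sumr_ge0 => s _; exact: mulr_ge0. Qed.

Lemma iter_avg_le n h h' x :
  (forall y, h y <= h' y) -> iter n (avg P) h x <= iter n (avg P) h' x.
Proof. by move=> hh; elim: n x => //= n IH x; exact: avg_le. Qed.

Lemma iter_avgZ n a h x :
  iter n (avg P) (fun y => a * h y) x = a * iter n (avg P) h x.
Proof.
elim: n x => //= n IH x; rewrite -avgZ; congr avg.
exact/funext.
Qed.

Lemma iter_avg_ge0 n h x : (forall y, 0 <= h y) -> 0 <= iter n (avg P) h x.
Proof. by move=> hh; elim: n x => //= n IH x; exact: avg_ge0. Qed.

Lemma ind_ge0 b x : 0 <= ind b x.
Proof. by rewrite /ind ler0n. Qed.

Lemma ge_ind h y : (forall x, 0 <= h x) -> forall x, h y * ind y x <= h x.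
Proof.
by move=> hh x; rewrite /ind; case: eqVneq => [->|_]; rewrite ?mulr1 ?mulr0.
Qed.

Lemma iter_avg_ge n h x y : (forall x, 0 <= h x) ->
  iter n (avg P) (ind y) x * h y <= iter n (avg P) h x.
Proof.
move=> hh; rewrite mulrC -iter_avgZ; apply: iter_avg_le; exact: ge_ind.
Qed.

Lemma nstep_mul n k x y z :
  iter n (avg P) (ind y) x * iter k (avg P) (ind z) y <=
  iter (n + k) (avg P) (ind z) x.
Proof.
rewrite iterD; apply: iter_avg_ge => w; exact/iter_avg_ge0/ind_ge0.
Qed.

End nonneg.

Lemma avg_ler_kernel P P' h x : (forall y, 0 <= h y) ->
  (forall y, P x y <= P' x y) -> avg P h x <= avg P' h x.
Proof. by move=> hh PP; apply: ler_sum => s _; exact: ler_wpM2r. Qed.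

Lemma cvg_avg P (hn : nat -> G -> R) h x :
  (forall y, hn ^~ y @ \oo --> h y) ->
  (fun n => avg P (hn n) x) @ \oo --> avg P h x.
Proof.
move=> hcvg; rewrite /avg.
apply: (cvg_big (op := +%R) (x0 := 0)) => [|s _]; first exact: add_continuous.
by apply: cvgMl_tmp; exact: hcvg.
Qed.

End kernel.

(** * Recursion for hitting probabilities and its limits *)

Section avoidance.
Context (R : realType) (G : groupType) (S : {fset G}).
Variables (P : G -> G -> R) (g : G -> R -> R) (b : G).

(* The probability that, starting from one particle at x, no particle sits at b
   at any time i with n <= i <= N. *)
Fixpoint avoid (N n : nat) (x : G) : R :=
  (if n is 0 then (x != b)%:R else 1) *
  (if N is N'.+1 then g x (avg S P (avoid N' n.-1) x) else 1).

Definition hit N n x := 1 - avoid N n x.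

(** The supremum is an increasing limit in N, and the infimum in [hit_io] a decreasing limit in n.
    When [g x] is the offspring generating function at x, [hit_io x] is the probability of
    infinitely many visits to b, see [Pr_infinitely_many_visits]. *)
Definition hit_from n x := sup (range (fun N => hit N n x)).

Definition hit_io x := inf (range (fun n => hit_from n x)).

Hypothesis P0 : forall x y, 0 <= P x y.
Hypothesis P1 : forall x, \sum_(s <- S) P x (x * s)%g = 1.
Hypothesis g0 : forall x (t : R), 0 <= t <= 1 -> 0 <= g x t.
Hypothesis g_le : forall x (t : R), 0 <= t <= 1 -> g x t <= t.
Hypothesis g_mono : forall x (s t : R), 0 <= s -> s <= t -> t <= 1 -> g x s <= g x t.

Lemma avg_cst a x : avg S P (fun=> a) x = a.
Proof. by rewrite /avg -mulr_suml P1 mul1r. Qed.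

Lemma avg_itv h x : (forall y, 0 <= h y <= 1) -> 0 <= avg S P h x <= 1.
Proof.
move=> hh; rewrite avg_ge0//=; last by move=> y; case/andP: (hh y).
by rewrite -[leRHS](avg_cst 1 x) avg_le// => y; case/andP: (hh y).
Qed.

Lemma avg1B h x : avg S P (fun y => 1 - h y) x = 1 - avg S P h x.
Proof. by rewrite avgB avg_cst. Qed.

Lemma avoid0_ge0 n x : 0 <= if n is 0%N then (x != b)%:R else 1 :> R.
Proof. by case: n => //; rewrite ler0n. Qed.

Lemma avoid_itv N n x : 0 <= avoid N n x <= 1.
Proof.
elim: N n x => [|N IH] n x /=.
  by rewrite mulr1; case: n => [|n]; case: (x != b); rewrite ?ler01 ?lexx.
have /andP[a0 a1] := avg_itv x (IH n.-1).
have gt0 : 0 <= g x (avg S P (avoid N n.-1) x) by apply: g0; rewrite a0.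
have gt1 : g x (avg S P (avoid N n.-1) x) <= 1.
  by apply: (le_trans _ a1); apply: g_le; rewrite a0.
case: n a0 a1 gt0 gt1 => [|n] /= a0 a1 gt0 gt1; last by rewrite mul1r gt0.
by case: (x != b); rewrite ?mul1r ?mul0r ?lexx ?ler01 ?gt0.
Qed.

Lemma avoidN N n x : avoid N.+1 n x <= avoid N n x.
Proof.
elim: N n x => [|N IH] n x.
  rewrite /= mulr1.
  have /andP[a0 a1] := avg_itv x (avoid_itv 0 n.-1).
  have gt1 : g x (avg S P (avoid 0 n.-1) x) <= 1.
    by apply: (le_trans _ a1); apply: g_le; rewrite a0.
  by apply: ler_piMr => //; exact: avoid0_ge0.
rewrite [leLHS]/= [leRHS]/=; apply: ler_wpM2l; first by exact: avoid0_ge0.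
have /andP[a0 a1] := avg_itv x (avoid_itv N n.-1).
have /andP[a0' a1'] := avg_itv x (avoid_itv N.+1 n.-1).
by apply: g_mono => //; apply: avg_le => // y; exact: IH.
Qed.

Lemma avoidn N n x : avoid N n x <= avoid N n.+1 x.
Proof.
elim: N n x => [|N IH] n x.
  by rewrite /= !mulr1; case: n => [|n] //; case: (x != b).
have /andP[a0 a1] := avg_itv x (avoid_itv N n.-1).
have /andP[a0' a1'] := avg_itv x (avoid_itv N n).
rewrite [leLHS]/= [leRHS]/= mul1r.
case: n a0 a1 a0' a1' => [|n] /= a0 a1 a0' a1'.
  by apply: ler_piMl; [rewrite g0// a0|case: (x != b); rewrite ?ler01 ?lexx].
by rewrite mul1r; apply: g_mono => //; exact: avg_le.
Qed.

Lemma hit_itv N n x : 0 <= hit N n x <= 1.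
Proof. by have := avoid_itv N n x; rewrite /hit; lra. Qed.

Lemma hit_nd n x : nondecreasing_seq (fun N => hit N n x).
Proof. by apply/nondecreasing_seqP => N; rewrite /hit lerB// avoidN. Qed.

Lemma hit_cvg n x : (fun N => hit N n x) @ \oo --> hit_from n x.
Proof.
apply: nondecreasing_cvgn; first exact: hit_nd.
by exists 1 => _ [N _ <-]; case/andP: (hit_itv N n x).
Qed.

Lemma hit_le_from N n x : hit N n x <= hit_from n x.
Proof.
by apply: ub_le_sup; [exists 1 => _ [M _ <-]; case/andP: (hit_itv M n x)|exists N].
Qed.

Lemma hit_from_le n x t : (forall N, hit N n x <= t) -> hit_from n x <= t.
Proof.
move=> ht; apply: sup_le_ub => [|_ [N _ <-]] //.
by exists (hit 0 n x); exists 0%N.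
Qed.

Lemma hit_from_itv n x : 0 <= hit_from n x <= 1.
Proof.
apply/andP; split; last by apply: hit_from_le => N; case/andP: (hit_itv N n x).
by apply: le_trans (hit_le_from 0 n x); case/andP: (hit_itv 0 n x).
Qed.

Lemma hit_from_ni x : nonincreasing_seq (fun n => hit_from n x).
Proof.
apply/nonincreasing_seqP => n; apply: hit_from_le => N.
by apply: le_trans (hit_le_from N n x); rewrite /hit lerB// avoidn.
Qed.

Lemma hit_from_cvg x : (fun n => hit_from n x) @ \oo --> hit_io x.
Proof.
apply: nonincreasing_cvgn; first exact: hit_from_ni.
by exists 0 => _ [n _ <-]; case/andP: (hit_from_itv n x).
Qed.

Lemma hit_io_le n x : hit_io x <= hit_from n x.
Proof.
by apply: ge_inf; [exists 0 => _ [m _ <-]; case/andP: (hit_from_itv m x)|exists n].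
Qed.

Lemma hit_io_ge x t : (forall n, t <= hit_from n x) -> t <= hit_io x.
Proof.
move=> ht; apply: lb_le_inf => [|_ [n _ <-]] //.
by exists (hit_from 0 x); exists 0%N.
Qed.

Lemma hit_io_itv x : 0 <= hit_io x <= 1.
Proof.
apply/andP; split; first by apply: hit_io_ge => n; case/andP: (hit_from_itv n x).
by apply: le_trans (hit_io_le 0 x) _; case/andP: (hit_from_itv 0 x).
Qed.

Lemma hitS N n x : hit N.+1 n.+1 x = 1 - g x (1 - avg S P (hit N n) x).
Proof.
rewrite /hit /= mul1r; congr (1 - g x _).
by rewrite avg1B opprB addrC subrK.
Qed.

Lemma hitS0 N x : hit N.+1 0 x =
  if x == b then 1 else 1 - g x (1 - avg S P (hit N 0) x).
Proof.
rewrite -hitS /hit /=; case: (x == b); first by rewrite mul0r subr0.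
by [].
Qed.

Section upper.
Variables (m kap : G -> R).
Hypothesis m0 : forall x, 0 <= m x.
Hypothesis kap0 : forall x, 0 <= kap x.
Hypothesis g_lower : forall x (t : R), 0 <= t <= 1 ->
  1 - g x (1 - t) <= m x * t - kap x * t ^+ 2.

Definition mean_kernel x y := m x * P x y.

Lemma avg_mean_kernel h x : avg S mean_kernel h x = m x * avg S P h x.
Proof. by rewrite /avg mulr_sumr; apply: eq_bigr => s _; rewrite mulrA. Qed.

Lemma mean_kernel_ge0 x y : 0 <= mean_kernel x y.
Proof. exact: mulr_ge0. Qed.

Let K := mean_kernel.
Let K0 := mean_kernel_ge0.

Lemma hitS_le N n x : hit N.+1 n.+1 x <=
  avg S K (hit N n) x - kap x * avg S P (hit N n) x ^+ 2.
Proof.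
by rewrite hitS avg_mean_kernel; apply: g_lower; exact/avg_itv/hit_itv.
Qed.

Lemma hitS_leK N n x : hit N.+1 n.+1 x <= avg S K (hit N n) x.
Proof.
apply: le_trans (hitS_le N n x) _.
by rewrite gerBl mulr_ge0// sqr_ge0.
Qed.

Lemma hit0_leK N x : x != b -> hit N.+1 0 x <= avg S K (hit N 0) x.
Proof.
move=> xb; apply: le_trans (hitS_leK N 0 x).
by rewrite hitS0 (negbTE xb) hitS.
Qed.

(** The bound [hitS_le] survives the limit in N and then the limit in n, because averages over the
    finite set S are continuous. *)
Lemma hit_io_subharmonic x :
  hit_io x <= avg S K hit_io x - kap x * avg S P hit_io x ^+ 2.
Proof.
have step n : hit_from n.+1 x <=
    avg S K (hit_from n) x - kap x * avg S P (hit_from n) x ^+ 2.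
  have cK := cvg_avg (S := S) (P := K) (x := x) (fun y => hit_cvg (n := n) (x := y)).
  have cP := cvg_avg (S := S) (P := P) (x := x) (fun y => hit_cvg (n := n) (x := y)).
  have c1 : (fun N => hit N.+1 n.+1 x) @ \oo --> hit_from n.+1 x.
    by rewrite (cvg_shiftS (fun N => hit N n.+1 x)); exact: hit_cvg.
  have c2 : (fun N => avg S K (hit N n) x - kap x * avg S P (hit N n) x ^+ 2)
      @ \oo --> avg S K (hit_from n) x - kap x * avg S P (hit_from n) x ^+ 2.
    by apply: cvgB => //; apply: cvgMl_tmp; rewrite expr2; exact: cvgM.
  apply: (ler_cvg_to c1 c2).
  by apply: nearW => N; exact: hitS_le.
have cK := cvg_avg (S := S) (P := K) (x := x) (fun y => hit_from_cvg (x := y)).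
have cP := cvg_avg (S := S) (P := P) (x := x) (fun y => hit_from_cvg (x := y)).
have c1 : (fun n => hit_from n.+1 x) @ \oo --> hit_io x.
  by rewrite (cvg_shiftS (fun n => hit_from n x)); exact: hit_from_cvg.
have c2 : (fun n => avg S K (hit_from n) x - kap x * avg S P (hit_from n) x ^+ 2)
    @ \oo --> avg S K hit_io x - kap x * avg S P hit_io x ^+ 2.
  by apply: cvgB => //; apply: cvgMl_tmp; rewrite expr2; exact: cvgM.
by apply: (ler_cvg_to c1 c2); exact: nearW.
Qed.

(** First-moment bound: [iter k (avg S K) (ind R b) x] is the expected number of particles at b at
    time k. *)
Lemma hit_le_green N n x :
  hit N n x <= \sum_(n <= k < N.+1) iter k (avg S K) (ind R b) x.
Proof.
elim: N n x => [|N IH] n x.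
  case: n => [|n].
    rewrite big_nat1 /hit /= mulr1 /ind.
    by case: (x == b); rewrite /= ?subr0 ?subrr.
  by rewrite big_geq// /hit /= mulr1 subrr.
have avg_green l : avg S K (fun y => \sum_(l <= k < N.+1)
      iter k (avg S K) (ind R b) y) x =
    \sum_(l.+1 <= k < N.+2) iter k (avg S K) (ind R b) x.
  by rewrite avg_sum big_add1.
case: n => [|n].
  rewrite big_nat_recl//=; case: (eqVneq x b) => [->|xb].
    rewrite hitS0 eqxx /ind eqxx lerDl sumr_ge0// => k _.
    by apply: avg_ge0 => // y; apply: iter_avg_ge0 => // z; exact: ind_ge0.
  apply: le_trans (hit0_leK N xb) _.
  apply: (@le_trans _ _ (avg S K (fun y => \sum_(0 <= k < N.+1)
      iter k (avg S K) (ind R b) y) x)); first exact: avg_le.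
  by rewrite avg_green big_add1 /= ler_wpDl// ind_ge0.
apply: le_trans (hitS_leK N n x) _; rewrite -avg_green.
by apply: avg_le.
Qed.

End upper.
End avoidance.

(** * Kernels with bounded damped Green functions: no infinite return *)

Lemma bernoulli_onem (R : realType) (e : R) n :
  0 <= e <= 1 -> 1 - n%:R * e <= (1 - e) ^+ n.
Proof.
move=> /andP[e0 e1]; elim: n => [|n IH]; first by rewrite mul0r subr0 expr0.
rewrite exprS -natr1.
have : (1 - e) * (1 - n%:R * e) <= (1 - e) * (1 - e) ^+ n.
  by apply: ler_wpM2l => //; rewrite subr_ge0.
apply: le_trans.
have : 0 <= n%:R * e * e by rewrite !mulr_ge0.
lra.
Qed.

Lemma le1_of_expr_lt1 (R : realType) (a : R) n :
  (forall t, 0 < t < 1 -> t ^+ n * a <= 1) -> a <= 1.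
Proof.
move=> h; rewrite leNgt; apply/negP => a1.
have a0 : 0 < a by lra.
(* With t = 1 - e, Bernoulli gives t^n >= 1 - n e, and n e stays strictly below (n + 2) e = 1 - 1/a.
   The 2 also keeps e < 1 when n is 0. *)
pose e := (1 - a^-1) / (n.+2%:R).
have ai : 0 < 1 - a^-1 < 1.
  rewrite subr_gt0 invf_lt1// a1 /= gtrBl invr_gt0//.
have n2 : (2 : R) <= n.+2%:R by rewrite ler_nat.
have e0 : 0 < e by rewrite divr_gt0//; lra.
have ee : e * n.+2%:R = 1 - a^-1 by rewrite mulfVK// gt_eqF//; lra.
have e1 : e < 1.
  have : e * 2 <= e * n.+2%:R by rewrite ler_pM2l.
  lra.
have /(h (1 - e)) : 0 < 1 - e < 1 by lra.
have : 1 - n%:R * e <= (1 - e) ^+ n by apply: bernoulli_onem; lra.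
have n2E : n.+2%:R = n%:R + 2 :> R by rewrite -addn2 natrD.
have : a^-1 < 1 - n%:R * e by move: ee; rewrite n2E mulrDr (mulrC e n%:R); lra.
move=> h1 h2.
have {h1 h2} : a^-1 < (1 - e) ^+ n by lra.
by rewrite -(ltr_pM2r a0) mulVf ?gt_eqF//; lra.
Qed.

Section transience.
Context (R : realType) (G : groupType) (S : {fset G}).
Variables (K : G -> G -> R) (b : G).
Hypothesis K0 : forall x y, 0 <= K x y.

Lemma cvg_iter_avg n (hn : nat -> G -> R) h x :
  (forall y, hn ^~ y @ \oo --> h y) ->
  (fun k => iter n (avg S K) (hn k) x) @ \oo --> iter n (avg S K) h x.
Proof.
move=> hcvg; elim: n x => [|n IH] x; first exact: hcvg.
exact: cvg_avg.
Qed.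

Lemma iter_telescope N (h : G -> R) x :
  \sum_(0 <= k < N) iter k (avg S K) (fun y => avg S K h y - h y) x =
  iter N (avg S K) h x - h x.
Proof.
elim: N => [|N IH]; first by rewrite big_geq// subrr.
by rewrite big_nat_recr//= IH iter_avgB -iterSr /= addrC subrKA.
Qed.

Definition green (t : R) N x :=
  \sum_(0 <= k < N) t ^+ k * iter k (avg S K) (ind R b) x.

Section subcritical.
Variable t : R.
Hypothesis t0 : 0 < t.
Hypothesis green_bounded : forall x, exists C, forall N, green t N x <= C.

(** f is the limit of the truncated Green functions. Applying t K to it drops the term k = 0, whence
    the inequality; that same term makes f positive at b. *)
Lemma green_superharmonic : exists f : G -> R,
  [/\ forall x, 0 <= f x, 0 < f b & forall x, t * avg S K f x <= f x].
Proof.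
have nd x : nondecreasing_seq (fun N => green t N x).
  apply/nondecreasing_seqP => N; rewrite /green big_nat_recr//= lerDl.
  apply: mulr_ge0; first exact/exprn_ge0/ltW.
  by apply: iter_avg_ge0 => // y; exact: ind_ge0.
have ubd x : has_ubound (range (fun N => green t N x)).
  by have [C hC] := green_bounded x; exists C => _ [N _ <-].
pose f x := sup (range (fun N => green t N x)).
have fcvg x : (fun N => green t N x) @ \oo --> f x by exact: nondecreasing_cvgn.
have gf N x : green t N x <= f x by apply: ub_le_sup => //; exists N.
exists f; split => [x||x].
- by apply: le_trans (gf 0%N x); rewrite /green big_geq.
- by apply: lt_le_trans (gf 1%N b); rewrite /green big_nat1 expr0 mul1r /= /ind eqxx.
- have c : (fun N => t * avg S K (green t N) x) @ \oo --> t * avg S K f x.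
    by apply: cvgMl_tmp; apply: cvg_avg.
  apply: (cvgr_to_le c); apply: nearW => N; apply: le_trans (gf N.+1 x).
  rewrite /green avg_sum mulr_sumr big_nat_recl//= ler_wpDl ?mulr_ge0 ?ind_ge0//.
  by apply: ler_sum => k _; rewrite avgZ mulrA -exprS.
Qed.

End subcritical.

End transience.

Section transience.
Context (R : realType) (G : groupType) (S : {fset G}).
Variables (P : G -> G -> R) (g : G -> R -> R) (b : G).
Variables (m kap : G -> R) (x0 : G).
Let K := mean_kernel P m.
Hypothesis P0 : forall x y, 0 <= P x y.
Hypothesis P1 : forall x, \sum_(s <- S) P x (x * s)%g = 1.
Hypothesis g0 : forall x (t : R), 0 <= t <= 1 -> 0 <= g x t.
Hypothesis g_le : forall x (t : R), 0 <= t <= 1 -> g x t <= t.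
Hypothesis g_mono : forall x (s t : R), 0 <= s -> s <= t -> t <= 1 -> g x s <= g x t.
Hypothesis m0 : forall x, 0 <= m x.
Hypothesis kap0 : forall x, 0 <= kap x.
Hypothesis kapx0 : 0 < kap x0.
Hypothesis g_lower : forall x (t : R), 0 <= t <= 1 ->
  1 - g x (1 - t) <= m x * t - kap x * t ^+ 2.
Hypothesis K_irr : forall x y, exists n, 0 < iter n (avg S K) (ind R y) x.
Hypothesis green_bounded : forall (t : R) x, 0 < t < 1 ->
  exists C, forall N, green S K b t N x <= C.

Let K0 x y : 0 <= K x y. Proof. exact: mean_kernel_ge0. Qed.
Let io := hit_io S P g b.

(** For fixed M and N the comparison with f loses only the factor t^(M + N), so t can tend to 1
    before M tends to infinity. This works whether K is transient or recurrent. *)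
Let K_hit_from_le1 N : iter N (avg S K) (hit_from S P g b 0) b <= 1.
Proof.
have c : (fun M => iter N (avg S K) (hit S P g b M 0) b) @ \oo -->
    iter N (avg S K) (hit_from S P g b 0) b.
  by apply: cvg_iter_avg => y; exact: hit_cvg.
apply: (cvgr_to_le c); apply: nearW => M.
apply: (@le1_of_expr_lt1 _ _ (M + N)) => t /andP[t0 t1].
have [|f [f0 fb ft]] := @green_superharmonic _ _ S K b K0 t t0.
  by move=> x; apply: green_bounded; rewrite t0.
(* f / f b equals 1 at b and dominates its image under t K, so it dominates the chance of a hit
   within M steps once each step is damped by t. *)
have hf x : t ^+ M * hit S P g b M 0 x * f b <= f x.
  elim: M x {c} => [|M IH] x.
    rewrite expr0 mul1r /hit /= mulr1; case: eqVneq => [->|_] /=.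
      by rewrite subr0 mul1r.
    by rewrite subrr mul0r.
  case: (eqVneq x b) => [->|xb].
    rewrite hitS0// eqxx mulr1; apply: ler_piMl; first exact: ltW.
    by apply: exprn_ile1; exact: ltW.
  apply: le_trans (ft x).
  have -> : t ^+ M.+1 * hit S P g b M.+1 0 x * f b =
      t * (f b * t ^+ M * hit S P g b M.+1 0 x) by rewrite exprS; ring.
  rewrite ler_pM2l//; apply: (@le_trans _ _
      (avg S K (fun y => (f b * t ^+ M) * hit S P g b M 0 y) x)).
    rewrite avgZ; apply: ler_wpM2l; last by apply: (hit0_leK P0 P1 g0 g_le kap0 g_lower).
    by apply: mulr_ge0; [exact: ltW|exact/exprn_ge0/ltW].
  by apply: avg_le => // y; rewrite -mulrA mulrC.
have fN x : t ^+ N * iter N (avg S K) f x <= f x.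
  elim: N x {c} => [|n IH] x; first by rewrite expr0 mul1r.
  rewrite exprSr -mulrA; apply: le_trans (IH x).
  by rewrite ler_pM2l ?exprn_gt0// iterSr -iter_avgZ; apply: iter_avg_le.
rewrite -(ler_pM2r fb) mul1r; apply: le_trans (fN b).
have -> : t ^+ (M + N) * iter N (avg S K) (hit S P g b M 0) b * f b =
    t ^+ N * (f b * t ^+ M * iter N (avg S K) (hit S P g b M 0) b).
  by rewrite exprD; ring.
rewrite ler_pM2l ?exprn_gt0// -iter_avgZ//.
by apply: iter_avg_le => // y; rewrite -mulrA mulrC.
Qed.

Theorem hit_io_eq0 : io b = 0.
Proof.
have io0 x : 0 <= io x by have /andP[] := hit_io_itv b P0 P1 g0 g_le x.
apply/eqP; rewrite eq_le io0 andbT.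
(* If the undamped Green function at b is finite, io b is bounded by each of its tails; this is
   expressed as every partial sum staying below s by at least io b. *)
have [[C hC]|hC] := pselect (exists C, forall N, green S K b 1 N b <= C).
  pose s := sup (range (fun N => green S K b 1 N b)).
  have ubd : has_ubound (range (fun N => green S K b 1 N b)).
    by exists C => _ [N _ <-].
  suff : s <= s - io b by lra.
  apply: sup_le_ub => [|_ [N _ <-]]; first by exists (green S K b 1 0 b); exists 0%N.
  suff : io b <= s - green S K b 1 N b by lra.
  apply: le_trans (hit_io_le b P0 P1 g0 g_le N b) _.
  apply: hit_from_le => // M.
  apply: le_trans (hit_le_green b P0 P1 g0 g_le m0 kap0 g_lower M N b) _.
  have [MN|MN] := leqP N M.+1; last first.
    rewrite big_geq; last exact: ltnW.
    by rewrite subr_ge0; apply: ub_le_sup => //; exists N.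
  have : green S K b 1 M.+1 b <= s by apply: ub_le_sup => //; exists M.+1.
  rewrite /green.
  rewrite lerBrDl; apply: le_trans; rewrite [leRHS](@big_cat_nat _ _ _ N)//= lerD2l.
  by apply: ler_sum => k _; rewrite expr1n mul1r.
pose d x := avg S K io x - io x.
have d0 x : 0 <= d x.
  rewrite subr_ge0.
  apply: le_trans (hit_io_subharmonic b P0 P1 g0 g_le g_mono g_lower x) _.
  by rewrite gerBl mulr_ge0// sqr_ge0.
have sumd N : \sum_(0 <= k < N) iter k (avg S K) d b <= 1.
  rewrite iter_telescope lerBlDr -[leLHS]addr0 lerD// ?io0//.
  apply: le_trans (K_hit_from_le1 N); apply: iter_avg_le => // y.
  exact: hit_io_le.
have dE x : d x = 0.
  apply/eqP; rewrite eq_le d0 andbT leNgt; apply/negP => dx.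
  have [l hl] := K_irr b x.
  (* Each unit of expected mass at b yields, l steps later, at least c in the telescoping sum. As
     that sum is at most 1, the Green function at b would be bounded by 1/c. *)
  set c := iter l (avg S K) (ind R x) b * d x.
  have c0 : 0 < c by rewrite mulr_gt0.
  apply: hC; exists c^-1 => N.
  rewrite -(ler_pM2r c0) mulVf ?gt_eqF//; apply: le_trans (sumd (N + l)%N).
  rewrite [leRHS](@big_cat_nat _ _ _ l)//= ?leq_addl//.
  apply: ler_wpDl.
    by apply: sumr_ge0 => k _; apply: iter_avg_ge0.
  rewrite -{1}(add0n l) big_addn addnK /green mulr_suml.
  apply: ler_sum => k _; rewrite expr1n mul1r iterD.
  have : iter k (avg S K) (fun y => c * ind R b y) b <=
    iter k (avg S K) (iter l (avg S K) d) b.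
    apply: iter_avg_le => // y.
    have d_ge0 z : 0 <= iter l (avg S K) d z by exact: iter_avg_ge0.
    apply: le_trans (ge_ind b d_ge0 y).
    by apply: ler_wpM2r; [exact: ind_ge0|exact: iter_avg_ge].
  by rewrite iter_avgZ mulrC.
have ioE x : avg S K io x = io x by apply/eqP; rewrite -subr_eq0; exact/eqP/dE.
(* Since io is now K-harmonic, no room is left for the quadratic defect at x0, and P io vanishes
   there. *)
have := hit_io_subharmonic b P0 P1 g0 g_le g_mono g_lower x0.
rewrite -/io -/K ioE => hx0.
have : avg S P io x0 ^+ 2 <= 0 by rewrite -(pmulr_rle0 _ kapx0); lra.
rewrite real_exprn_even_le0 ?num_real//= => /eqP Pio.
have iox0 : io x0 = 0 by rewrite -ioE avg_mean_kernel Pio mulr0.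
have [l hl] := K_irr x0 b.
have iterio : iter l (avg S K) io = io.
  by elim: l {hl} => //= l ->; exact/funext.
have : iter l (avg S K) (ind R b) x0 * io b <= 0.
  by rewrite -[leRHS]iox0 -[in leRHS]iterio; apply: iter_avg_ge.
by rewrite pmulr_rle0.
Qed.

End transience.

(** * Generating functions of offspring laws *)

Lemma nneseries_cvg_EFin (R : realType) (f : nat -> R) (l : R) :
  (forall k, 0 <= f k) -> series f @ \oo --> l ->
  (\sum_(k <oo) (f k)%:E = l%:E)%E.
Proof.
move=> f0 fl; rewrite -(cvg_lim _ fl)// -EFin_lim; last by apply/cvg_ex; exists l.
by apply: congr_lim; apply/funext => n /=; rewrite /series /= sumEFin.
Qed.

Lemma series_cvg_nneseries (R : realType) (f : nat -> R) (l : R) :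
  (forall k, 0 <= f k) -> (\sum_(k <oo) (f k)%:E = l%:E)%E ->
  series f @ \oo --> l.
Proof.
move=> f0 fl.
have fc : cvgn (series f) by apply: nnseries_is_cvg => //; rewrite fl ltry.
have := fl; rewrite (nneseries_cvg_EFin f0 fc) => -[<-]; exact: fc.
Qed.

(** Equality holds at k = 2, and each further factor 1 - t costs at most t because the power is at
    most 1; hence the gain t^2 is never lost. *)
Lemma expr_onem_ge (R : realType) (t : R) k : 0 <= t <= 1 -> (2 <= k)%N ->
  1 - k%:R * t + t ^+ 2 <= (1 - t) ^+ k.
Proof.
move=> /andP[t0 t1]; elim: k => // -[|[|k]] // IH _.
  by rewrite !expr2; lra.
have {IH} := IH isT; set e := (1 - t) ^+ k.+2 => IH.
have e1 : e <= 1 by apply: exprn_ile1; lra.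
rewrite [leRHS]exprS -/e -(natr1 k.+2).
have : t * e <= t by apply: ler_piMr.
move: IH; lra.
Qed.

Lemma expr_onem_le (R : realType) (t : R) k : 0 <= t <= 1 ->
  (1 - t) ^+ k <= 1 - k%:R * t + (k%:R * t) ^+ 2.
Proof.
move=> /andP[t0 t1]; elim: k => [|k IH].
  by rewrite expr0 mul0r expr0n /=; lra.
rewrite exprS; apply: (@le_trans _ _ ((1 - t) * (1 - k%:R * t + (k%:R * t) ^+ 2))).
  by apply: ler_wpM2l => //; lra.
rewrite -natr1 -subr_ge0.
have -> : 1 - (k%:R + 1) * t + ((k%:R + 1) * t) ^+ 2 -
   (1 - t) * (1 - k%:R * t + (k%:R * t) ^+ 2) =
   (k%:R + 1) * t ^+ 2 + k%:R ^+ 2 * t ^+ 3 by ring.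
by rewrite addr_ge0// !mulr_ge0// ?exprn_ge0// addr_ge0.
Qed.

Section generating_function.
Context (R : realType) (nu : nat -> R).

Definition genfun (t : R) : R := limn (series (fun k => nu k * t ^+ k)).

Hypothesis nu_law : offspring_laws R nu.

Let nu0 : nu 0 = 0. Proof. by case: nu_law. Qed.
Let nu_ge0 k : 0 <= nu k. Proof. by case: nu_law. Qed.

Lemma offspring_mass_cvg : series nu @ \oo --> (1 : R).
Proof. by apply: series_cvg_nneseries => //; case: nu_law. Qed.

Lemma offspring_mass_le1 n : series nu n <= 1.
Proof.
rewrite -(cvg_lim (@Rhausdorff R) offspring_mass_cvg).
apply: nondecreasing_cvgn_le; last by apply/cvg_ex; exists 1; exact: offspring_mass_cvg.
by apply/nondecreasing_seqP => k; rewrite !seriesEnat /= big_nat_recr//= lerDl.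
Qed.

Lemma mean_cvg : series (fun k => k%:R * nu k) @ \oo --> fine (mean nu).
Proof.
apply: series_cvg_nneseries => [k|]; first exact: mulr_ge0.
rewrite fineK// ge0_fin_numE; first by case: nu_law.
by apply: nneseries_ge0 => k _ _; rewrite lee_fin mulr_ge0.
Qed.

Lemma genfun_cvg t : 0 <= t <= 1 ->
  series (fun k => nu k * t ^+ k) @ \oo --> genfun t.
Proof.
move=> /andP[t0 t1].
have f0 k : 0 <= nu k * t ^+ k by rewrite mulr_ge0// exprn_ge0.
apply: nnseries_is_cvg => //.
apply: (@le_lt_trans _ _ 1%E); last by rewrite ltry.
have [_ _ <- _] := nu_law; apply: lee_nneseries => k _; rewrite lee_fin//.
by rewrite ler_piMr// exprn_ile1.
Qed.

Lemma genfun_sum t : 0 <= t <= 1 ->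
  (\sum_(k <oo) (nu k * t ^+ k)%:E = (genfun t)%:E)%E.
Proof.
move=> t01; apply: nneseries_cvg_EFin; last exact: genfun_cvg.
by move=> k; rewrite mulr_ge0// exprn_ge0//; case/andP: t01.
Qed.

Lemma genfun_ge0 t : 0 <= t <= 1 -> 0 <= genfun t.
Proof.
move=> t01; apply: (cvgr_to_ge (genfun_cvg t01)); apply: nearW => n.
rewrite seriesEnat; apply: sumr_ge0 => k _.
by rewrite mulr_ge0// exprn_ge0//; case/andP: t01.
Qed.

Lemma genfun_le t : 0 <= t <= 1 -> genfun t <= t.
Proof.
move=> t01; have /andP[t0 t1] := t01.
have c : (fun n => t * series nu n) @ \oo --> t * 1.
  by apply: cvgMl_tmp; exact: offspring_mass_cvg.
rewrite -[leRHS]mulr1.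
apply: (ler_cvg_to (genfun_cvg t01) c); apply: nearW => n.
rewrite !seriesEnat mulr_sumr; apply: ler_sum => -[|k] _.
  by rewrite nu0 mul0r mulr0.
by rewrite mulrC ler_wpM2r// exprS ler_piMr// exprn_ile1.
Qed.

Lemma genfun_mono s t : 0 <= s -> s <= t -> t <= 1 -> genfun s <= genfun t.
Proof.
move=> s0 st t1.
have s01 : 0 <= s <= 1 by rewrite s0 (le_trans st).
have t01 : 0 <= t <= 1 by rewrite t1 (le_trans s0).
apply: (ler_cvg_to (genfun_cvg s01) (genfun_cvg t01)); apply: nearW => n.
rewrite !seriesEnat; apply: ler_sum => k _; apply: ler_wpM2l => //.
by apply: lerXn2r; rewrite ?nnegrE// (le_trans s0).
Qed.

(** Provides the continuity that lets limits pass through the generating function in [miss_le]. *)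
Lemma genfun_lip s t : 0 <= s -> s <= t -> t <= 1 ->
  genfun t - genfun s <= fine (mean nu) * (t - s).
Proof.
move=> s0 st t1.
have s01 : 0 <= s <= 1 by rewrite s0 (le_trans st).
have t01 : 0 <= t <= 1 by rewrite t1 (le_trans s0).
have t0 : 0 <= t by case/andP: t01.
have expB k : t ^+ k - s ^+ k <= k%:R * (t - s).
  elim: k => [|k IH]; first by rewrite !expr0 mul0r subrr.
  have -> : t ^+ k.+1 - s ^+ k.+1 = t * (t ^+ k - s ^+ k) + s ^+ k * (t - s).
    by rewrite !exprS; ring.
  rewrite -natr1 mulrDl mul1r; apply: lerD.
    apply: le_trans IH; apply: ler_piMl => //.
    by rewrite subr_ge0; apply: lerXn2r.
  apply: ler_piMl; first by rewrite subr_ge0.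
  by apply: exprn_ile1 => //; case/andP: s01.
have c1 : (fun n => series (fun k => nu k * t ^+ k) n -
    series (fun k => nu k * s ^+ k) n) @ \oo --> genfun t - genfun s.
  by apply: cvgB; exact: genfun_cvg.
have c2 : (fun n => series (fun k => k%:R * nu k) n * (t - s)) @ \oo -->
    fine (mean nu) * (t - s) by apply: cvgMr_tmp; exact: mean_cvg.
apply: (ler_cvg_to c1 c2); apply: nearW => n.
rewrite !seriesEnat /= -sumrB mulr_suml; apply: ler_sum => k _.
by rewrite -mulrBr -mulrA mulrCA ler_wpM2l.
Qed.

Let series_split2 (f : nat -> R) n : series f n.+2 =
  f 0 + f 1 + \sum_(0 <= k < n) f k.+2.
Proof. by rewrite seriesEnat /= !big_nat_recl//= addrA. Qed.

(** This is [expr_onem_ge] averaged over litters of size k >= 2, whose total mass is 1 - nu 1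
    because nu 0 = 0. *)
Lemma genfun_lower t : 0 <= t <= 1 ->
  1 - genfun (1 - t) <= fine (mean nu) * t - (1 - nu 1) * t ^+ 2.
Proof.
move=> t01; have t01' : 0 <= 1 - t <= 1 by lra.
(* Starting at n + 2 isolates the sizes 0 and 1, for which [expr_onem_ge] is false. *)
have c1 : (fun n => series nu n.+2 - series (fun k => nu k * (1 - t) ^+ k) n.+2)
    @ \oo --> 1 - genfun (1 - t).
  apply: cvgB.
    have := offspring_mass_cvg; rewrite -(cvg_shiftn 2).
    by under eq_fun do rewrite addn2.
  have := genfun_cvg t01'; rewrite -(cvg_shiftn 2).
  by under eq_fun do rewrite addn2.
have c2 : (fun n => series (fun k => k%:R * nu k) n.+2 * t -
    (series nu n.+2 - nu 1) * t ^+ 2)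
    @ \oo --> fine (mean nu) * t - (1 - nu 1) * t ^+ 2.
  apply: cvgB; apply: cvgMr_tmp.
    have := mean_cvg; rewrite -(cvg_shiftn 2).
    by under eq_fun do rewrite addn2.
  apply: cvgB; last exact: cvg_cst.
  have := offspring_mass_cvg; rewrite -(cvg_shiftn 2).
  by under eq_fun do rewrite addn2.
apply: (ler_cvg_to c1 c2); apply: nearW => n.
rewrite !series_split2 nu0 expr1 !mul0r !add0r mul1r.
set A := \sum_(0 <= k < n) nu k.+2.
set B := \sum_(0 <= k < n) nu k.+2 * _; set C := \sum_(0 <= k < n) k.+2%:R * _.
have : A - B <= C * t - A * t ^+ 2.
  rewrite /A /B /C 2!mulr_suml -!sumrB; apply: ler_sum => k _.
  have := ler_wpM2l (nu_ge0 k.+2) (expr_onem_ge t01 (isT : 2 <= k.+2)%N); lra.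
lra.
Qed.

Lemma genfun_upper t : 0 <= t <= 1 ->
  genfun t <= t - (1 - nu 1) * (t * (1 - t)).
Proof.
move=> t01; have /andP[t0 t1] := t01.
have c1 : (fun n => series (fun k => nu k * t ^+ k) n.+2)
    @ \oo --> genfun t.
  have := genfun_cvg t01; rewrite -(cvg_shiftn 2).
  by under eq_fun do rewrite addn2.
have c2 : (fun n => nu 1 * t + (series nu n.+2 - nu 1) * t ^+ 2)
    @ \oo --> nu 1 * t + (1 - nu 1) * t ^+ 2.
  apply: cvgD; first exact: cvg_cst.
  apply: cvgMr_tmp; apply: cvgB; last exact: cvg_cst.
  have := offspring_mass_cvg; rewrite -(cvg_shiftn 2).
  by under eq_fun do rewrite addn2.
have -> : t - (1 - nu 1) * (t * (1 - t)) = nu 1 * t + (1 - nu 1) * t ^+ 2 by ring.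
apply: (ler_cvg_to c1 c2); apply: nearW => n.
rewrite !series_split2 nu0 expr1 !mul0r !add0r addrAC addrN add0r lerD2l mulr_suml.
apply: ler_sum => k _; apply: ler_wpM2l => //.
by rewrite -addn2 exprD -[leRHS]mul1r ler_wpM2r ?exprn_ge0// exprn_ile1.
Qed.

Section truncation.
Variables (c : nat -> R) (L : nat).
Hypothesis c_ge0 : forall k, 0 <= c k.
Hypothesis c_le : forall k, (k < L)%N -> c k <= nu k.

Let mL := \sum_(k < L) k%:R * c k.

(** Finitely many weights are bounded below because such a condition can be imposed with positive
    probability. For k < L the quadratic error (k t)^2 in [expr_onem_le] is at most k t L t, which
    gives a common factor 1 - L t. *)
Lemma genfun_truncation t : 0 <= t <= 1 ->
  mL * (t * (1 - L%:R * t)) <= 1 - genfun (1 - t).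
Proof.
move=> t01; have t01' : 0 <= 1 - t <= 1 by lra.
have /andP[t0 t1] := t01.
have c1 : (fun n => series nu n - series (fun k => nu k * (1 - t) ^+ k) n)
    @ \oo --> 1 - genfun (1 - t).
  by apply: cvgB; [exact: offspring_mass_cvg|exact: genfun_cvg].
have pos k : 0 <= 1 - (1 - t) ^+ k by rewrite subr_ge0 exprn_ile1//; lra.
apply: (cvgr_to_ge c1); exists L => // n /= Ln.
rewrite !seriesEnat /= -sumrB (@big_cat_nat _ _ _ L)//= -[leLHS]addr0 lerD//.
  rewrite big_mkord /mL mulr_suml; apply: ler_sum => k _.
  apply: (@le_trans _ _ (c k * (k%:R * t - (k%:R * t) ^+ 2))).
    rewrite mulrAC mulrC ler_wpM2l//.
    have : (k%:R * t) ^+ 2 <= k%:R * t * (L%:R * t).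
      by rewrite expr2 ler_wpM2l ?mulr_ge0// ler_wpM2r// ler_nat ltnW.
    lra.
  have -> : nu k - nu k * (1 - t) ^+ k = nu k * (1 - (1 - t) ^+ k) by ring.
  apply: (@le_trans _ _ (c k * (1 - (1 - t) ^+ k))).
    by apply: ler_wpM2l => //; have := expr_onem_le k t01; lra.
  by rewrite ler_wpM2r// c_le.
apply: sumr_ge0 => k _.
have -> : nu k - nu k * (1 - t) ^+ k = nu k * (1 - (1 - t) ^+ k) by ring.
exact: mulr_ge0.
Qed.

(** Bounds 1 - nu 1 below in terms of mL and L alone, so that one constant serves all seeds. In the
    truncated mean, size 1 counts at most nu 1 and the sizes from 2 up to L count at most L each. *)
Lemma truncated_mean_le : mL - 1 <= L%:R * (1 - nu 1).
Proof.
have c2 : (fun n => nu 1 + L%:R * (series nu n.+2 - nu 1))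
    @ \oo --> nu 1 + L%:R * (1 - nu 1).
  apply: cvgD; first exact: cvg_cst.
  apply: cvgMl_tmp; apply: cvgB; last exact: cvg_cst.
  have := offspring_mass_cvg; rewrite -(cvg_shiftn 2).
  by under eq_fun do rewrite addn2.
have nu1 : nu 1 <= 1.
  have := offspring_mass_le1 2; rewrite series_split2 nu0 big_geq// add0r addr0.
  by [].
suff : mL <= nu 1 + L%:R * (1 - nu 1) by lra.
apply: (cvgr_to_ge c2); exists L => // n /= Ln.
apply: (@le_trans _ _ (\sum_(0 <= k < L) k%:R * nu k)).
  by rewrite big_mkord; apply: ler_sum => k _; rewrite ler_wpM2l// c_le.
pose f k := (if (k < L)%N then k%:R else 0) * nu k.
have f0 k : 0 <= f k by rewrite /f mulr_ge0//; case: ifP.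
apply: (@le_trans _ _ (series f n.+2)).
  have Ln2 : (L <= n.+2)%N by rewrite (leq_trans Ln)// -addn2 leq_addr.
  rewrite seriesEnat /= [leRHS](@big_cat_nat _ _ _ L)//=.
  apply: (@le_trans _ _ (\sum_(0 <= k < L) f k)); last by rewrite lerDl sumr_ge0.
  by rewrite !big_mkord; apply: ler_sum => k _; rewrite /f ltn_ord.
have -> : series nu n.+2 - nu 1 = \sum_(0 <= k < n) nu k.+2.
  by rewrite series_split2 nu0 add0r addrAC addrN add0r.
rewrite !series_split2 /f nu0 mulr0 add0r; apply: lerD.
  by case: ifP; rewrite ?mul1r ?mul0r.
rewrite mulr_sumr; apply: ler_sum => k _; apply: ler_wpM2r => //.
by case: ifP => // kL; rewrite ler_nat ltnW.
Qed.

End truncation.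
End generating_function.

(** * Sums over lists of particles *)

Lemma countable_seq (T : Type) : countable [set: T] -> countable [set: seq T].
Proof. by move=> /Pcountable[T' ->]. Qed.

Section esum_extra.
Local Open Scope ereal_scope.
Context (R : realType).

Lemma esumZl (T : choiceType) (c : R) (a : T -> \bar R) :
  (0 <= c)%R -> (forall i, 0 <= a i) ->
  \esum_(i in [set: T]) (c%:E * a i) = c%:E * \esum_(i in [set: T]) a i.
Proof.
have upper (c' : R) (b : T -> \bar R) : (0 <= c')%R -> (forall i, 0 <= b i) ->
    \esum_(i in [set: T]) (c'%:E * b i) <= c'%:E * \esum_(i in [set: T]) b i.
  move=> c'0 b0; apply: ge_ereal_sup => _ [X [finX _] <-].
  rewrite fsbig_finite//= -ge0_sume_distrr//.
  rewrite lee_wpmul2l ?lee_fin//.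
  rewrite -fsbig_finite//; apply: ereal_sup_ubound.
  by exists X.
move=> c0 a0; apply/eqP; rewrite eq_le upper//=.
have [->|cn0] := eqVneq c 0%R.
  by rewrite mul0e esum_ge0// => i _; rewrite mul0e.
have {cn0}c0 : (0 < c)%R by rewrite lt0r cn0.
rewrite -[leRHS]mul1e -(mulfV (negbT (gt_eqF c0))) EFinM -muleA.
apply: lee_wpmul2l; first by rewrite lee_fin ltW.
apply: le_trans (upper _ _ _ _).
- apply: le_esum => i _; rewrite muleA -EFinM mulVf ?gt_eqF// mul1e.
  by [].
- by rewrite invr_ge0 ltW.
- by move=> i; rewrite mule_ge0// lee_fin ltW.
Qed.

Lemma measure_countable_bigcup d (T : measurableType d) (I : choiceType)
    (mu : {measure set T -> \bar R}) (F : I -> set T) :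
  countable [set: I] -> (forall i, measurable (F i)) -> trivIset setT F ->
  mu (\bigcup_i F i) = \esum_(i in [set: I]) mu (F i).
Proof.
elim/choicePpointed: I => I in F *.
  by move=> _ _ _; rewrite !emptyE bigcup_set0 measure0 esum_set0.
move=> /countable_bijP[B]; rewrite card_eq_sym => /card_set_bijP[f [_ finj fsurj]].
move=> mF tF.
rewrite (_ : \bigcup_i F i = \bigcup_(n in B) F (f n)); last first.
  apply/seteqP; split => [t [i _ Fi]|t [n Bn Fn]]; last by exists (f n).
  by have [n Bn fn] := fsurj i Logic.I; exists n => //; rewrite fn.
rewrite measure_bigcup//; last first.
  move=> i j Bi Bj Fij; apply: finj; rewrite ?inE//.
  exact: tF Fij.
rewrite -(@esum_set_image _ _ (mu \o F) f B)//.
rewrite (_ : [set f x | x in B] = setT)//.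
by apply/seteqP; split => // i _; exact: fsurj.
Qed.

(** A list with a cut position is the same as a pair of lists: concatenation recovers the list, and
    the size of the first half recovers the cut. *)
Lemma esum_cat (T' : choiceType) (f : seq T' -> seq T' -> R) :
  (forall l l', (0 <= f l l')%R) ->
  \esum_(z in [set: seq T'])
    (\sum_(j < (size z).+1) f (take j z) (drop j z))%:E =
  \esum_(l in [set: seq T']) \esum_(l' in [set: seq T']) (f l l')%:E.
Proof.
move=> f0; rewrite esum_esum//=; last by move=> *; rewrite lee_fin.
under eq_esum => z _.
  rewrite -sumEFin (fsbig_ord _ (size z).+1 (fun j => (f (take j z) (drop j z))%:E)).
  rewrite -esum_fset//; last by move=> *; rewrite lee_fin.
  over.
rewrite esum_esum//=; last by move=> *; rewrite lee_fin.
rewrite (reindex_esum ([set: seq T'] `*`` (fun z => `I_(size z).+1)) _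
  (fun zj => (take zj.2 zj.1, drop zj.2 zj.1)))//.
split => //.
- move=> [z j] [z' j']; rewrite !inE /= => -[_ jz] [_ j'z] [e1 e2].
  have zz : z = z' by rewrite -(cat_take_drop j z) e1 e2 cat_take_drop.
  congr (_, _) => //; move/(congr1 size): e1.
  by rewrite !size_takel.
- move=> [l l'] _; exists (l ++ l', size l) => /=.
    by split => //=; rewrite size_cat ltnS leq_addr.
  by rewrite take_size_cat// drop_size_cat.
Qed.

Lemma esum_prod_size (T : choiceType) (w : T -> R) (a : R) k :
  (forall y, (0 <= w y)%R) -> \esum_(y in [set: T]) (w y)%:E = a%:E ->
  \esum_(l in [set l : seq T | size l = k]) (\prod_(y <- l) w y)%:E =
  (a ^+ k)%:E.
Proof.
move=> w0 wa; elim: k => [|k IH].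
  rewrite (_ : [set l | size l = 0%N] = [set [::]]); last first.
    by apply/seteqP; split => [l /= /size0nil//|l ->].
  by rewrite esum_set1 big_nil.
rewrite (reindex_esum ([set: T] `*`` (fun=> [set l : seq T | size l = k])) _
  (fun yl => yl.1 :: yl.2)); last first.
  split.
  - by move=> [y l] /= [_ <-].
  - by move=> [y l] [y' l'] _ _ /= [-> ->].
  - by move=> [//|y l] /= [sl]; exists (y, l).
have prod0 (l : seq T) : (0 <= \prod_(y <- l) w y)%R by exact: prodr_ge0.
rewrite -(esum_esum (a := fun y l => (\prod_(z <- y :: l) w z)%:E))//; last first.
  by move=> *; rewrite lee_fin.
have aE0 : (0 <= a ^+ k)%R.
  by rewrite -lee_fin -IH; apply: esum_ge0 => l _; rewrite lee_fin.
under eq_esum => y _.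
  under eq_esum do rewrite big_cons EFinM.
  rewrite esum_mkcond.
  over.
rewrite /= (eq_esum (b := fun y => (a ^+ k)%:E * (w y)%:E)); last first.
  move=> y _; rewrite muleC -IH [in RHS]esum_mkcond -esumZl//; last first.
    by move=> l; case: ifP; rewrite ?lee_fin.
  by apply: eq_esum => l _; case: ifP; rewrite ?mule0.
rewrite esumZl//.
by rewrite wa -EFinM exprSr.
Qed.

End esum_extra.

Lemma probability_setI1 d (T : measurableType d) (R : realType)
    (Pr : probability T R) (A B : set T) :
  measurable A -> measurable B -> Pr B = 1%E -> Pr (A `&` B) = Pr A.
Proof.
move=> mA mB B1; rewrite [RHS](measureDI Pr mA mB).
rewrite [X in _ = (X + _)%E](_ : _ = 0%E) ?add0e//.
apply/eqP; rewrite -measure_le0 -[leRHS](_ : Pr (~` B) = 0%E).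
  apply: le_measure; rewrite ?inE; [exact: measurableD|exact: measurableC|].
  by move=> t [].
by rewrite probability_setC// B1 subee.
Qed.

(** * The branching property and the law of the visits to b *)

Section branching.
Context (R : realType) (G : groupType) (S : {fset G}).
Variables (P : G -> G -> R) (mu : G -> nat -> R).
Hypothesis P0 : forall x y, 0 <= P x y.
Hypothesis P1 : forall x, \sum_(s <- S) P x (x * s)%g = 1.
Hypothesis PS : forall x y, (x^-1 * y)%g \notin S -> P x y = 0.
Hypothesis mu_law : forall x, offspring_laws R (mu x).

Let g x t := genfun (mu x) t.

Let mu0 x k : 0 <= mu x k. Proof. by case: (mu_law x). Qed.

Lemma row_esum (h : G -> R) x : (forall y, 0 <= h y) ->
  (\esum_(y in [set: G]) (P x y * h y)%:E = (avg S P h x)%:E)%E.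
Proof.
move=> h0; rewrite (reindex_esum [set: G] _ (fun s => x * s)%g); last first.
  split => // [s s' _ _ /mulgI//|y _].
  by exists (x^-1 * y)%g => //; rewrite mulVKg.
transitivity (\esum_(s in [set` S]) (P x (x * s)%g * h (x * s)%g)%:E)%E.
  rewrite [RHS]esum_mkcond; apply: eq_esum => s _; rewrite mem_setE.
  by case: ifPn => // sS; rewrite PS ?mul0r// mulKg.
rewrite esum_fset//; last by move=> s _; rewrite lee_fin mulr_ge0.
by rewrite -fsbig_seq ?fset_uniq// sumEFin.
Qed.

Lemma litter_prob_ge0 x l : 0 <= litter_prob P mu x l.
Proof. by rewrite /litter_prob mulr_ge0// prodr_ge0. Qed.

Lemma generation_prob_ge0 z z' : 0 <= generation_prob P mu z z'.
Proof.
elim: z z' => [|x z IH] z' /=; first by rewrite ler0n.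
by apply: sumr_ge0 => j _; rewrite mulr_ge0// litter_prob_ge0.
Qed.

Section functional.
Variable h : G -> R.
Hypothesis h01 : forall y, 0 <= h y <= 1.

Let h0 y : 0 <= h y. Proof. by case/andP: (h01 y). Qed.

(** Litters are grouped by size: those of size k contribute [mu x k] times the k-th power of the
    one-child average. *)
Lemma litter_esum x :
  (\esum_(l in [set: seq G]) (litter_prob P mu x l * \prod_(y <- l) h y)%:E =
   (g x (avg S P h x))%:E)%E.
Proof.
rewrite -genfun_sum//; last exact: avg_itv.
have prod0 (l : seq G) : 0 <= \prod_(y <- l) (P x y * h y).
  by apply: prodr_ge0 => y _; rewrite mulr_ge0.
have litterE l : litter_prob P mu x l * \prod_(y <- l) h y =
    mu x (size l) * \prod_(y <- l) (P x y * h y).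
  by rewrite /litter_prob big_split /= mulrA.
under eq_esum do rewrite litterE.
rewrite (_ : [set: seq G] = \bigcup_k [set l | size l = k]); last first.
  by apply/seteqP; split => // l _; exists (size l).
rewrite nneseries_sum_bigcup; last 2 first.
- by move=> i j _ _ [l [/= <- <-]].
- by move=> l; rewrite lee_fin mulr_ge0.
apply: eq_eseriesr => k _.
transitivity (\esum_(l in [set l : seq G | size l = k])
   ((mu x k)%:E * (\prod_(y <- l) (P x y * h y))%:E))%E.
  by apply: eq_esum => l /= ->; rewrite EFinM.
rewrite esum_mkcond.
under eq_esum do rewrite -[X in if _ then _ else X](mule0 (mu x k)%:E) -fun_if.
rewrite esumZl//; last by move=> l; case: ifP; rewrite ?lee_fin.
rewrite -esum_mkcond (esum_prod_size (a := avg S P h x))// => [y|].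
  by rewrite mulr_ge0.
exact: row_esum.
Qed.

(** The convolution over cut positions in [generation_prob] factorises by [esum_cat]; this is the
    independence of the litters of distinct parents. *)
Lemma generation_esum z :
  (\esum_(z' in [set: seq G])
    (generation_prob P mu z z' * \prod_(y <- z') h y)%:E =
   (\prod_(x <- z) g x (avg S P h x))%:E)%E.
Proof.
have prodh0 (l : seq G) : 0 <= \prod_(y <- l) h y by exact: prodr_ge0.
elim: z => [|x z IH].
  rewrite big_nil (esumID [set [::]])//; last first.
    by move=> z' _; rewrite lee_fin mulr_ge0// generation_prob_ge0.
  rewrite setTI esum_set1 /= ?eqxx ?big_nil ?mulr1// esum1 ?adde0//.
  by move=> z' [_ /= /eqP/negbTE ->]; rewrite mul0r.
pose f l l' := litter_prob P mu x l * \prod_(y <- l) h y *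
  (generation_prob P mu z l' * \prod_(y <- l') h y).
transitivity (\esum_(z' in [set: seq G])
    (\sum_(j < (size z').+1) f (take j z') (drop j z'))%:E)%E.
  apply: eq_esum => z' _ /=; congr EFin; rewrite mulr_suml.
  apply: eq_bigr => j _; rewrite /f mulrACA; congr (_ * _).
  by rewrite -big_cat cat_take_drop.
have lit0 l : 0 <= litter_prob P mu x l * \prod_(y <- l) h y.
  by rewrite mulr_ge0// litter_prob_ge0.
have gen0 l : 0 <= generation_prob P mu z l * \prod_(y <- l) h y.
  by rewrite mulr_ge0// generation_prob_ge0.
rewrite esum_cat; last by move=> l l'; rewrite mulr_ge0.
transitivity (\esum_(l in [set: seq G])
  ((\prod_(x <- z) g x (avg S P h x))%:E *
   (litter_prob P mu x l * \prod_(y <- l) h y)%:E))%E.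
  apply: eq_esum => l _; rewrite muleC -IH -esumZl//.
rewrite esumZl//; last first.
  apply: prodr_ge0 => y _; apply: genfun_ge0 => //.
  exact: avg_itv.
by rewrite litter_esum -EFinM big_cons mulrC.
Qed.

End functional.

Section process.
Context d (T : measurableType d) (Pr : probability T R).
Variables (x0 b : G) (Z : nat -> T -> seq G).
Hypothesis ZBMC : is_BMC P mu Pr x0 Z.
Hypothesis G_countable : countable [set: G].

Let Zm n z : measurable [set t | Z n t = z]. Proof. by case: ZBMC. Qed.

Lemma measurable_BMC n (A : set (seq G)) : measurable [set t | A (Z n t)].
Proof.
rewrite (_ : [set t | _] = \bigcup_z [set t | A z /\ Z n t = z]); last first.
  apply/seteqP; split => [t /= AZ|t [z _ [/= Az ->]]//].
  by exists (Z n t).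
apply: countable_bigcupT_measurable; first exact: countable_seq.
move=> z; have [Az|Az] := pselect (A z).
  by rewrite (_ : [set t | _] = [set t | Z n t = z])//; apply/seteqP; split => t [].
rewrite (_ : [set t | _] = set0)//.
by apply/seteqP; split => t // [].
Qed.

Definition history k (z : nat -> seq G) : set T :=
  [set t | forall i, (i <= k)%N -> Z i t = z i].

Definition no_visit k M n : set T :=
  [set t | forall i, (0 < i <= M)%N -> (n <= i)%N -> b \notin Z (k + i)%N t].

Lemma measurable_history k z : measurable (history k z).
Proof.
rewrite (_ : history k z = \bigcap_(i in `I_k.+1) [set t | Z i t = z i]).
  by apply: bigcap_measurableType => i _.
by apply/seteqP; split => t h i /= ik; exact: h.
Qed.

Lemma measurable_no_visit k M n : measurable (no_visit k M n).
Proof.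
rewrite (_ : no_visit k M n = \bigcap_i
   [set t | (0 < i <= M)%N -> (n <= i)%N -> b \notin Z (k + i)%N t]).
  apply: bigcap_measurableType => i _.
  exact: (measurable_BMC (k + i)
    (fun z => (0 < i <= M)%N -> (n <= i)%N -> b \notin z)).
by apply/seteqP; split => t h i //=; [move=> _; exact: h|exact: h].
Qed.

(** [avoid] without its factor for time 0: the particles present at time k belong to the history, so
    only later times remain to be constrained. *)
Definition future M n x : R :=
  if M is M'.+1 then g x (avg S P (avoid S P g b M' n.-1) x) else 1.

Let g0 x t : 0 <= t <= 1 -> 0 <= g x t. Proof. exact: genfun_ge0. Qed.
Let g_le x t : 0 <= t <= 1 -> g x t <= t. Proof. exact: genfun_le. Qed.

Let g_mono x s t : 0 <= s -> s <= t -> t <= 1 -> g x s <= g x t.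
Proof. exact: genfun_mono. Qed.

Lemma avoidE M n x :
  avoid S P g b M n x = (if n is 0%N then (x != b)%:R else 1) * future M n x.
Proof. by case: M. Qed.

(** Markov and branching property together: given the history, the particles present at time k avoid
    b independently. *)
Lemma Pr_history_no_visit M k n z :
  (Pr (history k z `&` no_visit k M n) =
   Pr (history k z) * (\prod_(y <- z k) future M n y)%:E)%E.
Proof.
elim: M k n z => [|M IH] k n z.
  rewrite (_ : no_visit k 0 n = setT).
    by rewrite setIT big1// mule1.
  apply/seteqP; split => // t _ i.
  by rewrite ltn_neqAle => /andP[/andP[/negbTE + _]]; rewrite eq_sym => i0; rewrite leqn0 i0.
pose zz z' i := if i == k.+1 then z' else z i.
have zzk z' i : (i <= k)%N -> zz z' i = z i.
  by move=> ik; rewrite /zz ltn_eqF// ltnS.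
have zzS z' : zz z' k.+1 = z' by rewrite /zz eqxx.
have historyS z' : history k.+1 (zz z') =
    history k z `&` [set t | Z k.+1 t = z'].
  apply/seteqP; split => [t h|t [h1 /= h2] i].
    split => [i ik|/=]; first by rewrite h ?zzk// ltnW.
    by rewrite h// /zz eqxx.
  rewrite leq_eqVlt => /orP[/eqP ->|]; first by rewrite h2 /zz eqxx.
  by rewrite ltnS => ik; rewrite zzk// h1.
have PrS z' : Pr (history k.+1 (zz z')) =
    (Pr (history k z) * (generation_prob P mu (z k) z')%:E)%E.
  have [_ PrZ] := ZBMC; rewrite /history !PrZ -EFinM; congr EFin.
  rewrite zzk// -mulrA big_ord_recr /= zzk// zzS; congr (_ * (_ * _)).
  apply: eq_bigr => i _; rewrite !zzk//; exact: ltnW.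
(* Decompose over the next generation z'. Counted from time k + 1 the window starts at n - 1, and z'
   itself must avoid b exactly when n <= 1. *)
have split_next : history k z `&` no_visit k M.+1 n =
    \bigcup_(z' in [set: seq G]) (if (n <= 1)%N && (b \in z') then set0 else
       history k.+1 (zz z') `&` no_visit k.+1 M n.-1).
  apply/seteqP; split.
    move=> t [ht nt]; exists (Z k.+1 t) => //.
    case: ifPn => [/andP[n1]|_].
      by have := nt 1%N isT n1; rewrite addn1 => /negbTE ->.
    split; first by rewrite historyS.
    move=> i /andP[i0 iM] ni; rewrite addSnnS; apply: nt; first exact: iM.
    by move: ni; case: (n).
  move=> t [z' _]; case: ifPn => // nz'; rewrite historyS => -[[ht /= Zz'] nt].
  split => // -[|[|i]] //= iM ni.
    by move: nz'; rewrite ni /= addn1 Zz'.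
  rewrite -addSnnS; apply: nt => //.
  by move: ni; case: (n).
rewrite split_next measure_countable_bigcup//; last 3 first.
- exact: countable_seq.
- move=> z'; case: ifP => // _; apply: measurableI.
    exact: measurable_history.
  exact: measurable_no_visit.
- move=> z1 z2 _ _ [t []]; case: ifP => // _; rewrite historyS => -[[_ /= <-] _].
  by case: ifP => // _; rewrite historyS => -[[_ /= <-] _].
transitivity (\esum_(z' in [set: seq G]) (Pr (history k z) *
  (generation_prob P mu (z k) z' * \prod_(y <- z') avoid S P g b M n.-1 y)%:E))%E.
  apply: eq_esum => z' _.
  under [X in (_ * X)%:E]eq_bigr do rewrite avoidE.
  rewrite big_split /= EFinM EFinM.
  have -> : \prod_(y <- z') (if n.-1 is 0%N then (y != b)%:R else 1) =
      (~~ ((n <= 1)%N && (b \in z')))%:R :> R.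
    case: n {split_next} => [|[|n]] /=; last by rewrite big1.
    - elim: z' => [|y z' IHz]; first by rewrite big_nil.
      by rewrite big_cons IHz inE [b == y]eq_sym; case: (y == b); rewrite ?mul0r ?mul1r.
    - elim: z' => [|y z' IHz]; first by rewrite big_nil.
      by rewrite big_cons IHz inE [b == y]eq_sym; case: (y == b); rewrite ?mul0r ?mul1r.
  case: ifP => _ /=; first by rewrite measure0 mul0e !mule0.
  by rewrite IH PrS zzS mul1e muleA.
have Prfin : Pr (history k z) = (fine (Pr (history k z)))%:E.
  by rewrite fineK// fin_num_measure//; exact: measurable_history.
rewrite Prfin esumZl.
- by rewrite generation_esum// => y; exact: avoid_itv.
- exact/fine_ge0/measure_ge0.
- move=> z'; rewrite lee_fin mulr_ge0 ?generation_prob_ge0//.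
  by apply: prodr_ge0 => y _; case/andP: (avoid_itv b P0 P1 g0 g_le M n.-1 y).
Qed.

Lemma Pr_avoid N n :
  Pr [set t | forall i, (n <= i <= N)%N -> b \notin Z i t] =
  (avoid S P g b N n x0)%:E.
Proof.
have [_ PrZ] := ZBMC.
pose z (i : nat) := [:: x0].
(* The initial state is almost surely the single particle at x0, so intersecting with this history
   changes no probability. *)
have Pr0 : Pr (history 0 z) = 1%E by rewrite PrZ big_ord0 mulr1 eqxx.
pose A := [set t | forall i, (n <= i <= N)%N -> b \notin Z i t].
have mA : measurable A.
  rewrite (_ : A = \bigcap_i [set t | (n <= i <= N)%N -> b \notin Z i t]).
    apply: bigcap_measurableType => i _.
    exact: (measurable_BMC i (fun z => (n <= i <= N)%N -> b \notin z)).
  by apply/seteqP; split => t h i //=; [move=> _; exact: h|exact: h].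
have AE : A `&` history 0 z = if (n == 0%N) && (x0 == b) then set0
    else history 0 z `&` no_visit 0 N n.
  apply/seteqP; split => [t [At ht]|t].
    case: ifPn => [/andP[/eqP n0 /eqP xb]|_].
      by have := At 0%N; rewrite n0 ht// /z xb inE eqxx => /(_ isT).
    by split => // i /andP[_ iN] ni; apply: At; rewrite ni.
  case: ifPn => // n0 [ht nt]; split => // -[|i] /andP[ni iN]; last first.
    by rewrite -[i.+1]add0n; apply: nt.
  rewrite ht// inE eq_sym; apply: contra n0 => ->.
  by rewrite andbT -leqn0.
have PrE : Pr A = Pr (A `&` history 0 z).
  by rewrite probability_setI1//; exact: measurable_history.
rewrite -/A PrE AE avoidE.
clear AE PrE; case: n @A mA => [|n] A mA /=; last first.
  by rewrite Pr_history_no_visit Pr0 big_seq1 mul1e mul1r.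
case: eqVneq => /= [_|_]; first by rewrite measure0 mul0r.
by rewrite Pr_history_no_visit Pr0 big_seq1 mul1e mul1r.
Qed.

(** A generation is a finite list, so an infinite total needs infinitely many occupied times;
    conversely, a convergent series of integers has only finitely many nonzero terms. *)
Lemma infinitely_many_visitsP t :
  infinitely_many_visits R Z b t <->
  forall n, exists i, (n <= i)%N /\ b \in Z i t.
Proof.
pose f k : R := (count_mem b (Z k t))%:R.
have f0 k : 0 <= f k by rewrite ler0n.
split => [io n|io].
  apply: contrapT => /forallNP nio.
  have fn0 k : (n <= k)%N -> f k = 0.
    move=> nk; rewrite /f (count_memPn _)//; apply/negP => bZ.
    by apply: (nio k).
  move: io; rewrite /infinitely_many_visits /= (nneseries_split 1 n)//.
  rewrite [X in (_ + X)%E]eseries0 ?adde0; last first.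
    by move=> k nk _; congr EFin; apply: fn0; rewrite (leq_trans _ nk)// leq_addl.
  by rewrite sumEFin.
rewrite /infinitely_many_visits /=.
apply: contrapT => fin.
have fin0 : (\sum_(k <oo) (f k)%:E < +oo)%E.
  rewrite (nneseries_recl (P := xpredT))//; last by move=> k _; rewrite lee_fin.
  by apply: lte_add_pinfty; [exact: ltry|rewrite ltey; exact/eqP].
have := cvg_series_cvg_0 (nnseries_is_cvg f0 fin0).
move=> /cvgrPdist_lt /(_ 1 ltr01) [n _ fn].
have [i [ni bZ]] := io n.
have := fn i ni; rewrite sub0r normrN ger0_norm// ltrn1.
by rewrite ltnNge -has_count has_pred1 bZ.
Qed.

Let E n N := [set t | forall i, (n <= i <= N)%N -> b \notin Z i t].

Let mE n N : measurable (E n N).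
Proof.
rewrite (_ : E n N = \bigcap_i [set t | (n <= i <= N)%N -> b \notin Z i t]).
  apply: bigcap_measurableType => i _.
  exact: (measurable_BMC i (fun z => (n <= i <= N)%N -> b \notin z)).
by apply/seteqP; split => t h i //=; [move=> _; exact: h|exact: h].
Qed.

Let Pr_bigcapE n : Pr (\bigcap_N E n N) = (1 - hit_from S P g b n x0)%:E.
Proof.
have c1 : Pr \o E n @ \oo --> Pr (\bigcap_N E n N).
  apply: nonincreasing_cvg_mu => //; first by rewrite -ge0_fin_numE ?fin_num_measure.
    exact: bigcapT_measurable.
  apply/nonincreasing_seqP => N; apply/subsetPset => t h i /andP[ni iN].
  by apply: h; rewrite ni leqW.
have c2 : Pr \o E n @ \oo --> (1 - hit_from S P g b n x0)%:E.
  rewrite (_ : Pr \o E n = EFin \o (fun N => 1 - hit S P g b N n x0)).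
    apply: cvg_EFin; first exact: nearW.
    apply: cvgB; first exact: cvg_cst.
    by apply: hit_cvg => //; exact: g_mono.
  by apply/funext => N /=; rewrite Pr_avoid /hit opprB addrC subrK.
exact: cvg_unique c1 c2.
Qed.

Theorem Pr_infinitely_many_visits :
  Pr (infinitely_many_visits R Z b) = (hit_io S P g b x0)%:E.
Proof.
pose U := \bigcup_n \bigcap_N E n N.
have mcap n : measurable (\bigcap_N E n N) by exact: bigcapT_measurable.
have mU : measurable U by exact: bigcupT_measurable.
have ioE : infinitely_many_visits R Z b = ~` U.
  apply/seteqP; split => t.
    move=> /infinitely_many_visitsP io [n _ h].
    have [i [ni bZ]] := io n.
    by have := h i Logic.I i; rewrite ni leqnn bZ => /(_ isT).
  move=> nU; apply/infinitely_many_visitsP => n; apply: contrapT => /forallNP h.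
  apply: nU; exists n => // N _ i /andP[ni _].
  by apply/negP => bZ; apply: (h i).
have c1 : Pr \o (fun n => \bigcap_N E n N) @ \oo --> Pr U.
  apply: nondecreasing_cvg_mu => //.
  apply/nondecreasing_seqP => n; apply/subsetPset => t h N _ i /andP[ni iN].
  by apply: (h N) => //; rewrite iN ltnW.
have c2 : Pr \o (fun n => \bigcap_N E n N) @ \oo --> (1 - hit_io S P g b x0)%:E.
  rewrite (_ : Pr \o _ = EFin \o (fun n => 1 - hit_from S P g b n x0)).
    apply: cvg_EFin; first exact: nearW.
    apply: cvgB; first exact: cvg_cst.
    by apply: hit_from_cvg => //; exact: g_mono.
  by apply/funext => n /=; rewrite Pr_bigcapE.
rewrite ioE probability_setC// (cvg_unique _ c1 c2)// -EFinB opprB.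
by rewrite addrC subrK.
Qed.

End process.
End branching.

(** * Survival at seeds and the bound on the miss probability *)

Lemma expr_unbounded (R : realType) (a c : R) : 1 < a -> exists n, c <= a ^+ n.
Proof.
move=> a1.
have h n : 1 + n%:R * (a - 1) <= a ^+ n.
  elim: n => [|n IH]; first by rewrite mul0r addr0 expr0.
  rewrite exprS -natr1; have : a * (1 + n%:R * (a - 1)) <= a * a ^+ n.
    by rewrite ler_pM2l//; lra.
  apply: le_trans.
  have : 0 <= n%:R * (a - 1) * (a - 1) by rewrite !mulr_ge0// subr_ge0 ltW.
  lra.
exists (Num.bound (c / (a - 1))).
apply: le_trans (h _).
have a10 : 0 < a - 1 by lra.
have [c0|c0] := leP 0 c; last first.
  have : 0 <= (Num.bound (c / (a - 1)))%:R * (a - 1) by rewrite mulr_ge0 // ltW.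
  lra.
have : c / (a - 1) < (Num.bound (c / (a - 1)))%:R.
  by apply: archi_boundP; rewrite divr_ge0// ltW.
rewrite ltr_pdivrMr//; lra.
Qed.

Section recurrence.
Context (R : realType) (G : groupType) (S : {fset G}).
Variables (P : G -> G -> R) (g : G -> R -> R).
Hypothesis P0 : forall x y, 0 <= P x y.
Hypothesis P1 : forall x, \sum_(s <- S) P x (x * s)%g = 1.
Hypothesis g0 : forall x (t : R), 0 <= t <= 1 -> 0 <= g x t.
Hypothesis g_le : forall x (t : R), 0 <= t <= 1 -> g x t <= t.
Hypothesis g_mono : forall x (s t : R), 0 <= s -> s <= t -> t <= 1 -> g x s <= g x t.

(** By [hitS], the operator that takes [hit N n] to [hit N.+1 n.+1]. *)
Definition Phi (h : G -> R) x := 1 - g x (1 - avg S P h x).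

Lemma Phi_itv h x : (forall y, 0 <= h y <= 1) -> 0 <= Phi h x <= 1.
Proof.
move=> h01; have := avg_itv P0 P1 x h01; rewrite /Phi => ?.
have a01 : 0 <= 1 - avg S P h x <= 1 by lra.
by have := g0 x a01; have := g_le x a01; lra.
Qed.

Lemma iter_Phi_itv n h x : (forall y, 0 <= h y <= 1) -> 0 <= iter n Phi h x <= 1.
Proof. by move=> h01; elim: n x => [|n IH] x //=; exact: Phi_itv. Qed.

Lemma avg_le_Phi h x : (forall y, 0 <= h y <= 1) -> avg S P h x <= Phi h x.
Proof.
move=> h01; have := avg_itv P0 P1 x h01; rewrite /Phi => ?.
have a01 : 0 <= 1 - avg S P h x <= 1 by lra.
by have := g_le x a01; lra.
Qed.

Lemma iter_avg_le_Phi n h x : (forall y, 0 <= h y <= 1) ->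
  iter n (avg S P) h x <= iter n Phi h x.
Proof.
move=> h01; elim: n x => [|n IH] x //=.
apply: le_trans (avg_le_Phi _ _); last by move=> y; exact: iter_Phi_itv.
exact: avg_le.
Qed.

Section local_survival.
Variables (Q : G -> G -> R) (mL L lam eta : R) (n : nat) (z : G).
Hypothesis Q0 : forall x y, 0 <= Q x y.
Hypothesis QP : forall x y, Q x y <= P x y.
Hypothesis mL1 : 1 <= mL.
Hypothesis L0 : 0 <= L.
Hypothesis eta0 : 0 < eta.
Hypothesis Leta : L * eta <= 1.
Hypothesis Qg : forall x, (forall y, Q x y = 0) \/
  forall t : R, 0 <= t <= 1 -> mL * (t * (1 - L * t)) <= 1 - g x (1 - t).
Hypothesis lam1 : 1 < lam.
Hypothesis supercritical :
  lam <= ((1 - L * eta) * mL) ^+ n * iter n (avg S Q) (ind R z) z.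

(** Up to level eta, linearising the generating function loses at most a factor 1 - L eta. A value
    at most eps, multiplied by at most mL in each of n steps, does not exceed eta. *)
Let eps := eta / mL ^+ n.

Let eps_gt0 : 0 < eps.
Proof. by rewrite divr_gt0// exprn_gt0// (lt_le_trans _ mL1). Qed.

Lemma iter_killed_le1 i x : iter i (avg S Q) (ind R z) x <= 1.
Proof.
elim: i x => [|i IH] x /=; first by rewrite /ind; case: eqP.
apply: (@le_trans _ _ (avg S Q (fun=> 1) x)); first exact: avg_le.
rewrite -[leRHS](avg_cst P1 1 x); apply: avg_ler_kernel => // y.
Qed.

(** As long as the values stay below eta, [Phi] dominates the linear operator q Q with q = (1 - L
    eta) mL, and n of its steps multiply the value at z by at least lam. Killed sites only require
    nonnegativity. *)
Lemma Phi_growth h a : (forall y, 0 <= h y <= 1) -> 0 <= a <= eps -> a <= h z ->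
  lam * a <= iter n Phi h z.
Proof.
move=> h01 /andP[a0 ae] ahz.
have mL0 : 0 < mL by exact: lt_le_trans mL1.
have Lm0 : 0 <= 1 - L * eta by rewrite subr_ge0.
have Lm1 : 1 - L * eta <= 1 by rewrite gerBl mulr_ge0// ltW.
pose q := (1 - L * eta) * mL.
have q0 : 0 <= q by rewrite mulr_ge0// ltW.
have qm : q <= mL by rewrite /q ler_piMl// ltW.
have Qind i x : 0 <= iter i (avg S Q) (ind R z) x.
  by apply: iter_avg_ge0 => // y; exact: ind_ge0.
have key i : (i <= n)%N -> forall x,
    q ^+ i * a * iter i (avg S Q) (ind R z) x <= iter i Phi h x.
  elim: i => [_|i IH lin] x.
    rewrite expr0 mul1r /= /ind; case: eqVneq => [->|_]; first by rewrite mulr1.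
    by rewrite mulr0; case/andP: (h01 x).
  have [Q00|gx] := Qg x.
    rewrite /= {1}/avg big1 ?mulr0; last by move=> s _; rewrite Q00 mul0r.
    by have /andP[] := iter_Phi_itv i.+1 x h01.
  set t0 := q ^+ i * a * iter i.+1 (avg S Q) (ind R z) x.
  have t0E : avg S Q (fun y => q ^+ i * a * iter i (avg S Q) (ind R z) y) x = t0.
    by rewrite avgZ.
  have t00 : 0 <= t0 by rewrite !mulr_ge0// exprn_ge0.
  have t0eta : t0 <= eta.
    apply: (@le_trans _ _ (q ^+ i * a)).
      by apply: ler_piMr; [rewrite mulr_ge0// exprn_ge0|exact: iter_killed_le1].
    apply: (@le_trans _ _ (mL ^+ n * a)); last first.
      by rewrite mulrC -ler_pdivlMr// exprn_gt0.
    apply: ler_wpM2r => //; apply: (@le_trans _ _ (mL ^+ i)).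
      by apply: lerXn2r; rewrite ?nnegrE// ltW.
    by apply: ler_weXn2l => //; exact: ltnW.
  have Pt : t0 <= avg S P (iter i Phi h) x.
    rewrite -t0E; apply: (@le_trans _ _ (avg S P (fun y =>
        q ^+ i * a * iter i (avg S Q) (ind R z) y) x)).
      by apply: avg_ler_kernel => // y; rewrite !mulr_ge0// exprn_ge0.
    by apply: avg_le => // y; apply: IH; exact: ltnW.
  have := avg_itv P0 P1 x (fun y => iter_Phi_itv i y h01) => P01.
  have t01 : 0 <= t0 <= 1 by lra.
  apply: (@le_trans _ _ (1 - g x (1 - t0))); last first.
    by rewrite /= /Phi lerB//; apply: g_mono; lra.
  apply: le_trans (gx _ t01).
  have -> : q ^+ i.+1 * a * iter i.+1 (avg S Q) (ind R z) x =
      mL * (t0 * (1 - L * eta)) by rewrite exprS /t0 /q; ring.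
  by rewrite ler_pM2l// ler_wpM2l// lerB// ler_wpM2l.
apply: le_trans (key n (leqnn n) z).
by rewrite mulrAC ler_wpM2r.
Qed.

Section target.
Variable b : G.
Hypothesis reach : exists k, 0 < iter k (avg S P) (ind R b) z.

Lemma hit_diag j x : hit S P g b j j x = iter j Phi (ind R b) x.
Proof.
elim: j x => [|j IH] x.
  by rewrite /hit /= mulr1 /ind; case: (x == b); rewrite /= ?subr0 ?subrr.
rewrite hitS// /= /Phi; congr (1 - g x (1 - avg S P _ x)); exact/funext.
Qed.

Lemma hit_from_ge_Phi m j x : (m <= j)%N ->
  iter j Phi (ind R b) x <= hit_from S P g b m x.
Proof.
move=> mj; rewrite -hit_diag.
apply: le_trans (hit_le_from b P0 P1 g0 g_le j j x) _.
by apply: (@hit_from_ni _ _ S P g b P0 P1 g0 g_le g_mono x).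
Qed.

Lemma hit_io_seed : eps <= 1 -> eps <= hit_io S P g b z.
Proof.
move=> eps1; apply: hit_io_ge => m.
have ind01 y : 0 <= ind R b y <= 1 by rewrite /ind; case: eqP; rewrite ?lexx ?ler01.
have [k pk] := reach.
set p := iter k _ _ _ in pk.
(* Start from p, the chance that the walk is at b after k steps. Every block of n further steps
   multiplies the bound by lam until it saturates at eps. *)
have growth j : Num.min eps (lam ^+ j * p) <=
    iter (j * n + k) Phi (ind R b) z.
  elim: j => [|j IH].
    by rewrite mul0n add0n expr0 mul1r ge_min [X in _ || X]iter_avg_le_Phi// orbT.
  rewrite mulSn -addnA iterD.
  set a := Num.min eps (lam ^+ j * p) in IH.
  apply: (@le_trans _ _ (lam * a)).
    rewrite /a; have [h|h] := leP eps (lam ^+ j * p).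
      by rewrite ge_min ler_peMl// ltW.
    by rewrite ge_min exprS -mulrA lexx orbT.
  apply: Phi_growth => //; first by move=> y; exact: iter_Phi_itv.
  apply/andP; split; last by rewrite ge_min lexx.
  have lam0 : 0 <= lam := ltW (lt_trans ltr01 lam1).
  by rewrite le_min (ltW eps_gt0) mulr_ge0 ?exprn_ge0 ?(ltW pk).
have [j hj] := expr_unbounded (eps / p) lam1.
(* For n = 0 the return weight is 1 < lam. Positivity of n makes j + m blocks last at least m steps,
   so the visit falls after time m. *)
have n_gt0 : (0 < n)%N.
  move: supercritical; case: (n) => //.
  by rewrite expr0 mul1r /= /ind eqxx => h; have := lt_le_trans lam1 h; rewrite ltxx.
have lamjm : eps <= lam ^+ (j + m) * p.
  rewrite -ler_pdivrMr//; apply: le_trans hj _.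
  by apply: ler_weXn2l; [exact: ltW|exact: leq_addr].
apply: le_trans (hit_from_ge_Phi (j := ((j + m) * n + k)%N) _ _).
  by apply: le_trans (growth (j + m)%N); rewrite le_min lexx.
rewrite (leq_trans _ (leq_addr _ _))// (leq_trans (leq_addl j m))//.
exact: leq_pmulr.
Qed.

End target.
End local_survival.

Section conclusion.
Variables (b : G) (m : G -> R).
Hypothesis m0 : forall x, 0 <= m x.
Hypothesis g_lip : forall x (s t : R), 0 <= s -> s <= t -> t <= 1 ->
  g x t - g x s <= m x * (t - s).

Let v x := 1 - hit_io S P g b x.

Lemma miss_itv x : 0 <= v x <= 1.
Proof. by have := hit_io_itv b P0 P1 g0 g_le x; rewrite /v; lra. Qed.

Let io01 := hit_io_itv b P0 P1 g0 g_le.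
Let from01 := hit_from_itv b P0 P1 g0 g_le.
Let hit01 := hit_itv b P0 P1 g0 g_le.

(** The equality [hitS] holds on finite windows; monotonicity of g replaces the average of
    [hit_from] by that of [hit_io], in the direction wanted here. *)
Lemma miss_le x : v x <= g x (avg S P v x).
Proof.
rewrite /v avg1B//.
have := avg_itv P0 P1 x io01 => A01.
have step n : 1 - g x (1 - avg S P (hit_io S P g b) x) <= hit_from S P g b n.+1 x.
  have := avg_itv P0 P1 x (from01 n) => F01.
  (* The added term bounds, by the Lipschitz property, the error of replacing [hit] by [hit_from]
     inside g, and it vanishes as N grows. *)
  have c1 : (fun N => hit S P g b N.+1 n.+1 x +
      m x * (avg S P (hit_from S P g b n) x - avg S P (hit S P g b N n) x)) @ \oo -->
      hit_from S P g b n.+1 x +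
      m x * (avg S P (hit_from S P g b n) x - avg S P (hit_from S P g b n) x).
    apply: cvgD.
      rewrite (cvg_shiftS (fun N => hit S P g b N n.+1 x)).
      exact: hit_cvg.
    apply: cvgMl_tmp; apply: cvgB; first exact: cvg_cst.
    by apply: cvg_avg => y; exact: hit_cvg.
  rewrite subrr mulr0 addr0 in c1.
  apply: (cvgr_to_ge c1); apply: nearW => N.
  have := avg_itv P0 P1 x (hit01 N n) => H01.
  have HF : avg S P (hit S P g b N n) x <= avg S P (hit_from S P g b n) x.
    by apply: avg_le => // y; exact: hit_le_from.
  have AF : avg S P (hit_io S P g b) x <= avg S P (hit_from S P g b n) x.
    by apply: avg_le => // y; exact: hit_io_le.
  rewrite hitS//.
  have := @g_lip x (1 - avg S P (hit_from S P g b n) x)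
    (1 - avg S P (hit S P g b N n) x).
  have := @g_mono x (1 - avg S P (hit_from S P g b n) x)
    (1 - avg S P (hit_io S P g b) x).
  lra.
suff : 1 - g x (1 - avg S P (hit_io S P g b) x) <= hit_io S P g b x by lra.
apply: hit_io_ge => -[|n] //.
apply: le_trans (step 0) _.
by apply: (@hit_from_ni _ _ S P g b P0 P1 g0 g_le g_mono x).
Qed.

Lemma miss_le_avg x : v x <= avg S P v x.
Proof.
by apply: le_trans (miss_le x) _; apply: g_le; apply: avg_itv => // y; exact: miss_itv.
Qed.

Variables (D seeds : set G) (c0 kap eps : R).
Hypothesis c00 : 0 < c0.
Hypothesis kap01 : 0 < kap <= 1.
Hypothesis eps0 : 0 < eps.
Hypothesis D_seeds : forall y, D y -> exists z k,
  seeds z /\ c0 <= iter k (avg S P) (ind R z) y.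
Hypothesis seeds_g : forall z (t : R), seeds z -> 0 <= t <= 1 ->
  g z t <= t - kap * (t * (1 - t)).
Hypothesis seeds_io : forall z, seeds z -> eps <= hit_io S P g b z.
Hypothesis D_hit : forall (u : G -> R) (s : R), 0 <= s ->
  (forall x, 0 <= u x <= 1) -> (forall x, u x <= avg S P u x) ->
  (forall y, D y -> u y <= s) -> forall x, u x <= s.

(** [D_hit] is a maximum principle, the form in which arrival of the walk in D is used: it reduces
    bounds on V to bounds on D ([Vs]). It is applied with [eps] to get V < 1, and with [kap] to get
    a contraction from which the factor 1 - V can then be cancelled. *)
Theorem hit_io_eq1 x : hit_io S P g b x = 1.
Proof.
pose V := sup (range v).
have vV y : v y <= V.
  by apply: ub_le_sup; [exists 1 => _ [w _ <-]; case/andP: (miss_itv w)|exists y].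
have V0 : 0 <= V by apply: le_trans (vV x); case/andP: (miss_itv x).
have V1 : V <= 1.
  by apply: sup_le_ub => [|_ [w _ <-]]; [exists (v x), x|case/andP: (miss_itv w)].
have Vs s : 0 <= s -> (forall y, D y -> v y <= s) -> V <= s.
  move=> s0 Ds; apply: sup_le_ub => [|_ [w _ <-]]; first by exists (v x), x.
  by apply: D_hit Ds w => // [w|w]; [exact: miss_itv|exact: miss_le_avg].
have viter k y : v y <= iter k (avg S P) v y.
  elim: k y => //= k IH y; apply: le_trans (miss_le_avg y) _; exact: avg_le.
(* With weight at least c0 the walk from y is at z after k steps, and wherever else it is, v is at
   most V. *)
have vD y z k : c0 <= iter k (avg S P) (ind R z) y ->
    v y <= V - c0 * (V - v z).
  move=> hk; apply: le_trans (viter k y) _.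
  have : iter k (avg S P) v y <= iter k (avg S P)
      (fun w => V - (V - v z) * ind R z w) y.
    apply: iter_avg_le => // w; rewrite /ind; case: eqVneq => [->|_].
      by rewrite mulr1; lra.
    by rewrite mulr0 subr0.
  have iter_cst j w : iter j (avg S P) (fun=> V) w = V.
    elim: j w => //= j IH w; rewrite -[RHS](avg_cst P1 V w); congr avg.
    exact/funext.
  move/le_trans; apply.
  rewrite iter_avgB iter_cst iter_avgZ lerB// mulrC ler_wpM2l//.
  by rewrite subr_ge0.
have p1 y z k : iter k (avg S P) (ind R z) y <= 1.
  elim: k y => [|k IH] y /=; first by rewrite /ind; case: eqP.
  by rewrite -[leRHS](avg_cst P1 1 y); apply: avg_le.
have vz z : seeds z -> v z <= V - kap * (V * (1 - V)).
  move=> sz; apply: le_trans (miss_le z) _.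
  have t01 : 0 <= avg S P v z <= 1 by apply: avg_itv => // w; exact: miss_itv.
  have tV : avg S P v z <= V.
    by rewrite -[leRHS](avg_cst P1 V z); apply: avg_le.
  apply: le_trans (seeds_g sz t01) _.
  set t := avg S P v z in t01 tV *.
  (* t - kap t (1 - t) is nondecreasing on [0, 1] because kap <= 1; the factorisation below makes
     this explicit between t and V. *)
  rewrite -subr_ge0.
  have -> : V - kap * (V * (1 - V)) - (t - kap * (t * (1 - t))) =
    (V - t) * (1 - kap + kap * (V + t)) by ring.
  have /andP[k0 k1] := kap01; have /andP[t0 t1] := t01.
  apply: mulr_ge0; first by rewrite subr_ge0.
  by apply: addr_ge0; [rewrite subr_ge0|apply: mulr_ge0; [exact: ltW|exact: addr_ge0]].
have vz1 z : seeds z -> v z <= 1 - eps.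
  by move=> sz; rewrite /v lerB// seeds_io.
suff V00 : V <= 0 by have := vV x; have := miss_itv x; rewrite /v; lra.
have [[y0 Dy0]|nD] := pselect (exists y, D y); last first.
  by apply: Vs => // y Dy; exfalso; apply: nD; exists y.
have c01 : c0 <= 1 by have [z [k [_ hk]]] := D_seeds Dy0; exact: le_trans hk (p1 _ _ _).
have hD1 y : D y -> v y <= 1 - c0 * eps.
  move=> /D_seeds [z [k [sz hk]]]; apply: le_trans (vD _ _ _ hk) _.
  have := ler_wpM2l (ltW c00) (vz1 _ sz).
  have : (1 - c0) * V <= 1 - c0 by apply: ler_piMr => //; lra.
  lra.
have Vlt : V <= 1 - c0 * eps.
  by apply: Vs => //; apply: le_trans (hD1 _ Dy0); case/andP: (miss_itv y0).
have ce : 0 < c0 * eps by rewrite mulr_gt0.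
have ck : 0 < c0 * kap <= 1.
  have /andP[k0 k1] := kap01.
  by rewrite mulr_gt0//=; apply: mulr_ile1 => //; exact: ltW.
have VV : 0 <= V * (1 - V) by apply: mulr_ge0 => //; rewrite subr_ge0.
have Vle : V <= V - c0 * kap * (V * (1 - V)).
  apply: Vs => [|y /D_seeds [z [k [sz hk]]]].
    have : c0 * kap * (V * (1 - V)) <= V * (1 - V) by apply: ler_piMl => //; lra.
    have : V * (1 - V) <= V by apply: ler_piMr => //; lra.
    lra.
  apply: le_trans (vD _ _ _ hk) _.
  have := ler_wpM2l (ltW c00) (vz _ sz); lra.
have : c0 * kap * (V * (1 - V)) <= 0 by lra.
rewrite pmulr_rle0; last by lra.
by rewrite pmulr_lle0//; lra.
Qed.

End conclusion.
End recurrence.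

(** * Almost sure statements and independence in product spaces *)

Lemma ae_countable d (T : measurableType d) (R : realType)
    (mu : {measure set T -> \bar R}) (J : choiceType) (E : J -> T -> Prop) :
  countable [set: J] -> (forall j, {ae mu, forall e, E j e}) ->
  {ae mu, forall e, forall j, E j e}.
Proof.
elim/choicePpointed: J => J in E *.
  by move=> _ _; apply: aeW => e j; have : [set: J] j by []; rewrite emptyE.
move=> /countable_bijP[B]; rewrite card_eq_sym => /card_set_bijP[f [_ _ fsurj]] hE.
have hae : {ae mu, forall e, forall n, E (f n) e} by apply: ae_foralln.
apply: (filterS _ hae) => e he j.
by have [n _ <-] := fsurj j Logic.I.
Qed.

Lemma ae_probability1 d (T : measurableType d) (R : realType)
    (Pr : probability T R) (A : set T) : measurable A ->
  Pr A = 1%E <-> {ae Pr, forall t, A t}.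
Proof.
move=> mA; split => [A1|[N [mN N0 AN]]].
  exists (~` A); split => //; first exact: measurableC.
  by rewrite probability_setC// A1 subee.
have A0 : Pr (~` A) = 0%E.
  by apply/eqP; rewrite -measure_le0 -N0 le_measure// inE//; exact: measurableC.
by rewrite -[A]setCK probability_setC ?A0 ?sube0//; exact: measurableC.
Qed.

Lemma countable_bigcapT_measurable d (T : measurableType d) (U : Type)
    (F : U -> set T) : countable [set: U] -> (forall i, measurable (F i)) ->
  measurable (\bigcap_i F i).
Proof.
move=> cU mF; rewrite -[X in measurable X]setCK setC_bigcap; apply: measurableC.
by apply: countable_bigcupT_measurable => // i; exact: measurableC.
Qed.

Section product_measurability.
Context (I : choiceType) d (T : measurableType d).

Lemma measurable_coordinate i : measurable_fun setT (fun e : prod_space I T => e i).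
Proof.
move=> _ A mA; rewrite setTI; apply: sub_sigma_algebra.
by exists i => //; exists A => //; rewrite setTI.
Qed.

Lemma measurable_coordinate_set i (A : set T) : measurable A ->
  measurable [set e : prod_space I T | A (e i)].
Proof. by move=> mA; rewrite -[X in measurable X]setTI; exact: measurable_coordinate. Qed.

Lemma measurable_prod_space d' (X : measurableType d') (f : X -> prod_space I T) :
  (forall i, measurable_fun setT (fun x => f x i)) -> measurable_fun setT f.
Proof.
move=> mf; apply: (@measurability _ _ X (prod_space I T) setT f
  (@coordinate_events I d T) erefl).
move=> _ [_ [i _ [A mA <-]] <-].
by rewrite !setTI; have := mf i measurableT A mA; rewrite setTI.
Qed.

Definition cylinder (F : {fset I}) (A : I -> set T) : set (prod_space I T) :=
  [set e | forall i, i \in F -> A i (e i)].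

Lemma measurable_cylinder F A : (forall i, i \in F -> measurable (A i)) ->
  measurable (cylinder F A).
Proof.
move=> mA; rewrite (_ : cylinder F A =
    \bigcap_(i in [set` F]) [set e : prod_space I T | A i (e i)]).
  apply: fin_bigcap_measurable => // i /= iF.
  by apply: measurable_coordinate_set; apply: mA.
by apply/seteqP; split => e h i; exact: h.
Qed.

Definition cylinders : set (set (prod_space I T)) :=
  [set C | exists F A, (forall i, i \in F -> measurable (A i)) /\ C = cylinder F A].

Lemma cylinders_generate : @measurable _ (prod_space I T) = <<s cylinders >>.
Proof.
apply/seteqP; split; last first.
  apply: smallest_sub; first exact: sigma_algebra_measurable.
  by move=> _ [F [A [mA ->]]]; exact: measurable_cylinder.
apply: smallest_sub; first exact: smallest_sigma_algebra.
move=> _ [i _ [A mA <-]]; rewrite setTI; apply: sub_sigma_algebra.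
exists [fset i]%fset, (fun=> A); split => //.
apply/seteqP; split => e /=; first by move=> Ae j /fset1P ->.
by apply; rewrite fset11.
Qed.

Lemma cylinders_setI : setI_closed cylinders.
Proof.
move=> _ _ [F [A [mA ->]]] [F' [A' [mA' ->]]].
exists (F `|` F')%fset, (fun i => (if i \in F then A i else setT) `&`
  (if i \in F' then A' i else setT)).
split.
  by move=> i _; apply: measurableI; case: ifPn => // ?; first [exact: mA|exact: mA'].
apply/seteqP; split => [e [h h'] i _|e h].
  by split; case: ifP => //; auto.
split=> i iF; have := h i; rewrite inE iF ?orbT => /(_ isT)[]; auto.
Qed.

End product_measurability.

Section iid.
Context (I : choiceType) d (T : measurableType d) (R : realType).
Variables (m : set T -> \bar R) (Th : probability (prod_space I T) R).
Hypothesis iid : is_iid_product m Th.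

Lemma iid_marginal i A : measurable A ->
  Th [set e : prod_space I T | A (e i)] = m A.
Proof.
move=> mA; have := @iid [fset i]%fset (fun=> A) (fun _ _ => mA).
rewrite big_seq_fset1 => <-; congr (Th _).
apply/seteqP; split => e /=; first by move=> Ae j /fset1P ->.
by apply; rewrite fset11.
Qed.

Lemma iid_ae A : countable [set: I] -> measurable A -> m A = 1%E ->
  {ae Th, forall e, forall i, A (e i)}.
Proof.
move=> cI mA mA1; apply: ae_countable => // i.
apply/(ae_probability1 Th (measurable_coordinate_set i mA)).
by rewrite iid_marginal.
Qed.

Section independence.
Variables (V : set I) (F : {fset I}) (A : I -> set T) (e0 : prod_space I T).
Hypothesis VF : forall i, i \in F -> ~ V i.
Hypothesis mA : forall i, i \in F -> measurable (A i).

(** Freezing the coordinates outside V turns dependence on V alone into invariance, W = W o rho, so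
    independence can be stated about image measures. *)
Let rho (e : prod_space I T) : prod_space I T :=
  fun i => if pselect (V i) then e i else e0 i.

Let mrho : measurable_fun setT rho.
Proof.
apply: measurable_prod_space => i; rewrite /rho.
case: (pselect (V i)) => Vi; last exact: measurable_cst.
exact: measurable_coordinate.
Qed.

Let B := cylinder F A.
Let mB : measurable B. Proof. exact: measurable_cylinder. Qed.

Let indep_cylinder C : cylinders C ->
  Th (rho @^-1` C `&` B) = (Th B * Th (rho @^-1` C))%E.
Proof.
move=> [F' [A' [mA' ->]]].
(* A cylinder that rejects a frozen value has empty preimage; otherwise its constraints outside V
   are vacuous after freezing. *)
have [noV|hV] := pselect (exists i, [/\ i \in F', ~ V i & ~ A' i (e0 i)]).
  have -> : rho @^-1` cylinder F' A' = set0.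
    apply/seteqP; split => // e h; have [i [iF' nV nA]] := noV.
    by have := h i iF'; rewrite /rho; case: pselect.
  by rewrite set0I measure0 mule0.
pose FV := [fset i in F' | `[< V i >]]%fset.
have -> : rho @^-1` cylinder F' A' = cylinder FV A'.
  apply/seteqP; split => e h i.
    rewrite !inE /= => /andP[iF' /asboolP Vi]; have := h i iF'.
    by rewrite /rho; case: pselect.
  move=> iF'; rewrite /rho; case: pselect => Vi.
    by apply: h; rewrite !inE /= iF'; exact/asboolP.
  by apply: contrapT => nA; apply: hV; exists i.
pose A'' i := if i \in F then A i else A' i.
have FVF i : i \in FV -> i \notin F.
  by rewrite !inE => /andP[_ /asboolP Vi]; apply/negP => /VF.
have mFV i : i \in FV -> measurable (A' i) by rewrite !inE => /andP[+ _]; exact: mA'.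
have -> : cylinder FV A' `&` B = cylinder (F `|` FV)%fset A''.
  apply/seteqP; split => [e [h1 h2] i|e h].
    rewrite inE /A''; case: ifP => iF /=; first by move=> _; exact: h2.
    exact: h1.
  split => i iF; have := h i; rewrite inE iF ?orbT /A''.
    by rewrite (negbTE (FVF i iF)); apply.
  by rewrite iF; apply.
rewrite (iid (F := FV) (A := A')) ?(iid (F := F) (A := A))//.
rewrite iid; last first.
  move=> i; rewrite inE /A''; case: ifP => iF /=; first by move=> _; exact: mA.
  exact: mFV.
have FFV : perm_eq (F `|` FV)%fset (enum_fset F ++ enum_fset FV).
  apply: uniq_perm; rewrite ?fset_uniq//; last first.
    by move=> i; rewrite mem_cat inE.
  rewrite cat_uniq !fset_uniq andbT; apply/hasPn => i; exact: FVF.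
rewrite (perm_big _ FFV) big_cat /=.
congr (_ * _)%E; apply: eq_big_seq => i iF; rewrite /A''; first by rewrite iF.
by rewrite (negbTE (FVF i iF)).
Qed.

(** V may be infinite while the product formula speaks of finite cylinders. The image under [rho] of
    Th restricted to B, and Th B times the image of Th, agree on cylinders, which form a generating
    pi-system; W is then integrated against both. *)
Lemma iid_integral_indep (W : prod_space I T -> \bar R) :
  measurable_fun setT W -> (forall e, 0 <= W e)%E ->
  (forall e1 e2, (forall i, V i -> e1 i = e2 i) -> W e1 = W e2) ->
  (\int[Th]_(e in B) W e = Th B * \int[Th]_e W e)%E.
Proof.
move=> mW W0 WV.
have Wrho e : W e = (W \o rho) e.
  by apply: WV => i Vi; rewrite /rho; case: pselect.
have PB : Th B = (fine (Th B))%:E by rewrite fineK// fin_num_measure.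
have fB0 : 0 <= fine (Th B) by exact/fine_ge0/measure_ge0.
pose c := NngNum fB0.
pose m1 := pushforward (mrestr Th mB) rho.
pose m2 := mscale c (pushforward Th rho).
have m12 C : measurable C -> m1 C = m2 mrho C.
  apply: (@measure_unique _ _ _ (@cylinders I _ T) (fun=> setT)) => //.
  - exact: cylinders_generate.
  - exact: cylinders_setI.
  - move=> _; exists fset0, (fun=> setT); split => //.
    by apply/seteqP; split.
  - exact: bigcup_const.
  - move=> C0 hC0.
    change (Th (rho @^-1` C0 `&` B) = (fine (Th B))%:E * Th (rho @^-1` C0))%E.
    by rewrite indep_cylinder// -PB.
  - move=> _; change (Th (rho @^-1` setT `&` B) < +oo)%E.
    by rewrite preimage_setT setTI -ge0_fin_numE// fin_num_measure.
have W0' : {in setT, forall y, 0 <= W y}%E by move=> y _.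
transitivity (\int[mrestr Th mB]_e W (rho e))%E.
  have mWrho : measurable_fun setT (W \o rho) by exact: measurableT_comp.
  rewrite -[setT in RHS](setvU B) setUC ge0_integral_setU//; last 3 first.
  - exact: measurableC.
  - exact: measurable_funS mWrho.
  - by rewrite disj_set2E setICr.
  rewrite [X in _ = (_ + X)%E](_ : _ = 0%E) ?adde0; last first.
    rewrite (eq_measure_integral mzero) ?integral_measure_zero// => C mC CB.
    change (Th (C `&` B) = 0%E).
    by rewrite (_ : C `&` B = set0) ?measure0//; exact/disjoints_subset.
  rewrite (eq_measure_integral Th); last by move=> C mC CB; change (Th (C `&` B) = Th C); rewrite setIidl.
  by apply: eq_integral => e _; exact: Wrho.
rewrite -[setT in LHS](preimage_setT rho) -(ge0_integral_pushforward mrho)//.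
rewrite (eq_measure_integral (m2 mrho)); last by move=> C mC _; exact: m12.
rewrite ge0_integral_mscale//.
rewrite ge0_integral_pushforward//= preimage_setT.
by rewrite -PB; congr (_ * _)%E; apply: eq_integral => e _; rewrite [RHS]Wrho.
Qed.

End independence.
End iid.

(** * The support of the offspring law and measurability of the laws *)

Section rational_boxes.
Context (R : realType).

Definition box (l : seq (nat * (rat * rat))) : set (nat -> R) :=
  [set nu | forall p, p \in l -> ratr p.2.1 < nu p.1 < ratr p.2.2].

Lemma measurable_box l : measurable (box l : set (offspring_space R)).
Proof.
rewrite (_ : box l = \bigcap_(p in [set` l])
    [set nu : offspring_space R | `]ratr p.2.1, ratr p.2.2[%classic (nu p.1)]).
  apply: fin_bigcap_measurable => // p _.
  exact: (@measurable_coordinate_set nat _ (measurableTypeR R) p.1).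
by apply/seteqP; split => nu h p pl; have := h p pl; rewrite /= in_itv.
Qed.

Lemma box_basis (U : set {ptws nat -> R}) (nu : nat -> R) : open U -> U nu ->
  exists2 l, box l nu & box l `<=` U.
Proof.
move=> oU Unu.
(* This filter converges to nu in each coordinate, hence pointwise, so every neighbourhood of nu
   contains a box around nu. Boxes are countable in number, which makes open sets measurable. *)
pose F : set_system (nat -> R) := [set A | exists2 l, box l nu & box l `<=` A].
have FF : Filter F.
  apply: Build_Filter => [|A B [l hl lA] [l' hl' lB]|A B AB [l hl lA]].
  - by exists [::].
  - exists (l ++ l') => [p|nu' h]; first by rewrite mem_cat => /orP[/hl|/hl'].
    by split; [apply: lA|apply: lB] => p pl; apply: h; rewrite mem_cat pl ?orbT.
  - by exists l => //; exact: subset_trans AB.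
have : {ptws, F --> nu}.
  apply/pointwise_cvgP => t; apply/cvgrPdist_lt => e e0.
  have [q1 /andP[q1a q1b]] : exists q : rat, nu t - e < ratr q < nu t.
    by have [|q] := @rat_in_itvoo R (nu t - e) (nu t); [rewrite gtrBl|rewrite in_itv; exists q].
  have [q2 /andP[q2a q2b]] : exists q : rat, nu t < ratr q < nu t + e.
    by have [|q] := @rat_in_itvoo R (nu t) (nu t + e); [rewrite ltrDl|rewrite in_itv; exists q].
  exists [:: (t, (q1, q2))] => [p|nu' h].
    by rewrite inE => /eqP -> /=; rewrite q1b q2a.
  have /= /andP[h1 h2] := h (t, (q1, q2)) (mem_head _ _).
  by rewrite /= ltr_norml; apply/andP; split; lra.
by move=> /(_ U); apply; exact: open_nbhs_nbhs.
Qed.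

Lemma measurable_ptws_open (U : set {ptws nat -> R}) : open U ->
  measurable (U : set (offspring_space R)).
Proof.
move=> oU; rewrite (_ : U = \bigcup_(l in [set l | box l `<=` U]) box l).
  rewrite bigcup_mkcond; apply: countable_bigcupT_measurable => // l.
  by case: ifP => // _; exact: measurable_box.
apply/seteqP; split => [nu Unu|nu [l lU hl]]; last exact: lU.
by have [l hl lU] := box_basis oU Unu; exists l.
Qed.

Lemma open_ptws_coordinate k (A : set R) : open A ->
  open ([set nu | A (nu k)] : set {ptws nat -> R}).
Proof.
move=> oA; apply: (open_comp _ oA) => nu _.
exact: (@proj_continuous nat (fun=> R) k nu).
Qed.

End rational_boxes.

Section law_sets.
Context (R : realType).

Lemma measurable_step_laws (G : groupType) (S : {fset G}) :
  measurable (step_laws R S : set (step_space R S)).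
Proof.
rewrite (_ : step_laws R S = \bigcap_(s in [set: S])
   [set w : step_space R S | `[0, +oo[%classic (w s)] `&`
   (setT `&` (fun w : step_space R S => \sum_(s : S) (w s : R)) @^-1` [set 1])).
  apply: measurableI.
    apply: fin_bigcap_measurable => [|s _]; first exact: finite_finset.
    exact: (@measurable_coordinate_set S _ (measurableTypeR R) s).
  have : measurable_fun setT (fun w : step_space R S => \sum_(s : S) (w s : R)).
    apply: measurable_sum => s.
    exact: (@measurable_coordinate S _ (measurableTypeR R) s).
  by apply.
apply/seteqP; split => [w [w0 w1]|w [w0 [_ w1]]].
  by split => // s _; rewrite /= in_itv /= w0.
by split => // s; have := w0 s Logic.I; rewrite /= in_itv /= andbT.
Qed.

(** Absolute values make the terms nonnegative at every sequence, and change nothing at offspring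
    laws. *)
Lemma measurable_offspring_series (c : nat -> R) : (forall k, 0 <= c k) ->
  measurable_fun setT
    (fun nu : offspring_space R => (\sum_(k <oo) (c k * `|nu k|)%:E)%E).
Proof.
move=> c0.
apply: (eq_measurable_fun (fun nu : offspring_space R =>
   (\sum_(k <oo | k \in predT) (c k * `|nu k|)%:E)%E)) => //.
apply: ge0_emeasurable_sum => [k nu _ _|k _]; first by rewrite lee_fin mulr_ge0.
apply/measurable_EFinP; apply: measurable_funM => //.
apply: measurableT_comp => //.
exact: (@measurable_coordinate nat _ (measurableTypeR R) k).
Qed.

Lemma measurable_offspring_laws :
  measurable (offspring_laws R : set (offspring_space R)).
Proof.
rewrite (_ : offspring_laws R =
  [set nu : offspring_space R | [set 0] (nu 0%N)] `&`
  \bigcap_k [set nu : offspring_space R | `[0, +oo[%classic (nu k)] `&`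
  (setT `&` (fun nu : offspring_space R => (\sum_(k <oo) (1 * `|nu k|)%:E)%E)
     @^-1` [set 1%E]) `&`
  (setT `&` (fun nu : offspring_space R => (\sum_(k <oo) (k%:R * `|nu k|)%:E)%E)
     @^-1` (~` [set +oo%E]))).
  apply: measurableI; last first.
    apply: measurable_offspring_series => //.
    exact/measurableC/emeasurable_set1.
  apply: measurableI; last first.
    by apply: measurable_offspring_series => //; exact: emeasurable_set1.
  apply: measurableI; last apply: bigcapT_measurable => k.
    exact: (@measurable_coordinate_set nat _ (measurableTypeR R) 0).
  exact: (@measurable_coordinate_set nat _ (measurableTypeR R) k).
have absE (nu : nat -> R) : (forall k, 0 <= nu k) -> forall k, `|nu k| = nu k.
  by move=> nu0 k; rewrite ger0_norm.
apply/seteqP; split => [nu [nu0 nuge nus num]|nu [[[nu0 nuge] [_ nus]] [_ num]]].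
  split; [split; [split|]|]; [by []|by move=> k _; rewrite /= in_itv /= nuge|..].
    by split=> //=; rewrite -[RHS]nus; apply: eq_eseriesr => k _; rewrite mul1r absE.
  split=> //=; rewrite (eq_eseriesr (g := fun k => (k%:R * nu k)%:E)).
    by move=> h; move: num; rewrite /mean h ltxx.
  by move=> k _; rewrite absE.
have nuge' k : 0 <= nu k by have := nuge k Logic.I; rewrite /= in_itv /= andbT.
split => //.
  by rewrite -[RHS]nus; apply: eq_eseriesr => k _; rewrite mul1r absE.
rewrite ltey /mean (eq_eseriesr (g := fun k => (k%:R * `|nu k|)%:E)).
  exact/eqP.
by move=> k _; rewrite absE.
Qed.

End law_sets.

Lemma generates_countable (G : groupType) (S : {fset G}) :
  generates S -> countable [set: G].
Proof.
move=> genS.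
pose f (l : seq S) : G := (\big[*%g/1]_(s <- l) val s)%g.
have -> : [set: G] = f @` [set: seq S].
  apply/seteqP; split => // x _; have [l lS ->] := genS x.
  have [l' <-] : exists l' : seq S, map val l' = l.
    elim: l lS => [|y l IH] lS; first by exists [::].
    have yS : y \in S by apply: lS; rewrite mem_head.
    have [l' <-] := IH (fun z zl => lS z (mem_behead (s := y :: l) zl)).
    by exists ([` yS]%fset :: l').
  by exists l' => //; rewrite /f big_map.
exact/(sub_countable (card_image_le _ _))/countableP.
Qed.

Section offspring.
Context (R : realType).

Definition branching_laws : set (offspring_space R) := [set nu | nu 1%N < 1].

Lemma offspring_trivial (nu : nat -> R) :
  offspring_laws R nu -> 1 <= nu 1%N -> mean nu = 1%E.
Proof.
move=> law nu1; have [nu0 nu_ge0 nus _] := law.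
rewrite -nus; apply: eq_eseriesr => -[|[|k]] _; rewrite ?nu0 ?mul0r ?mul1r//.
suff -> : nu k.+2 = 0 by rewrite mulr0.
apply/eqP; rewrite eq_le nu_ge0 andbT.
have := offspring_mass_le1 law k.+3.
rewrite seriesEnat /= big_nat_recr//= !big_nat_recl//= nu0.
have : 0 <= \sum_(0 <= i < k) nu i.+2 by exact: sumr_ge0.
lra.
Qed.

Variable Qt : probability (offspring_space R) R.
Hypothesis Qt_laws : Qt (offspring_laws R) = 1%E.

(** [offspring_support] quantifies over all open sets. Testing only countably many boxes gives a
    measurable subset, and one of full measure because the null boxes have a null union. *)
Definition support_core : set (offspring_space R) :=
  offspring_laws R `&` [set nu | forall l, box l nu -> (0 < Qt (box l))%E].

Lemma support_core_sub : support_core `<=` offspring_support Qt.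
Proof.
move=> nu [law core]; split => // U oU Unu.
have [l hl lU] := box_basis oU Unu.
apply: lt_le_trans (core l hl) _; apply: le_measure; rewrite ?inE//.
  exact: measurable_box.
exact: measurable_ptws_open.
Qed.

Lemma measurable_support_core : measurable support_core.
Proof.
apply: measurableI; first exact: measurable_offspring_laws.
pose F l : set (offspring_space R) :=
  if pselect (0 < Qt (box l))%E then setT else ~` box l.
rewrite [X in measurable X](_ : _ = \bigcap_l F l).
  apply: countable_bigcapT_measurable => // l; rewrite /F.
  by case: pselect => ?; [exact: measurableT|apply: measurableC; exact: (@measurable_box R l)].
apply/seteqP; split => [nu h l _|nu h l bl].
  by rewrite /F; case: pselect => // nQ bl; apply: nQ; exact: h.
by have := h l Logic.I; rewrite /F; case: pselect.
Qed.

Lemma support_core1 : Qt support_core = 1%E.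
Proof.
apply/(ae_probability1 Qt measurable_support_core).
have h1 : {ae Qt, forall nu, offspring_laws R nu}.
  by apply/(ae_probability1 Qt _).1 => //; exact: measurable_offspring_laws.
have h2 : {ae Qt, forall nu, forall l, box l nu -> (0 < Qt (box l))%E}.
  apply: ae_countable => [|l]; first exact: countableP.
  have [Q0|Q0] := pselect (0 < Qt (box l))%E; first exact: aeW.
  exists (box l); split; first exact: measurable_box.
    by apply/eqP; rewrite -measure_le0 leNgt; exact/negP.
  by move=> nu /= h; apply: contrapT => nb; apply: h.
by apply: filterS2 h1 h2 => nu ? ?; split.
Qed.

Lemma mstar_gt (a : R) : (a%:E < mstar Qt)%E ->
  exists2 nu, offspring_support Qt nu & (a%:E < mean nu)%E.
Proof.
move=> am; apply: contrapT => h; move: am; apply/negP; rewrite -leNgt.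
apply: ge_ereal_sup => _ [nu snu <-]; rewrite leNgt; apply/negP => anu.
by apply: h; exists nu.
Qed.

Lemma branching_probability_gt0 : (1 < mstar Qt)%E ->
  (0 < Qt branching_laws)%E.
Proof.
move=> /mstar_gt[nu [law Unu] mean1].
have oU : open ([set nu | nu 1%N < 1] : set {ptws nat -> R}).
  by apply: (@open_ptws_coordinate R 1%N [set x | x < 1]); exact: open_lt.
apply: (Unu _ oU) => /=; rewrite ltNge; apply/negP => nu1.
by move: mean1; rewrite offspring_trivial// ltxx.
Qed.

End offspring.

(** * Kernels and sites of almost every environment *)

Section environment_ae.
Context (R : realType) (G : groupType) (S : {fset G}).
Variables (Q : probability (step_space R S) R) (Qt : probability (offspring_space R) R).
Variable Th : probability (env_space R G S) R.
Hypothesis iid : is_iid_product (Q \x Qt)%E Th.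
Hypothesis G_countable : countable [set: G].

Lemma environment_ae A1 A2 : measurable A1 -> measurable A2 ->
  Q A1 = 1%E -> Qt A2 = 1%E ->
  {ae Th, forall e, forall x, A1 (env_step e x) /\ A2 (env_offspring e x)}.
Proof.
move=> mA1 mA2 Q1 Qt1.
have := iid_ae (A := A1 `*` A2) iid G_countable.
apply; first exact: measurableX.
transitivity (Q A1 * Qt A2)%E; first exact: product_measure1E.
by rewrite Q1 Qt1 mule1.
Qed.

Lemma branching_site_ae : infinite_set [set: G] ->
  (0 < Qt (@branching_laws R))%E ->
  {ae Th, forall e, exists x, env_offspring e x 1%N < 1}.
Proof.
move=> infG B0.
pose B := @branching_laws R.
have mB : measurable B.
  apply: (@measurable_coordinate_set nat _ (measurableTypeR R) 1%N [set x | x < 1]).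
  by rewrite -set_itvNyo; exact: measurable_itv.
pose C := [set: step_space R S] `*` ~` B.
have mC : measurable C by apply: measurableX => //; exact: measurableC.
pose c := fine (Qt (~` B)).
have cE : Qt (~` B) = c%:E by rewrite fineK// fin_num_measure//; exact: measurableC.
have c0 : 0 <= c by exact/fine_ge0/measure_ge0.
have c1 : c < 1.
  have BE : Qt B = (fine (Qt B))%:E by rewrite fineK// fin_num_measure.
  have : c%:E = (1 - fine (Qt B))%:E by rewrite -cE probability_setC// BE.
  by move=> [->]; rewrite gtrBl -lte_fin -BE.
pose N := [set e : env_space R G S | forall x, C (e x)].
have mN : measurable N.
  rewrite (_ : N = \bigcap_x [set e : env_space R G S | C (e x)]).
    apply: countable_bigcapT_measurable => // x.
    exact: measurable_coordinate_set.
  by apply/seteqP; split => [e h x _|e h x]; [exact: h|exact: (h x Logic.I)].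
exists N; split => //; last first.
  move=> e /forallNP h x; split => //; by move=> Bx; apply: (h x); exact: Bx.
(* Infinitely many sites allow any number n of independent trials, each without branching with
   probability c < 1. *)
have NC n : (Th N <= (c ^+ n)%:E)%E.
  have [F _ nF] := infinite_set_fset n infG.
  apply: (@le_trans _ _ (Th (cylinder F (fun=> C)))).
    apply: le_measure; rewrite ?inE//; first exact: measurable_cylinder.
    by move=> e h x _; exact: h.
  rewrite [X in (X <= _)%E]iid//.
  have -> : (Q \x Qt)%E C = c%:E.
    transitivity (Q setT * Qt (~` B))%E.
      by apply: product_measure1E => //; exact: measurableC.
    by rewrite probability_setT mul1e cE.
  rewrite prodEFin lee_fin big_const_seq count_predT iter_mulr_1.
  by apply: ler_wiXn2l => //; exact: ltW.
have NE : Th N = (fine (Th N))%:E by rewrite fineK// fin_num_measure.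
change (Th N = 0%E); rewrite NE; congr EFin; apply/eqP.
rewrite eq_le fine_ge0 ?andbT; last exact: measure_ge0.
have : (fun n => c ^+ n) @ \oo --> 0 by apply: cvg_expr; rewrite ger0_norm.
by move=> /cvgr_to_ge; apply; apply: nearW => n; rewrite -lee_fin -NE.
Qed.

End environment_ae.

Section environment_kernel.
Context (R : realType) (G : groupType) (S : {fset G}).
Variable e : env_space R G S.
Hypothesis e_law : forall x, step_laws R S (env_step e x).

Let P := env_kernel e.

Lemma env_kernelE x (s : S) : P x (x * val s)%g = env_step e x s.
Proof. by rewrite /P /env_kernel mulKg valK. Qed.

Lemma env_kernel_ge0 x y : 0 <= P x y.
Proof.
by rewrite /P /env_kernel; case: insub => // s; have [+ _] := e_law x; apply.
Qed.

Lemma env_kernel_sum x : \sum_(s <- S) P x (x * s)%g = 1.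
Proof.
have [_ <-] := e_law x.
by rewrite (big_seq_fsetE _ S xpredT) /=; apply: eq_bigr => s _; exact: env_kernelE.
Qed.

Lemma env_kernel_notin x y : (x^-1 * y)%g \notin S -> P x y = 0.
Proof. by move=> nS; rewrite /P /env_kernel insubN. Qed.

(** The bound depends on the word but not on the starting point; this uniformity is what
    [short_path] needs. *)
Lemma env_kernel_word (S' : {fset G}) (gamma : R) (l : seq G) x :
  (S' `<=` S)%fset -> 0 < gamma ->
  (forall x (s : S), val s \in S' -> gamma < env_step e x s) ->
  {subset l <= S'} ->
  gamma ^+ size l <=
    iter (size l) (avg S P) (ind R (x * \big[*%g/1%g]_(s <- l) s)%g) x.
Proof.
move=> S'S g0 ell; elim: l x => [|s l IH] x lS.
  by rewrite big_nil mulg1 expr0 /= /ind eqxx.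
have sS' : s \in S' by apply: lS; rewrite mem_head.
have sS : s \in S by exact: (fsubsetP S'S).
rewrite /= {1}/avg (bigD1_seq s) ?fset_uniq//= big_cons exprS.
rewrite -[leLHS]addr0; apply: lerD; last first.
  apply: sumr_ge0 => s' _; apply: mulr_ge0; first exact: env_kernel_ge0.
  by apply: iter_avg_ge0 => y; [move=> ?; exact: env_kernel_ge0|exact: ind_ge0].
apply: ler_pM; rewrite ?exprn_ge0 ?(ltW g0)//.
  have := ell x [` sS]%fset sS'; rewrite -env_kernelE /= => /ltW; apply: le_trans.
  by [].
by rewrite mulgA; apply: IH => y yl; apply: lS; rewrite inE yl orbT.
Qed.

Lemma env_kernel_irr (S' : {fset G}) (gamma : R) x y :
  (S' `<=` S)%fset -> 0 < gamma ->
  (forall x (s : S), val s \in S' -> gamma < env_step e x s) ->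
  generates S' -> exists k, 0 < iter k (avg S P) (ind R y) x.
Proof.
move=> S'S g0 ell gen; have [l lS lE] := gen (x^-1 * y)%g.
exists (size l); apply: lt_le_trans (exprn_gt0 (size l) g0) _.
by have := env_kernel_word x S'S g0 ell lS; rewrite -lE mulVKg.
Qed.

End environment_kernel.

(** * Spectral radius and return probabilities *)

Section spectral_radius.
Context (R : realType) (G : groupType) (S : {fset G}).
Variable P : G -> G -> R.
Hypothesis P0 : forall x y, 0 <= P x y.
Hypothesis irr : forall x y, exists k, 0 < iter k (avg S P) (ind R y) x.

Let p n x y := iter n (avg S P) (ind R y) x.

Let p_ge0 n x y : 0 <= p n x y.
Proof. by apply: iter_avg_ge0 => // z; exact: ind_ge0. Qed.

Let root_expr n (x : R) : (0 < n)%N -> 0 <= x -> (x `^ n%:R^-1) ^+ n = x.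
Proof.
move=> n0 x0; rewrite -powR_mulrn ?powR_ge0// -powRrM mulVf ?powRr1//.
by rewrite pnatr_eq0 -lt0n.
Qed.

Lemma spectral_radius_lt (sig : R) : (spectral_radius S P < sig%:E)%E ->
  exists N, forall n, (N <= n)%N -> (0 < n)%N -> p n 1%g 1%g <= sig ^+ n.
Proof.
rewrite /spectral_radius /limn_esup /limf_esup => /ereal_inf_lt[_ [V [N _ NV] <-] hV].
exists N => n Nn n0.
have : ((nstep S P n 1%g 1%g `^ n%:R^-1)%:E < sig%:E)%E.
  by apply: le_lt_trans hV; apply: ereal_sup_ubound; exists n => //; exact: NV.
rewrite lte_fin nstepE -/(p n _ _) => /ltW h.
rewrite -[leLHS](root_expr n0)//; apply: lerXn2r => //; rewrite nnegrE ?powR_ge0//.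
exact: le_trans (powR_ge0 _ _) h.
Qed.

Lemma spectral_radius_gt (tau : R) : 0 <= tau -> (tau%:E < spectral_radius S P)%E ->
  exists n, (0 < n)%N /\ tau ^+ n < p n 1%g 1%g.
Proof.
move=> tau0 htau.
(* A tail of the limsup that leaves out time 0, where the root carries no information on the return
   probabilities. *)
pose V : set nat := [set n | (0 < n)%N].
have oV : (\oo : set (set nat)) V by exists 1%N.
have : (tau%:E < ereal_sup
    [set (nstep S P n 1%g 1%g `^ n%:R^-1)%:E | n in V])%E.
  by apply: lt_le_trans htau _; apply: ereal_inf_lbound; exists V.
move=> /ereal_sup_gt[_ [n n0 <-]]; rewrite lte_fin nstepE -/(p n _ _) => h.
exists n; split => //; rewrite -[ltRHS](root_expr n0)//.
by rewrite ltr_pXn2r ?nnegrE ?powR_ge0.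
Qed.

Lemma spectral_radius_bound (sig : R) : 0 < sig -> (spectral_radius S P < sig%:E)%E ->
  exists2 C, 0 < C & forall n, p n 1%g 1%g <= C * sig ^+ n.
Proof.
move=> s0 /spectral_radius_lt[N hN].
pose C := 1 + \sum_(k < N.+1) p k 1%g 1%g / sig ^+ k.
have sum0 : 0 <= \sum_(k < N.+1) p k 1%g 1%g / sig ^+ k.
  by apply: sumr_ge0 => k _; apply: divr_ge0 => //; exact/exprn_ge0/ltW.
have C1 : 1 <= C by rewrite /C lerDl.
exists C => [|n]; first exact: lt_le_trans ltr01 C1.
have [nN|Nn] := leqP n N; last first.
  apply: le_trans (hN n (ltnW Nn) (leq_ltn_trans (leq0n N) Nn)) _.
  by apply: ler_peMl => //; exact/exprn_ge0/ltW.
rewrite -ler_pdivrMr ?exprn_gt0// /C (bigD1 (Ordinal (nN : (n < N.+1)%N)))//=.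
rewrite addrCA lerDl addr_ge0// sumr_ge0// => k _.
by apply: divr_ge0 => //; exact/exprn_ge0/ltW.
Qed.

(** Closing the path as 1 to x to y to 1 compares it with a return to 1; the two outer legs are
    fixed and only enter the constant. *)
Lemma spectral_radius_bound_all (sig : R) x y : 0 < sig ->
  (spectral_radius S P < sig%:E)%E ->
  exists2 C, 0 < C & forall n, p n x y <= C * sig ^+ n.
Proof.
move=> s0 hs; have [C C0 hC] := spectral_radius_bound s0 hs.
have [k hk] := irr 1%g x; have [l hl] := irr y 1%g.
rewrite -/(p k 1%g x) in hk; rewrite -/(p l y 1%g) in hl.
exists (C * sig ^+ (k + l) / (p k 1%g x * p l y 1%g)) => [|n].
  by rewrite divr_gt0 ?mulr_gt0// exprn_gt0.
rewrite mulrAC ler_pdivlMr ?mulr_gt0//.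
apply: (@le_trans _ _ (p (k + (n + l)) 1%g 1%g)).
  apply: le_trans (nstep_mul S P0 k (n + l) 1%g x 1%g).
  rewrite mulrC -mulrA; apply: ler_wpM2l => //.
  rewrite mulrC; exact: nstep_mul.
apply: le_trans (hC _) _; rewrite -mulrA -exprD.
by rewrite addnA [(k + l + n)%N]addnAC.
Qed.

Lemma spectral_radius_gt0 k : (0 < k)%N -> 0 < p k 1%g 1%g ->
  (0 < spectral_radius S P)%E.
Proof.
move=> k0; set c := p k 1%g 1%g => c0.
rewrite ltNge; apply/negP => rho0.
(* Since sig <= 1 and k > 0, sig^k <= sig <= c/2 < c, which contradicts the lower bound c^j for
   returns at time j k. *)
pose sig := Num.min 1 (c / 2).
have sig0 : 0 < sig by rewrite lt_min ltr01 divr_gt0.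
have sigc : sig ^+ k < c.
  apply: (@le_lt_trans _ _ sig).
    rewrite -(prednK k0) exprS ler_piMr// ?(ltW sig0)//.
    by apply: exprn_ile1; [exact: ltW|rewrite ge_min lexx].
  apply: (@le_lt_trans _ _ (c / 2)); first by rewrite ge_min lexx orbT.
  by lra.
have [|C C0 hC] := @spectral_radius_bound sig sig0.
  by apply: le_lt_trans rho0 _; rewrite lte_fin.
have pj j : c ^+ j <= p (j * k) 1%g 1%g.
  elim: j => [|j IH]; first by rewrite mul0n expr0 /p /= /ind eqxx.
  rewrite mulSn exprS; apply: le_trans (nstep_mul S P0 k (j * k) 1%g 1%g 1%g).
  by apply: ler_wpM2l => //; exact: ltW.
have a1 : 1 < c / sig ^+ k by rewrite ltr_pdivlMr ?exprn_gt0// mul1r.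
have [j] := expr_unbounded (C + 1) a1.
apply/negP; rewrite -ltNge expr_div_n ltr_pdivrMr; last by rewrite !exprn_gt0.
apply: le_lt_trans (pj j) _; apply: le_lt_trans (hC _) _.
by rewrite mulnC exprM ltr_pM2r ?ltrDl// !exprn_gt0.
Qed.

Lemma green_mean_bounded (rho : R) (m : G -> R) (b x : G) (t : R) :
  0 < rho -> spectral_radius S P = rho%:E ->
  (forall x, 0 <= m x <= rho^-1) -> 0 < t < 1 ->
  exists C, forall N, green S (mean_kernel P m) b t N x <= C.
Proof.
move=> rho0 rhoE m0 /andP[t0 t1].
(* q lies strictly between t and 1, so sig > rho is an admissible rate, and t sig / rho = q < 1
   makes the Green series geometric. *)
pose q := (t + 1) / 2; pose sig := rho * q / t.
have q0 : 0 < q by rewrite divr_gt0//; lra.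
have q1 : q < 1 by rewrite /q; lra.
have tq : t < q by rewrite /q; lra.
have sig0 : 0 < sig by rewrite divr_gt0// mulr_gt0.
have [|C C0 hC] := @spectral_radius_bound_all sig x b sig0.
  by rewrite rhoE lte_fin /sig ltr_pdivlMr// ltr_pM2l.
exists (C / (1 - q)) => N.
have iterK n y : iter n (avg S (mean_kernel P m)) (ind R b) y <=
    rho^-1 ^+ n * iter n (avg S P) (ind R b) y.
  elim: n y => [|n IH] y; first by rewrite expr0 mul1r.
  rewrite /= avg_mean_kernel exprS -mulrA -[X in _ <= _ * X]avgZ.
  have [m0y my] := andP (m0 y).
  apply: ler_pM => //.
    apply: avg_ge0 => // z; apply: iter_avg_ge0 => [w w'|w]; last exact: ind_ge0.
    by apply: mulr_ge0 => //; case/andP: (m0 w).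
  exact: avg_le.
rewrite ler_pdivlMr ?subr_gt0//.
have geom M : \sum_(0 <= k < M) q ^+ k * (1 - q) = 1 - q ^+ M.
  elim: M => [|M IH]; first by rewrite big_geq// expr0 subrr.
  by rewrite big_nat_recr//= IH exprS; ring.
apply: (@le_trans _ _ (C * \sum_(0 <= k < N) q ^+ k * (1 - q))).
  rewrite /green mulr_suml mulr_sumr; apply: ler_sum => k _.
  rewrite mulrA; apply: ler_wpM2r; first by rewrite subr_ge0 ltW.
  apply: (@le_trans _ _ (t ^+ k * (rho^-1 ^+ k * (C * sig ^+ k)))).
    apply: ler_wpM2l; first exact/exprn_ge0/ltW.
    apply: le_trans (iterK k x) _; apply: ler_wpM2l.
      by apply: exprn_ge0; rewrite invr_ge0 ltW.
    exact: hC.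
  have <- : t * (rho^-1 * sig) = q.
    by rewrite /sig; field; rewrite ?gt_eqF.
  by rewrite !exprMn; lra.
rewrite geom ler_piMr ?(ltW C0)// gerBl; exact/exprn_ge0/ltW.
Qed.

End spectral_radius.

(** * Tiling by cells and exploration by the walk *)

Lemma exists_cells (G : groupType) (F : {fset G}) : 1%g \in F ->
  exists c : G -> G,
    (forall x y, y \in F -> c (c x * y)%g = c x) /\
    (forall x, exists y y', [/\ y \in F, y' \in F & c x = (x * y * y'^-1)%g]).
Proof.
move=> F1.
(* The centres form a maximal set A with disjoint translates z F. Points of z F are sent to z, any
   other x to a centre z such that x F meets z F, which exists by maximality. A cell thus contains
   the F-translate of its centre and has bounded size. *)
pose packed (A : set G) := forall z z' y y', A z -> A z' -> y \in F -> y' \in F ->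
  (z * y = z' * y')%g -> z = z'.
have [A [pA maxA]] : exists A, packed A /\ forall B, A `<` B -> ~ packed B.
  apply: Zorn_bigcup => C CP totC z z' y y' [X CX Xz] [X' CX' X'z'].
  have [XX'|X'X] := totC X X' CX CX'.
    exact: (CP X' CX') (XX' _ Xz) X'z'.
  exact: (CP X CX) Xz (X'X _ X'z').
have near x : exists z, A z /\ exists y y',
    [/\ y \in F, y' \in F & (x * y = z * y')%g].
  apply: contrapT => far.
  have nAx : ~ A x by move=> Ax; apply: far; exists x; split => //; exists 1%g, 1%g.
  apply: (maxA (A `|` [set x])).
    by split => [z|/(_ x)]; [left|move=> h; apply: nAx; apply: h; right].
  move=> z z' y y' [Az|->] [Az'|->] yF y'F zz' //.
  - exact: pA zz'.
  - by exfalso; apply: far; exists z; split => //; exists y', y; rewrite zz'.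
  - by exfalso; apply: far; exists z'; split => //; exists y, y'.
have center x : exists z, A z /\
    (exists y y', [/\ y \in F, y' \in F & (x * y = z * y')%g]) /\
    forall z' y, A z' -> y \in F -> x = (z' * y)%g -> z = z'.
  have [[z' [y [Az' yF xE]]]|h] :=
      pselect (exists z' y, [/\ A z', y \in F & x = (z' * y)%g]).
    exists z'; split => //; split.
      by exists 1%g, y; split => //; rewrite mulg1.
    by move=> z2 y2 Az2 y2F xE2; apply: (pA _ _ y y2) => //; rewrite -xE.
  have [z [Az hz]] := near x; exists z; split => //; split => // z' y Az' yF xE.
  by exfalso; apply: h; exists z', y.
have [c hc] := choice center.
exists c; split => [x y yF|x].
  by have [Ac _] := hc x; have [_ [_ h]] := hc (c x * y)%g; exact: h yF erefl.
have [_ [[y [y' [yF y'F xE]]] _]] := hc x.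
by exists y, y'; split => //; rewrite xE mulgK.
Qed.

Section exploration.
Context (R : realType) (G : groupType) (S : {fset G}).
Variables (P : G -> G -> R) (c : G -> G) (seed : G -> bool).
Implicit Types (V : {fset G}).

(* Probability that the walk enters at least j cells outside V within n steps
   and that none of the first j of them contains a seed. *)
Fixpoint trap (n : nat) V (j : nat) (x : G) : R :=
  if j is j'.+1 then
    if n is n'.+1 then
      \sum_(s <- S) P x (x * s)%g *
        (if c (x * s)%g \in V then trap n' V j (x * s)%g
         else (~~ seed (c (x * s)%g))%:R *
              trap n' (c (x * s)%g |` V)%fset j' (x * s)%g)
    else 0
  else 1.

(* Probability that the walk enters fewer than j cells outside V within n steps. *)
Fixpoint slow (n : nat) V (j : nat) (x : G) : R :=
  if j is j'.+1 then
    if n is n'.+1 then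
      \sum_(s <- S) P x (x * s)%g *
        (if c (x * s)%g \in V then slow n' V j (x * s)%g
         else slow n' (c (x * s)%g |` V)%fset j' (x * s)%g)
    else 1
  else 0.

Lemma slowS n V j x : slow n.+1 V j.+1 x = \sum_(s <- S) P x (x * s)%g *
  (if c (x * s)%g \in V then slow n V j.+1 (x * s)%g
   else slow n (c (x * s)%g |` V)%fset j (x * s)%g).
Proof. by []. Qed.

Hypothesis P0 : forall x y, 0 <= P x y.

Lemma trap_ge0 n V j x : 0 <= trap n V j x.
Proof.
elim: n V j x => [|n IH] V [|j] x //=.
by apply: sumr_ge0 => s _; apply: mulr_ge0 => //; case: ifP => _ //; apply: mulr_ge0.
Qed.

Lemma trap_nd n V j x : trap n V j x <= trap n.+1 V j x.
Proof.
elim: n V j x => [|n IH] V [|j] x; [by []|exact: trap_ge0|by []|].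
rewrite [leLHS]/= [leRHS]/=; apply: ler_sum => s _; apply: ler_wpM2l => //.
case: ifP => _; first exact: IH.
by apply: ler_wpM2l => //; exact: IH.
Qed.

Lemma slow_ge0 n V j x : 0 <= slow n V j x.
Proof.
elim: n V j x => [|n IH] V [|j] x //=.
by apply: sumr_ge0 => s _; apply: mulr_ge0 => //; case: ifP.
Qed.

Hypothesis P1 : forall x, \sum_(s <- S) P x (x * s)%g = 1.

Lemma slow_le1 n V j x : slow n V j x <= 1.
Proof.
elim: n V j x => [|n IH] V [|j] x //=.
by rewrite -[leRHS](P1 x); apply: ler_sum => s _; apply: ler_piMr => //; case: ifP.
Qed.

Lemma slow_ni n V j x : slow n.+1 V j x <= slow n V j x.
Proof.
elim: n V j x => [|n IH] V [|j] x; [by []|exact: slow_le1|by []|].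
rewrite !slowS; apply: ler_sum => s _; apply: ler_wpM2l => //.
by case: ifP => _; exact: IH.
Qed.

(** Follow the walk until it enters a new cell with a seed, where u <= b. Failure within n steps
    means either j new cells without a seed ([trap]) or fewer than j new cells ([slow]), and then u
    <= 1 is used. *)
Lemma subharmonic_le_trap_slow (u : G -> R) (b : R) n V j x : 0 <= b ->
  (forall x, u x <= 1) -> (forall x, u x <= avg S P u x) ->
  (forall y, seed (c y) -> u y <= b) ->
  u x <= b + trap n V j x + slow n V j x.
Proof.
move=> b0 u1 uavg ub.
have u1b y : u y <= b + 1 by apply: le_trans (u1 y) _; rewrite lerDr.
elim: n V j x => [|n IH] V [|j] x; rewrite /= ?addr0//.
apply: le_trans (uavg x) _.
rewrite -[b in leRHS](avg_cst P1 b x) /avg -!big_split /=.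
apply: ler_sum => s _; rewrite -!mulrDr; apply: ler_wpM2l => //.
case: ifP => _; first exact: IH.
case: (boolP (seed _)) => /= [sd|_]; last by rewrite mul1r; exact: IH.
by rewrite mul0r addr0; apply: le_trans (ub _ sd) _; rewrite lerDl slow_ge0.
Qed.

Section exit.
Hypothesis G_infinite : infinite_set [set: G].
Hypothesis irr : forall x y, exists k, 0 < iter k (avg S P) (ind R y) x.
Hypothesis cells_finite : forall V, finite_set [set x | c x \in V].

Let L V j x := inf (range (fun n => slow n V j x)).

Let Lcvg V j x : (fun n => slow n V j x) @ \oo --> L V j x.
Proof.
apply: nonincreasing_cvgn; first by apply/nonincreasing_seqP => n; exact: slow_ni.
by exists 0 => _ [n _ <-]; exact: slow_ge0.
Qed.

Let L_ge0 V j x : 0 <= L V j x.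
Proof. by apply: (cvgr_to_ge (@Lcvg V j x)); apply: nearW => n; exact: slow_ge0. Qed.

Let LS V j x : L V j.+1 x = \sum_(s <- S) P x (x * s)%g *
  (if c (x * s)%g \in V then L V j.+1 (x * s)%g
   else L (c (x * s)%g |` V)%fset j (x * s)%g).
Proof.
have c1 : (fun n => slow n.+1 V j.+1 x) @ \oo --> L V j.+1 x.
  by rewrite (cvg_shiftS (fun n => slow n V j.+1 x)).
apply: (cvg_unique _ c1) => //=.
apply: (cvg_big (op := +%R) (x0 := 0)) => [|s _]; first exact: add_continuous.
by apply: cvgMl_tmp; case: ifP => _; exact: Lcvg.
Qed.

(** Finitely many cells are a finite set of points, on which the limit attains its maximum. Were the
    maximum positive, it would propagate along the irreducible walk to all of G, contradicting
    infinity. *)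
Lemma slow_cvg0 V j x : c x \in V -> (fun n => slow n V j x) @ \oo --> 0.
Proof.
suff L0 : forall V x, c x \in V -> L V j x = 0 by move=> cx; rewrite -(L0 V x cx).
move=> {V x}; elim: j => [|j IHj] V x cx.
  apply: (cvg_unique _ (@Lcvg V 0%N x)) => //.
  rewrite (_ : (fun n => slow n V 0 x) = fun=> 0); first exact: cvg_cst.
  by apply/funext => -[].
have [xm [cxm xmax]] : exists xm, c xm \in V /\
    forall y, c y \in V -> L V j.+1 y <= L V j.+1 xm.
  pose E := fset_set [set x | c x \in V].
  have EE y : (y \in E) = (c y \in V).
    by rewrite in_fset_set ?inE//; apply/idP/idP; rewrite ?inE.
  have xE : x \in E by rewrite EE.
  pose M := [arg max_(y > [` xE]%fset) L V j.+1 (val y)]%O.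
  exists (val M); split; first by rewrite -EE; exact: valP.
  move=> y cy; have yE : y \in E by rewrite EE.
  rewrite /M; case: arg_maxP => // i _ /(_ [` yE]%fset); exact.
set M := L V j.+1 xm in xmax.
have [M0|M0] := leP M 0.
  by apply/eqP; rewrite eq_le L_ge0 andbT; apply: le_trans M0; exact: xmax.
exfalso.
(* Entering a new cell leaves j cells to find, where the limit is 0 by induction; hence the
   extension by 0. *)
pose val_ y := if c y \in V then L V j.+1 y else 0.
have valM y : val_ y <= M by rewrite /val_; case: ifP => [/xmax//|_]; exact: ltW.
have Lval y : L V j.+1 y = avg S P val_ y.
  rewrite LS; apply: eq_bigr => s _; congr (_ * _); rewrite /val_.
  by case: ifP => // _; apply: IHj; exact: fset1U1.
have valMax k y : c y \in V -> L V j.+1 y = M ->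
    iter k (avg S P) (fun w => M - val_ w) y = 0.
  elim: k y => [|k IHk] y cy Ly; first by rewrite /= /val_ cy Ly subrr.
  have sum0 : \sum_(s <- S) P y (y * s)%g * (M - val_ (y * s)%g) = 0.
    rewrite -/(avg S P (fun w => M - val_ w) y) avgB avg_cst// -Lval Ly.
    by rewrite subrr.
  rewrite /= /avg big_seq big1// => s sS.
  have := sum0; rewrite big_seq => /eqP.
  rewrite psumr_eq0; last by move=> s' _; rewrite mulr_ge0// subr_ge0.
  move=> /allP/(_ s sS); rewrite sS /= mulf_eq0 => /orP[/eqP->|]; first by rewrite mul0r.
  rewrite subr_eq0 => /eqP Mv; rewrite IHk ?mulr0//.
    by apply: contraTT M0 => nc; rewrite Mv /val_ (negbTE nc) ltxx.
  by move: Mv; rewrite /val_; case: ifP => // _ M0'; move: M0; rewrite M0' ltxx.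
have allV y : c y \in V.
  have [k hk] := irr xm y; apply: contraLR hk => cy; rewrite -leNgt.
  have := valMax k xm cxm erefl.
  have h : iter k (avg S P) (ind R y) xm * (M - val_ y) <=
      iter k (avg S P) (fun w => M - val_ w) xm.
    by apply: iter_avg_ge => // w; rewrite subr_ge0.
  move=> h0; move: h; rewrite h0 /val_ (negbTE cy) subr0.
  by rewrite pmulr_lle0.
apply: G_infinite; apply: sub_finite_set (cells_finite V) => y _; exact: allV.
Qed.

End exit.
End exploration.

(** * Averaging the exploration over the environment *)

Section annealed.
Context (R : realType) (G : groupType) (S : {fset G}).
Local Notation site := (step_space R S * offspring_space R)%type.
Variables (m : set site -> \bar R) (Th : probability (env_space R G S) R).
Hypothesis iid : is_iid_product m Th.
Variables (c : G -> G) (F : {fset G}) (A : G -> set site) (del : R).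
Hypothesis cF : forall x y, y \in F -> c (c x * y)%g = c x.
Hypothesis mA : forall y, measurable (A y).
Hypothesis delE : (\prod_(y <- F) m (A y) = del%:E)%E.

Definition seeded (z : G) : set (env_space R G S) :=
  [set e | forall y, y \in F -> A y (e (z * y)%g)].

Let zF z := [fset (z * y)%g | y in F]%fset.

Lemma seededE z : seeded z = cylinder (zF z) (fun x => A (z^-1 * x)%g).
Proof.
apply/seteqP; split => e h.
  by move=> _ /imfsetP[y yF ->]; rewrite mulKg; exact: h.
move=> y yF; have := h (z * y)%g; rewrite mulKg; apply.
by apply/imfsetP; exists y.
Qed.

Lemma measurable_seeded z : measurable (seeded z).
Proof. by rewrite seededE; apply: measurable_cylinder. Qed.

Lemma seeded_probability z : Th (seeded z) = del%:E.
Proof.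
rewrite seededE iid// -delE /zF.
rewrite (perm_big _ (enum_imfset _ _)) /=; last by move=> x y _ _ /mulgI.
by rewrite big_map; apply: eq_bigr => y _; rewrite mulKg.
Qed.

(* Killing the irregular rows makes the kernel substochastic for every environment
   and not just almost every one, so that the traps below are integrable. *)
Definition safe_kernel (e : env_space R G S) x y : R :=
  if `[< step_laws R S (env_step e x) >] then env_kernel e x y else 0.

Lemma safe_kernel_ge0 e x y : 0 <= safe_kernel e x y.
Proof.
rewrite /safe_kernel; case: asboolP => // -[h _].
by rewrite /env_kernel; case: insub.
Qed.

Lemma safe_kernel_sum e x : \sum_(s <- S) safe_kernel e x (x * s)%g <= 1.
Proof.
rewrite /safe_kernel; case: asboolP => [[_ w1]|_]; last first.
  by rewrite big1// ?ler01.
rewrite -[leRHS]w1 (big_seq_fsetE _ S xpredT) /=; apply: ler_sum => s _.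
by rewrite /env_kernel mulKg valK.
Qed.

Lemma safe_kernel_le1 e x s : s \in S -> safe_kernel e x (x * s)%g <= 1.
Proof.
move=> sS; apply: le_trans (safe_kernel_sum e x).
rewrite (bigD1_seq s) ?fset_uniq//= lerDl; apply: sumr_ge0 => s' _.
exact: safe_kernel_ge0.
Qed.

Lemma measurable_safe_kernel x y : measurable_fun setT (fun e => safe_kernel e x y).
Proof.
have mstep : measurable_fun setT
      (fun e : env_space R G S => env_step e x : step_space R S).
  by apply: (measurableT_comp measurable_fst); exact: measurable_coordinate.
apply: measurable_fun_ifT; last exact: measurable_cst.
- apply: (measurable_fun_bool true).
  rewrite setTI [X in measurable X](_ : _ = [set e | step_laws R S (env_step e x)]).
    rewrite -[X in measurable X]setTI; apply: mstep => //.
    exact: measurable_step_laws.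
  by apply/seteqP; split => e /asboolP.
- rewrite /env_kernel; case: insub => [s|]; last first.
    exact: measurable_cst.
  have ms := @measurable_coordinate S _ (measurableTypeR R) s.
  exact: (measurableT_comp ms mstep).
Qed.

Definition env_trap n V j x (e : env_space R G S) : R :=
  trap S (safe_kernel e) c (fun z => `[< seeded z e >]) n V j x.

Lemma measurable_not_seeded z : measurable_fun setT
  (fun e : env_space R G S => (~~ `[< seeded z e >])%:R : R).
Proof.
apply: (eq_measurable_fun (\1_(~` seeded z) : _ -> R)).
  by move=> e _; rewrite indicE in_setC.
apply: measurable_indic; apply: measurableC; exact: measurable_seeded.
Qed.

Lemma measurable_env_trap n V j x : measurable_fun setT (env_trap n V j x).
Proof.
elim: n V j x => [|n IH] V [|j] x; try exact: measurable_cst.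
apply: measurable_sum => s; apply: measurable_funM.
  exact: measurable_safe_kernel.
case: (c (x * s)%g \in V); first exact: IH.
by apply: measurable_funM; [exact: measurable_not_seeded|exact: IH].
Qed.

Lemma env_trap_ge0 n V j x e : 0 <= env_trap n V j x e.
Proof. by apply: trap_ge0 => *; exact: safe_kernel_ge0. Qed.

(** W carries the path weights and the failed tests of the explored cells. Allowing every such W is
    what closes the induction: after one step, W times the step weight, possibly times one more
    failed test, is again of this form. *)
Lemma env_trap_annealed n V j x (W : env_space R G S -> R) : c x \in V ->
  measurable_fun setT W -> (forall e, 0 <= W e <= 1) ->
  (forall e e', (forall y, c y \in V -> e y = e' y) -> W e = W e') ->
  (\int[Th]_e (W e * env_trap n V j x e)%:E <=
   ((1 - del) ^+ j)%:E * \int[Th]_e (W e)%:E)%E.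
Proof.
have /andP[del_ge0 onem_del_ge0] : (0 <= del) && (0 <= 1 - del).
  rewrite subr_ge0 -!lee_fin -(seeded_probability 1%g) measure_ge0.
  by rewrite probability_le1//; exact: measurable_seeded.
have W0' (W' : env_space R G S -> R) : (forall e, 0 <= W' e <= 1) ->
    (0 <= \int[Th]_e (W' e)%:E)%E.
  by move=> h; apply: integral_ge0 => e _; rewrite lee_fin; case/andP: (h e).
elim: n V j x W => [|n IH] V [|j] x W cx mW W01 WV.
- by rewrite expr0 mul1e; under eq_integral do rewrite mulr1.
- under eq_integral do rewrite mulr0; rewrite integral0 mule_ge0//; last exact: W0'.
  by rewrite lee_fin exprn_ge0.
- by rewrite expr0 mul1e; under eq_integral do rewrite mulr1.
pose Ws s e := W e * safe_kernel e x (x * s)%g.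
have mWs s : measurable_fun setT (Ws s).
  exact: measurable_funM mW (measurable_safe_kernel x (x * s)%g).
have Ws01 s e : s \in S -> 0 <= Ws s e <= 1.
  move=> sS; have /andP[w0 w1] := W01 e.
  have k0 := safe_kernel_ge0 e x (x * s)%g; have k1 := safe_kernel_le1 e x sS.
  by rewrite mulr_ge0//= mulr_ile1.
have WsV s e e' : (forall y, c y \in V -> e y = e' y) -> Ws s e = Ws s e'.
  move=> ee'; rewrite /Ws (WV e e' ee').
  by rewrite /safe_kernel /env_kernel /env_step (ee' x cx).
pose B s e := if c (x * s)%g \in V then env_trap n V j.+1 (x * s)%g e
  else (~~ `[< seeded (c (x * s)%g) e >])%:R *
       env_trap n (c (x * s)%g |` V)%fset j (x * s)%g e.
have mB s : measurable_fun setT (B s).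
  rewrite /B; case: (c (x * s)%g \in V); first exact: measurable_env_trap.
  apply: measurable_funM; last exact: measurable_env_trap.
  exact: measurable_not_seeded.
have B0 s e : 0 <= B s e.
  by rewrite /B; case: ifP => _; [exact: env_trap_ge0|apply: mulr_ge0 => //; exact: env_trap_ge0].
have stepE e : W e * env_trap n.+1 V j.+1 x e = \sum_(s <- S) Ws s e * B s e.
  by rewrite mulr_sumr; apply: eq_bigr => s _; rewrite /Ws mulrA.
have key s : s \in S -> (\int[Th]_e (Ws s e * B s e)%:E <=
    ((1 - del) ^+ j.+1)%:E * \int[Th]_e (Ws s e)%:E)%E.
  move=> sS; rewrite /B; case: (boolP (c (x * s)%g \in V)) => cV.
    by apply: IH => // [e|e e' ee']; [exact: Ws01|exact: WsV].
  set z := c (x * s)%g in cV *.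
  pose W' e := Ws s e * (~~ `[< seeded z e >])%:R.
  have mW' : measurable_fun setT W'.
    exact: measurable_funM (mWs s) (measurable_not_seeded z).
  have W'01 e : 0 <= W' e <= 1.
    have /andP[w0 w1] := Ws01 s e sS.
    by rewrite /W'; case: (~~ _); rewrite ?mulr1 ?mulr0 ?w0 ?w1 ?lexx ?ler01.
  have cz y : y \in F -> c (z * y)%g = z by exact: cF.
  (* The seed event of z reads only the environment in the cell z, which is not in V, whereas [Ws s]
     reads only cells in V. *)
  have W'int : (\int[Th]_e (W' e)%:E = (1 - del)%:E * \int[Th]_e (Ws s e)%:E)%E.
    have split_int : (\int[Th]_e (Ws s e)%:E = \int[Th]_e (W' e)%:E +
        \int[Th]_(e in seeded z) (Ws s e)%:E)%E.
      rewrite [X in (_ + X)%E]integral_mkcond -ge0_integralD//=.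
      - apply: eq_integral => e _; rewrite patchE /W'.
        have -> : (e \in seeded z) = `[< seeded z e >] by [].
        by case: `[< _ >] => /=; rewrite ?mulr1 ?mulr0 ?add0e ?adde0.
      - by move=> e _; rewrite lee_fin; case/andP: (W'01 e).
      - exact/measurable_EFinP.
      - by move=> e _; rewrite patchE; case: ifP => // _; rewrite lee_fin; case/andP: (Ws01 s e sS).
      - have mr : measurable_fun (seeded z) (fun e => (Ws s e)%:E).
          by apply: measurable_funTS; exact/measurable_EFinP.
        exact: (measurable_restrictT _ (measurable_seeded z)).1 mr.
    have seed_int : (\int[Th]_(e in seeded z) (Ws s e)%:E =
        del%:E * \int[Th]_e (Ws s e)%:E)%E.
      rewrite -(seeded_probability z) seededE.
      apply: (@iid_integral_indep _ _ _ _ m Th iid [set y | c y \in V]) => //.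
      - exact: point.
      - move=> _ /imfsetP[y yF ->] /=; rewrite cz// => zV.
        by move/negP: cV.
      - exact/measurable_EFinP.
      - by move=> e; rewrite lee_fin; case/andP: (Ws01 s e sS).
      - by move=> e e' ee'; congr EFin; exact: WsV.
    have Wfin : (\int[Th]_e (Ws s e)%:E)%E \is a fin_num.
      rewrite ge0_fin_numE; last by apply: W0' => e; exact: Ws01.
      apply: (@le_lt_trans _ _ (\int[Th]_e (cst 1%E e))%E); last first.
        by rewrite integral_cst// mul1e -ge0_fin_numE// fin_num_measure.
      apply: ge0_le_integral => //.
      - by move=> e _; rewrite lee_fin; case/andP: (Ws01 s e sS).
      - exact/measurable_EFinP.
      - by move=> e _ /=; rewrite lee_fin; case/andP: (Ws01 s e sS).
    have W'fin : (\int[Th]_e (W' e)%:E)%E \is a fin_num.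
      rewrite ge0_fin_numE; last exact: W0'.
      rewrite (le_lt_trans _ (_ : \int[Th]_e (Ws s e)%:E < +oo)%E)//; last first.
        by rewrite -ge0_fin_numE//; apply: W0' => e; exact: Ws01.
      have Ws_int0 : (0 <= \int[Th]_e (Ws s e)%:E)%E.
        by apply: W0' => e; exact: Ws01.
      by rewrite split_int leeDl// seed_int; apply: mule_ge0; rewrite ?lee_fin.
    move: split_int; rewrite seed_int -(fineK Wfin) -(fineK W'fin) -!EFinM -EFinD.
    by move=> [h]; congr EFin; rewrite mulrBl mul1r {1}h addrK.
  apply: (@le_trans _ _ (((1 - del) ^+ j)%:E * \int[Th]_e (W' e)%:E)%E).
    under eq_integral do rewrite mulrA -/(W' _).
    apply: IH => //; first exact: fset1U1.
    move=> e e' ee'; rewrite /W' (@WsV s e e'); last first.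
      by move=> y cy; apply: ee'; rewrite inE cy orbT.
    congr (_ * (~~ _)%:R); apply: asbool_equiv_eq; split => h y yF.
      by rewrite -ee'; [exact: h|rewrite cz// fset1U1].
    by rewrite ee'; [exact: h|rewrite cz// fset1U1].
  by rewrite W'int muleA -EFinM exprSr.
under eq_integral do rewrite stepE -sumEFin.
rewrite ge0_integral_sum//; last 2 first.
- by move=> s; apply/measurable_EFinP; exact: measurable_funM.
- move=> s e _; rewrite lee_fin !mulr_ge0//; last exact: safe_kernel_ge0.
  by case/andP: (W01 e).
apply: (@le_trans _ _ (\sum_(s <- S) ((1 - del) ^+ j.+1)%:E * \int[Th]_e (Ws s e)%:E)%E).
  by rewrite big_seq [leRHS]big_seq; apply: lee_sum => s sS; exact: key.
have intWs0 s : (0 <= \int[Th]_e (Ws s e)%:E)%E.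
  apply: integral_ge0 => e _; rewrite lee_fin mulr_ge0//; last exact: safe_kernel_ge0.
  by case/andP: (W01 e).
rewrite -ge0_sume_distrr//; apply: lee_wpmul2l.
  by rewrite lee_fin exprn_ge0.
rewrite -ge0_integral_sum//; last 2 first.
- by move=> s; exact/measurable_EFinP.
- move=> s e _; rewrite lee_fin mulr_ge0//; last exact: safe_kernel_ge0.
  by case/andP: (W01 e).
apply: ge0_le_integral => //.
- move=> e _; apply: sume_ge0 => s _; rewrite lee_fin mulr_ge0//; last exact: safe_kernel_ge0.
  by case/andP: (W01 e).
- by apply: emeasurable_sum => s; exact/measurable_EFinP.
- exact/measurable_EFinP.
- move=> e _; rewrite sumEFin lee_fin -mulr_sumr ler_piMr ?safe_kernel_sum//.
  by case/andP: (W01 e).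
Qed.

Section conclusion.
Hypothesis G_countable : countable [set: G].
Hypothesis del0 : 0 < del.

Let bad x (eps : R) : set (env_space R G S) :=
  [set e | forall j, exists n, eps < env_trap n [fset c x]%fset j x e].

(** Markov's inequality bounds the probability of a large trap by (1 - del)^j / eps uniformly in n;
    traps increase with n, so the bound passes to the union over n, and then j tends to infinity. *)
Let bad_null x eps : 0 < eps -> Th.-negligible (bad x eps).
Proof.
move=> eps0.
pose E j n := [set e | eps < env_trap n [fset c x]%fset j x e].
have mE j n : measurable (E j n).
  rewrite -[X in measurable X]setTI.
  have := @measurable_env_trap n [fset c x]%fset j x measurableT `]eps, +oo[%classic.
  by rewrite set_itvoy; apply; rewrite -set_itvoy; exact: measurable_itv.
have del1 : del <= 1.
  by rewrite -lee_fin -(seeded_probability 1%g) probability_le1//; exact: measurable_seeded.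
have ThE j n : (eps%:E * Th (E j n) <= ((1 - del) ^+ j)%:E)%E.
  have := @env_trap_annealed n [fset c x]%fset j x (fun=> 1) (fset11 _)
    (measurable_cst _) (fun=> _) (fun _ _ _ => erefl).
  rewrite ler01 lexx => /(_ (fun=> isT)).
  rewrite [X in (_ * X)%E](_ : _ = 1%E) ?mule1; last first.
    transitivity (1 * Th setT)%E; first exact: (integral_cst Th measurableT 1%E).
    by rewrite probability_setT mul1e.
  apply: le_trans; rewrite -(integral_cst Th (mE j n) (eps%:E)).
  under [leRHS]eq_integral do rewrite mul1r.
  apply: (@le_trans _ _ (\int[Th]_(e in E j n) (env_trap n [fset c x]%fset j x e)%:E)%E).
    apply: ge0_le_integral => //.
    - by move=> e _; rewrite lee_fin ltW.
    - by apply: measurable_funTS; apply/measurable_EFinP; exact: measurable_env_trap.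
    - by move=> e; rewrite /E /= lee_fin; exact: ltW.
  apply: ge0_subset_integral => //.
    by apply/measurable_EFinP; exact: measurable_env_trap.
  by move=> e _; rewrite lee_fin; exact: env_trap_ge0.
have mU j : measurable (\bigcup_n E j n) by exact: bigcupT_measurable.
have ThU j : (eps%:E * Th (\bigcup_n E j n) <= ((1 - del) ^+ j)%:E)%E.
  have cU : Th \o E j @ \oo --> Th (\bigcup_n E j n).
    apply: nondecreasing_cvg_mu => //; apply/nondecreasing_seqP => n.
    apply/subsetPset => e; rewrite /E /= => /lt_le_trans; apply.
    by apply: trap_nd => *; exact: safe_kernel_ge0.
  have ThUfin : Th (\bigcup_n E j n) \is a fin_num by exact: fin_num_measure.
  rewrite muleC -lee_pdivlMr// -EFinM.
  apply: (cvge_to_le cU); apply: nearW => n.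
  by have h := ThE j n; rewrite muleC -lee_pdivlMr// -EFinM in h; exact: h.
exists (\bigcap_j \bigcup_n E j n); split; first exact: bigcapT_measurable.
  change (Th (\bigcap_j \bigcup_n E j n) = 0%E).
  have mB : measurable (\bigcap_j \bigcup_n E j n) by exact: bigcapT_measurable.
  have BE : Th (\bigcap_j \bigcup_n E j n) =
      (fine (Th (\bigcap_j \bigcup_n E j n)))%:E by rewrite fineK// fin_num_measure.
  rewrite BE; congr EFin; apply/eqP; rewrite eq_le fine_ge0 ?andbT; last exact: measure_ge0.
  rewrite -(pmulr_rle0 _ eps0).
  have : (fun j => (1 - del) ^+ j) @ \oo --> 0 by apply: cvg_expr; rewrite ger0_norm ?subr_ge0// gtrBl.
  move=> /cvgr_to_ge; apply; apply: nearW => j.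
  rewrite -lee_fin EFinM -BE; apply: le_trans (ThU j).
  apply: lee_wpmul2l; first by rewrite lee_fin ltW.
  apply: le_measure; rewrite ?inE//.
  by move=> e h; exact: (h j Logic.I).
by move=> e h j _; have [n hn] := h j; exists n.
Qed.

Theorem env_trap_cvg0 : {ae Th, forall e, forall x (eps : R), 0 < eps ->
  exists j, forall n, env_trap n [fset c x]%fset j x e <= eps}.
Proof.
have : {ae Th, forall e, forall xk : G * nat, ~ bad xk.1 (xk.2.+1%:R^-1) e}.
  apply: ae_countable => [|[x k]].
    rewrite -setXTT; apply: countableX; [exact: G_countable|exact: countableP].
  have k0 : 0 < k.+1%:R^-1 :> R by rewrite invr_gt0.
  have [N [mN N0 hN]] := bad_null x k0.
  by exists N; split => // e /= h; apply: hN; exact: contrapT.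
move=> hae; apply: (filterS _ hae) => e h x eps eps0.
have [k hk] : exists k, k.+1%:R^-1 < eps.
  have ei : 0 < eps^-1 by rewrite invr_gt0.
  exists (Num.bound eps^-1); rewrite -[ltRHS]invrK ltf_pV2 ?posrE//.
  by apply: lt_trans (archi_boundP (ltW ei)) _; rewrite ltr_nat.
have /existsNP[j hj] := h (x, k).
exists j => n; rewrite leNgt; apply/negP => hn; apply: hj; exists n.
exact: lt_trans hn.
Qed.

End conclusion.

End annealed.

(** * Seed patterns of positive probability *)

Lemma offspring_lower (R : realType) (Qt : probability (offspring_space R) R) (a : R) :
  0 <= a -> (a%:E < mstar Qt)%E ->
  exists (L : nat) (beta : nat -> R) (B : set (offspring_space R)),
    [/\ forall k, 0 <= beta k, a < \sum_(k < L) k%:R * beta k,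
        measurable B, (0 < Qt B)%E &
        forall nu, offspring_laws R nu -> B nu ->
          forall k, (k < L)%N -> beta k <= nu k].
Proof.
move=> a0 /mstar_gt[nu0 [law Unu] amean].
have [_ nu0_ge0 _ _] := law.
have meanE : mean nu0 = (fine (mean nu0))%:E.
  rewrite fineK// ge0_fin_numE; first by case: law.
  by apply: nneseries_ge0 => k _ _; rewrite lee_fin mulr_ge0.
have [L hL] : exists L, a < series (fun k => k%:R * nu0 k) L.
  apply: contrapT => /forallNP h; move: amean; rewrite meanE lte_fin; apply/negP.
  rewrite -leNgt; apply: (cvgr_to_le (mean_cvg law)); apply: nearW => n.
  by rewrite leNgt; apply/negP.
set sL := series _ L in hL.
have sL0 : 0 < sL by exact: le_lt_trans hL.
(* Shrinking the weights of nu0 by th < 1 leaves an open set of laws above them, while th > a / sL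
   keeps the truncated mean above a. *)
pose th := (a / sL + 1) / 2.
have asL : a / sL < 1 by rewrite ltr_pdivrMr// mul1r.
have asL0 : 0 <= a / sL by rewrite divr_ge0// ltW.
have th01 : 0 < th < 1 by rewrite /th; lra.
have th_gt : a / sL < th by rewrite /th; lra.
have /andP[th0 th1] := th01.
(* The value -1 keeps the strict inequality, hence openness, where nu0 k = 0; nonnegativity of laws
   restores the bound 0 there. *)
pose c k := if nu0 k == 0 then -1 else th * nu0 k.
have c_lt k : c k < nu0 k.
  rewrite /c; case: eqVneq => [->|nk]; first by rewrite ltrN10.
  by rewrite gtr_pMl// lt0r nk nu0_ge0.
pose B : set (offspring_space R) := [set nu | forall k, (k < L)%N -> c k < nu k].
have oB : open (B : set {ptws nat -> R}).
  rewrite /B; elim: (L) => [|n IH].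
    rewrite [X in open X](_ : _ = setT); first exact: openT.
    by apply/seteqP; split.
  rewrite [X in open X](_ : _ = [set nu | forall k, (k < n)%N -> c k < nu k] `&`
    [set nu | c n < nu n]).
    apply: openI => //.
    by apply: (@open_ptws_coordinate R n [set x | c n < x]); exact: open_gt.
  apply/seteqP; split => [nu h|nu [h1 h2] k].
    by split => [k kn|]; apply: h => //; exact: ltnW.
  by rewrite ltnS leq_eqVlt => /orP[/eqP ->|]; [exact: h2|exact: h1].
exists L, (fun k => th * nu0 k), B; split.
- by move=> k; rewrite mulr_ge0// ltW.
- rewrite (_ : \sum_(k < L) _ = th * sL); first by rewrite -ltr_pdivrMr.
  rewrite /sL seriesEnat /= big_mkord mulr_sumr; apply: eq_bigr => k _.
  by rewrite mulrCA.
- exact: measurable_ptws_open.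
- by apply: Unu.
- move=> nu [_ nu_ge0 _ _] Bnu k kL; have := Bnu k kL; rewrite /c.
  by case: eqVneq => [->|_ /ltW//]; rewrite mulr0.
Qed.

Section word_ball.
Context (G : groupType) (S : {fset G}).

Fixpoint word_ball n : {fset G} :=
  if n is n'.+1 then
    (word_ball n' `|` [fset (x * s)%g | x in word_ball n', s in S])%fset
  else [fset 1%g]%fset.

Lemma word_ballS n x s : x \in word_ball n -> s \in S -> (x * s)%g \in word_ball n.+1.
Proof.
move=> xn sS; rewrite /= inE; apply/orP; right.
by apply/imfset2P; exists x => //; exists s.
Qed.

Lemma word_ball_mono n k : (n <= k)%N -> (word_ball n `<=` word_ball k)%fset.
Proof.
elim: k => [|k IH]; first by rewrite leqn0 => /eqP ->.
rewrite leq_eqVlt => /orP[/eqP ->//|]; rewrite ltnS => /IH h.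
by apply: fsubset_trans h _ => /=; exact: fsubsetUl.
Qed.

Lemma word_ball1 n : 1%g \in word_ball n.
Proof. by apply: (fsubsetP (word_ball_mono (leq0n n))); rewrite inE. Qed.

End word_ball.

Section killed_kernel.
Context (R : realType) (G : groupType) (S : {fset G}).

(** Rational entries leave only countably many patterns over all radii, so one of them must occur
    with positive probability. *)
Definition killed_kernel (F : {fset G}) (a : {ffun F * S -> rat}) (x y : G) : R :=
  if insub x is Some x' then
    if insub (x^-1 * y)%g is Some s then ratr (a (x', s)) else 0
  else 0.

Variable Q : probability (step_space R S) R.
Variable Qt : probability (offspring_space R) R.
Variable Th : probability (env_space R G S) R.
Hypothesis iid : is_iid_product (Q \x Qt)%E Th.

Definition step_above (F : {fset G}) (a : {ffun F * S -> rat}) (y : G) :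
    set (step_space R S) :=
  [set w | forall s, (if insub y is Some y' then ratr (a (y', s)) else 0) <= w s].

Lemma measurable_step_above (F : {fset G}) (a : {ffun F * S -> rat}) y :
  measurable (step_above a y).
Proof.
rewrite (_ : step_above a y = \bigcap_(s in [set: S])
   [set w : step_space R S |
     `[(if insub y is Some y' then ratr (a (y', s)) else 0), +oo[%classic (w s)]).
  apply: fin_bigcap_measurable => [|s _]; first exact: finite_finset.
  exact: (@measurable_coordinate_set S _ (measurableTypeR R) s).
apply/seteqP; split => [w h s _|w h s]; first by rewrite /= in_itv /= h.
by have := h s Logic.I; rewrite /= in_itv /= andbT.
Qed.

Lemma step_lower_env (e : env_space R G S) (mL : R) n : 0 < mL -> (0 < n)%N ->
  (forall x, step_laws R S (env_step e x)) ->
  (mL^-1) ^+ n < iter n (avg S (env_kernel e)) (ind R 1%g) 1%g ->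
  exists a : {ffun word_ball S n * S -> rat},
    [/\ forall i, 0 <= a i,
        1 < mL ^+ n * iter n (avg S (killed_kernel a)) (ind R 1%g) 1%g &
        forall y, y \in word_ball S n -> step_above a y (env_step e y)].
Proof.
move=> mL0 n0 law hn.
set p := iter n _ _ _ in hn.
have P0 x y : 0 <= env_kernel e x y by exact: env_kernel_ge0.
have p0 : 0 < p by apply: lt_trans hn; rewrite exprn_gt0// invr_gt0.
have X1 : 1 < mL ^+ n * p.
  by rewrite -ltr_pdivrMl ?exprn_gt0// mulr1 -exprVn.
set X := mL ^+ n * p in X1.
(* Rounding an entry down to a rational costs a factor of at least th, once per step; the strict
   supercriticality pays for n such factors. *)
have [th /andP[th0 th1] hth] : exists2 th, 0 < th < 1 & 1 < th ^+ n * X.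
  apply: contrapT => h.
  have : X <= 1.
    apply: (@le1_of_expr_lt1 _ _ n) => t t01; rewrite leNgt; apply/negP => ht.
    by apply: h; exists t.
  by rewrite leNgt X1.
have choose_rat (i : word_ball S n * S) : exists q : rat,
    [/\ 0 <= q, th * env_step e (val i.1) i.2 <= ratr q &
        ratr q <= env_step e (val i.1) i.2].
  have [w0 _] := law (val i.1); have := w0 i.2.
  set w := env_step _ _ _ => {}w0.
  have [->|wn0] := eqVneq w 0; first by exists 0; rewrite mulr0 raddf0 lexx.
  have w_gt0 : 0 < w by rewrite lt0r wn0.
  have [|q] := @rat_in_itvoo R (th * w) w; first by rewrite gtr_pMl.
  rewrite in_itv /= => /andP[q1 q2]; exists q; split; [|exact: ltW|exact: ltW].
  rewrite -(ler0q R); apply: le_trans (ltW q1); apply: mulr_ge0; exact: ltW.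
have [f hf] := choice choose_rat.
pose a := [ffun i => f i] : {ffun word_ball S n * S -> rat}.
exists a; split.
- by move=> i; rewrite ffunE; have [] := hf i.
- have K0 x y : 0 <= killed_kernel a x y :> R.
    rewrite /killed_kernel; case: insubP => // x' _ _; case: insubP => // s _ _.
    by rewrite ler0q ffunE; have [] := hf (x', s).
  (* With j steps to go the walk started at 1 is still in the ball of radius n - j, so within n
     steps it never feels the killing. *)
  have key j x : (j <= n)%N -> x \in word_ball S (n - j)%N ->
      th ^+ j * iter j (avg S (env_kernel e)) (ind R 1%g) x <=
      iter j (avg S (killed_kernel a)) (ind R 1%g) x.
    elim: j x => [|j IH] x jn xb; first by rewrite expr0 mul1r.
    rewrite /= exprS -mulrA -avgZ -avgZ /avg big_seq [leRHS]big_seq.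
    apply: ler_sum => s sS.
    have xs : (x * s)%g \in word_ball S (n - j)%N.
      by rewrite subnS in xb; rewrite -(prednK (_ : 0 < n - j)%N) ?subn_gt0//; exact: word_ballS.
    have IHs := IH (x * s)%g (ltnW jn) xs.
    set I1 := iter j (avg S (env_kernel e)) _ _ in IHs *.
    have I10 : 0 <= I1 by apply: iter_avg_ge0 => // z; exact: ind_ge0.
    have Ks : th * env_kernel e x (x * s)%g <= killed_kernel a x (x * s)%g.
      have xF : x \in word_ball S n by apply: (fsubsetP (word_ball_mono S (leq_subr j.+1 n))).
      have KE : killed_kernel a (val [` xF]%fset) (val [` xF]%fset * val [` sS]%fset)%g
          = ratr (a ([` xF]%fset, [` sS]%fset)) :> R.
        by rewrite /killed_kernel mulKg !valK.
      rewrite KE (env_kernelE e x [` sS]%fset) ffunE.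
      by have [] := hf ([` xF]%fset, [` sS]%fset).
    rewrite mulrCA.
    apply: (@le_trans _ _ ((th * env_kernel e x (x * s)%g) * (th ^+ j * I1))); first by lra.
    apply: ler_pM => //; first by apply: mulr_ge0 => //; exact: ltW.
    by apply: mulr_ge0 => //; apply: exprn_ge0; exact: ltW.
  have := key n 1%g (leqnn n); rewrite subnn => /(_ (fset11 _)) h.
  apply: lt_le_trans hth _; rewrite /X mulrCA; apply: ler_wpM2l => //.
  by apply: exprn_ge0; exact: ltW.
- move=> y yF s; rewrite -[y in insub y]/(val [` yF]%fset) valK ffunE.
  by have [] := hf ([` yF]%fset, s).
Qed.

(** If every supercritical pattern had a site of probability zero, almost no environment would
    satisfy any of these countably many patterns, yet [step_lower_env] finds one in almost every
    environment. *)
Lemma step_lower (mL : R) : 1 < mL ->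
  {ae Th, forall e, forall x, step_laws R S (env_step e x)} ->
  {ae Th, forall e, exists n, (0 < n)%N /\
    (mL^-1) ^+ n < iter n (avg S (env_kernel e)) (ind R 1%g) 1%g} ->
  exists n (a : {ffun word_ball S n * S -> rat}),
    [/\ (0 < n)%N, forall i, 0 <= a i,
        1 < mL ^+ n * iter n (avg S (killed_kernel a)) (ind R 1%g) 1%g &
        forall y, y \in word_ball S n -> (0 < Q (step_above a y))%E].
Proof.
move=> mL1 hlaw hrad; apply: contrapT => none.
pose good (J : {n : nat & {ffun word_ball S n * S -> rat}}) :=
  [/\ (0 < tag J)%N, forall i, 0 <= tagged J i &
      1 < mL ^+ tag J * iter (tag J) (avg S (killed_kernel (tagged J))) (ind R 1%g) 1%g].
have hae : {ae Th, forall e, forall J, good J ->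
    ~ forall y, y \in word_ball S (tag J) -> step_above (tagged J) y (env_step e y)}.
  apply: ae_countable => [|[n a]]; first exact: countableP.
  have [[/= n0 a0 gt1]|ng] := pselect (good (existT _ n a)); last exact: aeW.
  pose C (y : G) : set (step_space R S * offspring_space R) := step_above a y `*` setT.
  have mC y : measurable (C y) by apply: measurableX => //; exact: measurable_step_above.
  have [y [yF Qy]] : exists y, y \in word_ball S n /\ Q (step_above a y) = 0%E.
    apply: contrapT => /forallNP h; apply: none; exists n, a; split => // y yF.
    rewrite lt0e measure_ge0 andbT; apply/eqP => Qy.
    by apply: (h y).
  exists [set e : env_space R G S | C y (e y)]; split.
  - exact: measurable_coordinate_set.
  - rewrite (iid_marginal iid)//.
    transitivity (Q (step_above a y) * Qt setT)%E; last by rewrite Qy mul0e.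
    by apply: product_measure1E => //; exact: measurable_step_above.
  - move=> e /= h; apply: contrapT => nC; apply: h => _ h.
    by apply: nC; split => //; exact: h.
have : {ae Th, forall e, False}.
  apply: filterS3 hlaw hrad hae => e law [n [n0 hn]] hJ.
  have [|a [a0 gt1 above]] := step_lower_env _ n0 law hn; first exact: lt_trans mL1.
  by apply: (hJ (existT _ n a)).
move=> [N [mN N0 hN]].
have : Th N = 1%E.
  rewrite (_ : N = setT) ?probability_setT//.
  by apply/seteqP; split => // e _; apply: hN => h; exact: h.
by rewrite N0 => /eqP; rewrite eq_sym onee_eq0.
Qed.

End killed_kernel.

(** * Transience and recurrence in a fixed good environment *)

Lemma mean_ge1 (R : realType) (nu : nat -> R) :
  offspring_laws R nu -> 1 <= fine (mean nu).
Proof.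
move=> [nu0 nu_ge0 nus mfin].
have : (1 <= mean nu)%E.
  rewrite -nus; apply: lee_nneseries => [k _ _|[|k] _]; rewrite lee_fin//.
    by rewrite nu0 mulr0.
  by rewrite ler_peMl// ler1n.
move: mfin; case: (mean nu) => [r| |]//.
Qed.

Lemma elliptic_measurable (R : realType) (G : groupType) (S S' : {fset G}) (gamma : R) :
  measurable ([set w : S -> R | forall s : S, val s \in S' -> gamma < w s]
    : set (step_space R S)).
Proof.
rewrite (_ : [set w | _] = \bigcap_(s in [set s : S | val s \in S'])
   [set w : step_space R S | `]gamma, +oo[%classic (w s)]).
  apply: fin_bigcap_measurable => [|s _]; first exact: finite_finset.
  exact: (@measurable_coordinate_set S _ (measurableTypeR R) s).
apply/seteqP; split => [w h s sS'|w h s sS']; first by rewrite /= in_itv /= h.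
by have := h s sS'; rewrite /= in_itv /= andbT.
Qed.

Section realization.
Context (R : realType) (G : groupType) (S : {fset G}).
Hypothesis G_infinite : infinite_set [set: G].
Hypothesis G_countable : countable [set: G].
Variables (S' : {fset G}) (gamma : R).
Hypothesis gamma_gt0 : 0 < gamma.
Hypothesis S'_sub : (S' `<=` S)%fset.
Hypothesis S'_generates : generates S'.
Variable e : env_space R G S.
Hypothesis e_law : forall x, step_laws R S (env_step e x).
Hypothesis e_elliptic : forall x (s : S), val s \in S' -> gamma < env_step e x s.

Let P := env_kernel e.
Let P0 : forall x y, 0 <= P x y := env_kernel_ge0 e_law.
Let P1 : forall x, \sum_(s <- S) P x (x * s)%g = 1 := env_kernel_sum e_law.
Let irr x y : exists k, 0 < iter k (avg S P) (ind R y) x :=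
  env_kernel_irr e_law x y S'_sub gamma_gt0 e_elliptic S'_generates.

Lemma env_spectral_radius_gt0 : (0 < spectral_radius S P)%E.
Proof.
have [x0 x01] : exists x : G, x != 1%g.
  apply: contrapT => /forallNP h; apply: G_infinite.
  apply: (sub_finite_set _ (finite_set1 (1%g : G))) => x _.
  by have /negP := h x; rewrite negbK => /eqP.
have [k hk] := irr 1%g x0; have [l hl] := irr x0 1%g.
have k0 : (0 < k)%N.
  rewrite lt0n; apply/eqP => k0; move: hk.
  by rewrite k0 /= /ind eq_sym (negbTE x01) ltxx.
apply: (@spectral_radius_gt0 _ _ _ _ P0 (k + l)%N); first by rewrite addn_gt0 k0.
by apply: lt_le_trans (nstep_mul S P0 k l 1%g x0 1%g); exact: mulr_gt0.
Qed.

Hypothesis e_offspring : forall x, offspring_laws R (env_offspring e x).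

Let g x : R -> R := genfun (env_offspring e x).
Let m x : R := fine (mean (env_offspring e x)).
Let g0 x := @genfun_ge0 R _ (e_offspring x).
Let g_le x := @genfun_le R _ (e_offspring x).
Let g_mono x := @genfun_mono R _ (e_offspring x).
Let m_ge1 x : 1 <= m x := mean_ge1 (e_offspring x).

Let mean_kernel_irr x y :
  exists n, 0 < iter n (avg S (mean_kernel P m)) (ind R y) x.
Proof.
have K0 z z' : 0 <= mean_kernel P m z z'.
  by apply: mulr_ge0 => //; exact: le_trans (m_ge1 z).
have [k hk] := irr x y; exists k; apply: lt_le_trans hk _.
elim: k x => [|k IH] x //=.
apply: (@le_trans _ _ (avg S (mean_kernel P m) (iter k (avg S P) (ind R y)) x)).
  apply: avg_ler_kernel => z; first by apply: iter_avg_ge0 => // ?; exact: ind_ge0.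
  by rewrite ler_peMl.
exact: avg_le.
Qed.

Lemma env_transient (rho : R) (x0 : G) : 0 < rho ->
  spectral_radius S P = rho%:E -> (forall x, m x <= rho^-1) ->
  env_offspring e x0 1%N < 1 ->
  transient P (env_offspring e).
Proof.
move=> rho0 rhoE mle br b d T Pr Z BMC.
rewrite (Pr_infinitely_many_visits P0 P1 (@env_kernel_notin _ _ _ e) e_offspring b BMC)//.
congr (_%:E).
have m0 x : 0 <= m x by exact: le_trans (m_ge1 x).
apply: (@hit_io_eq0 _ _ _ P g b m (fun x => 1 - env_offspring e x 1%N) x0) => //.
- move=> x; have := offspring_mass_le1 (e_offspring x) 2; have [nu0 _ _ _] := e_offspring x.
  by rewrite seriesEnat /= !big_nat_recl//= big_geq// nu0 add0r addr0 subr_ge0.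
- by rewrite subr_gt0.
- by move=> x t; exact: genfun_lower.
- move=> t x t01; apply: (green_mean_bounded P0 irr b x rho0 rhoE _ t01) => y.
  by rewrite m0 mle.
Qed.

Section recurrence.
Variables (n : nat) (a : {ffun word_ball S n * S -> rat}).
Variables (L : nat) (beta : nat -> R) (B : set (offspring_space R)) (c : G -> G).
Let F := word_ball S n.
Let A (y : G) : set (step_space R S * offspring_space R) := step_above a y `*` B.
Let mL := \sum_(k < L) k%:R * beta k.
Let X := mL ^+ n * iter n (avg S (killed_kernel R a)) (ind R 1%g) 1%g.
Hypothesis n0 : (0 < n)%N.
Hypothesis a0 : forall i, 0 <= a i.
Hypothesis beta0 : forall k, 0 <= beta k.
Hypothesis mL1 : 1 < mL.
Hypothesis X1 : 1 < X.
Hypothesis betaB : forall nu, offspring_laws R nu -> B nu ->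
  forall k, (k < L)%N -> beta k <= nu k.
Hypothesis cE : forall x, exists y y', [/\ y \in F, y' \in F & c x = (x * y / y')%g].
Hypothesis untrapped : forall x (eps : R), 0 < eps ->
  exists j, forall k, env_trap c F A k [fset c x]%fset j x e <= eps.

Let seeds : set G := [set z | seeded F A z e].

Let L0 : (0 < L)%N.
Proof.
rewrite lt0n; apply/eqP => L0; move: mL1; rewrite /mL L0 big_ord0.
by rewrite ltNge ler01.
Qed.

Let mL0 : 0 < mL := lt_trans ltr01 mL1.

Let seed_beta z y k : seeds z -> y \in F -> (k < L)%N ->
  beta k <= env_offspring e (z * y)%g k.
Proof. by move=> sz yF; apply: betaB => //; have [_] := sz y yF. Qed.

(** The quotient comes from [truncated_mean_le]; the cap at 1 is the monotonicity condition of
    [hit_io_eq1]. *)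
Let kap := Num.min 1 ((mL - 1) / L%:R).

Let kap01 : 0 < kap <= 1.
Proof.
by rewrite /kap lt_min ltr01 divr_gt0 ?subr_gt0 ?ltr0n//= ge_min lexx.
Qed.

Let seeds_g z (t : R) : seeds z -> 0 <= t <= 1 -> g z t <= t - kap * (t * (1 - t)).
Proof.
move=> sz t01; apply: le_trans (genfun_upper (e_offspring z) t01) _.
rewrite lerD2l lerN2; apply: ler_wpM2r.
  by have /andP[t0 t1] := t01; rewrite mulr_ge0// subr_ge0.
rewrite /kap ge_min; apply/orP; right; rewrite ler_pdivrMr ?ltr0n// mulrC.
apply: truncated_mean_le => // k kL.
by have := seed_beta sz (word_ball1 S n) kL; rewrite mulg1.
Qed.

Let seed_kernel z x y : R := killed_kernel R a (z^-1 * x)%g (z^-1 * y)%g.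

Let killed_ge0 x y : 0 <= killed_kernel R a x y.
Proof.
by rewrite /killed_kernel; case: insub => // x'; case: insub => // s; rewrite ler0q.
Qed.

Let iter_seed_kernel z k x :
  iter k (avg S (seed_kernel z)) (ind R z) x =
  iter k (avg S (killed_kernel R a)) (ind R 1%g) (z^-1 * x)%g.
Proof.
elim: k x => [|k IH] x /=.
  by rewrite /ind -[in RHS](mulVg z) (inj_eq (mulgI _)).
by apply: eq_bigr => s _; rewrite IH /seed_kernel !mulgA.
Qed.

Let seed_kernel_le z x y : seeds z -> seed_kernel z x y <= P x y.
Proof.
move=> sz; rewrite /seed_kernel /killed_kernel.
case: insubP => [x' xF x'E|_]; last exact: P0.
rewrite invgM invgK -mulgA mulVKg /P /env_kernel.
case: insubP => // s _ _.
have [/= + _] := sz _ xF; rewrite mulVKg => /(_ s).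
by rewrite -x'E valK.
Qed.

(** Chosen so that (1 - d) X = (1 + X) / 2, still above 1. With n L eta = d, Bernoulli gives (1 - L
    eta)^n >= 1 - d, so the linearisation loss over n steps is affordable. *)
Let d := (X - 1) / (X *+ 2).
Let eta := d / (n%:R * L%:R).

Let d01 : 0 < d <= 1.
Proof.
have X2 : 0 < X *+ 2 by rewrite mulrn_wgt0// (lt_trans ltr01).
rewrite /d divr_gt0 ?subr_gt0//= ler_pdivrMr// mul1r mulr2n.
have := X1; lra.
Qed.

Let n1 : 1 <= n%:R :> R. Proof. by rewrite ler1n. Qed.
Let L1 : 1 <= L%:R :> R. Proof. by rewrite ler1n. Qed.

Let eta0 : 0 < eta.
Proof. by case/andP: d01 => ? _; rewrite divr_gt0// mulr_gt0 ?ltr0n. Qed.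

Let etaE : n%:R * (L%:R * eta) = d.
Proof.
rewrite /eta mulrA mulrC divfK// mulf_neq0// pnatr_eq0 -lt0n//.
Qed.

Let Leta : L%:R * eta <= 1.
Proof.
have /andP[_ dle] := d01; apply: le_trans dle; rewrite -etaE ler_peMl//.
by rewrite mulr_ge0 ?ler0n ?(ltW eta0).
Qed.

Let seeds_io b z : seeds z -> eta / mL ^+ n <= hit_io S P g b z.
Proof.
move=> sz; apply: (@hit_io_seed _ _ _ P g P0 P1 g0 g_le g_mono
    (seed_kernel z) mL L%:R ((1 + X) / 2)) => //.
- by move=> x y; exact: killed_ge0.
- by move=> x y; exact: seed_kernel_le.
- exact: ltW.
- move=> x; have [xF|nxF] := boolP ((z^-1 * x)%g \in F); last first.
    by left => y; rewrite /seed_kernel /killed_kernel insubN.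
  right => t t01; apply: genfun_truncation => // k kL.
  by have := seed_beta sz xF kL; rewrite mulVKg.
- have := X1; lra.
- rewrite iter_seed_kernel mulVg exprMn -mulrA -/X.
  have Le0 : 0 <= L%:R * eta by rewrite mulr_ge0 ?ler0n ?(ltW eta0).
  apply: (@le_trans _ _ ((1 - d) * X)).
    have X0 : X != 0 by rewrite gt_eqF// (lt_trans ltr01).
    rewrite le_eqVlt; apply/orP; left; apply/eqP; rewrite /d; field.
    exact: X0.
  apply: ler_wpM2r; first exact/ltW/(lt_trans ltr01).
  by rewrite -etaE; apply: bernoulli_onem; rewrite Le0 Leta.
- rewrite ler_pdivrMr ?exprn_gt0// mul1r.
  apply: (@le_trans _ _ 1); last by rewrite exprn_ege1// ltW.
  apply: le_trans Leta; rewrite ler_peMl// ltW//.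
Qed.

(** The displacement from x to its centre takes finitely many values, each spelled by one word in
    S'. Replacing gamma by [gam], which is at most 1, makes the longest word give the worst
    bound. *)
Let short_path : exists2 c0, 0 < c0 & forall x, exists k,
  c0 <= iter k (avg S P) (ind R (c x)) x.
Proof.
have /choice[f hf] (p : F * F) : exists k, forall x,
    gamma ^+ k <= iter k (avg S P) (ind R (x * val p.1 / val p.2)%g) x.
  have [l lS lE] := S'_generates (val p.1 / val p.2)%g.
  exists (size l) => x; rewrite -mulgA lE.
  exact: (env_kernel_word e_law x S'_sub gamma_gt0 e_elliptic lS).
pose gam := Num.min gamma 1.
have gam0 : 0 < gam by rewrite lt_min gamma_gt0 ltr01.
exists (gam ^+ (\max_p f p)%N) => [|x]; first exact: exprn_gt0.
have [y [y' [yF yF' ->]]] := cE x.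
have h := hf ([` yF]%fset, [` yF']%fset) x.
exists (f ([` yF]%fset, [` yF']%fset)); apply: le_trans h.
apply: (@le_trans _ _ (gam ^+ f ([` yF]%fset, [` yF']%fset))).
  apply: ler_wiXn2l; [exact: ltW|by rewrite ge_min lexx orbT|].
  exact: (@leq_bigmax _ f).
by apply: lerXn2r; rewrite ?nnegrE ?(ltW gam0) ?(ltW gamma_gt0)// ge_min lexx.
Qed.

Let cells_finite (V : {fset G}) : finite_set [set x | c x \in V].
Proof.
pose h (p : G * G * G) := (p.1.1 * p.1.2 / p.2)%g.
apply: (@sub_finite_set _ _ (h @` ([set` V] `*` [set` F] `*` [set` F]))).
  move=> x /= xV; have [y [y' [yF yF' cxE]]] := cE x.
  exists (c x, y', y) => //=; rewrite /h cxE /=.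
  by rewrite -(mulgA _ y'^-1%g) mulVg mulg1 mulgK.
apply: finite_image; apply: finite_setX; last exact: finite_fset.
by apply: finite_setX; exact: finite_fset.
Qed.

Let seeds_hit (u : G -> R) (s : R) : 0 <= s ->
  (forall x, 0 <= u x <= 1) -> (forall x, u x <= avg S P u x) ->
  (forall y, seeds (c y) -> u y <= s) -> forall x, u x <= s.
Proof.
move=> s0 u01 uavg us x; apply/ler_addgt0Pr => eps eps0.
have e2 : 0 < eps / 2 by rewrite divr_gt0.
(* The order matters: j is fixed so that traps are small at all times, and only then is the time
   taken so large that finding fewer than j cells is unlikely. *)
have [j hj] := untrapped x e2.
have safeE : safe_kernel e = P.
  by apply/funext => y; apply/funext => y'; rewrite /safe_kernel asboolT.
have cx : c x \in [fset c x]%fset by rewrite inE.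
have [k hk] : exists k, slow S P c k [fset c x]%fset j x <= eps / 2.
  have cv := slow_cvg0 P0 P1 G_infinite irr cells_finite j cx.
  apply: contrapT => /forallNP h; move: e2; apply/negP; rewrite -leNgt.
  apply: (cvgr_to_ge cv); apply: nearW => k.
  by rewrite ltW// ltNge; apply/negP; exact: h.
have := hj k; rewrite /env_trap safeE => htrap.
have := subharmonic_le_trap_slow (c := c) (seed := fun z => `[< seeded F A z e >])
  P0 P1 k [fset c x]%fset j x s0 (fun y => (andP (u01 y)).2) uavg.
move=> /(_ (fun y h => us y (asboolW h))) h.
apply: (le_trans h); rewrite -addrA lerD2l [leRHS](splitr eps); exact: lerD.
Qed.

Lemma env_recurrent : strongly_recurrent P (env_offspring e).
Proof.
move=> b dT T Pr Z BMC.
rewrite (Pr_infinitely_many_visits P0 P1 (@env_kernel_notin _ _ _ e) e_offspring b BMC)//.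
have [c0 c00 hc0] := short_path.
congr (_%:E).
apply: (@hit_io_eq1 _ _ _ P g P0 P1 g0 g_le g_mono b m _ [set y | seeds (c y)] seeds
  c0 kap (eta / mL ^+ n)) => //.
- by move=> x s t; exact: genfun_lip.
- by rewrite divr_gt0// exprn_gt0.
- by move=> y sy; have [k hk] := hc0 y; exists (c y), k.
- by move=> z; exact: seeds_io.
Qed.

End recurrence.

End realization.

Theorem theorem3p3 (R : realType) (G : groupType) (S : {fset G})
  (G_infinite : infinite_set [set: G])
  (S_symmetric : symmetric_set S) (S_generates : generates S)
  (Q : probability (step_space R S) R)
  (Qt : probability (offspring_space R) R)
  (Q_laws : Q (step_laws R S) = 1%E)
  (Qt_laws : Qt (offspring_laws R) = 1%E)
  (Theta : probability (env_space R G S) R)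
  (Theta_iid : is_iid_product (Q \x Qt)%E Theta)
  (gamma : R) (S' : {fset G})
  (gamma_gt0 : 0 < gamma)
  (S'_sub : (S' `<=` S)%fset) (S'_minimal : minimal_generates S')
  (Q_elliptic :
    Q [set w | forall s : S, val s \in S' -> gamma < w s] = 1%E)
  (mstar_gt1 : (1 < mstar Qt)%E)
  (rho : R)
  (rho_spectral : {ae Theta, forall e, spectral_radius S (env_kernel e) = rho%:E}) :
  ((mstar Qt <= (rho^-1)%:E)%E ->
     {ae Theta, forall e, transient (env_kernel e) (env_offspring e)}) /\
  (((rho^-1)%:E < mstar Qt)%E ->
     {ae Theta, forall e, strongly_recurrent (env_kernel e) (env_offspring e)}).
Proof.
have G_countable := generates_countable S_generates.
have [S'_generates _] := S'_minimal.
(* [support_core] instead of [offspring_laws]: membership in the support is what bounds every mean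
   by m*. *)
have good : {ae Theta, forall e, [/\ forall x, step_laws R S (env_step e x),
    forall x (s : S), val s \in S' -> gamma < env_step e x s &
    forall x, support_core Qt (env_offspring e x)]}.
  have mell := @elliptic_measurable R G S S' gamma.
  have mlaws := @measurable_step_laws R G S.
  have Q1 := etrans (probability_setI1 mlaws mell Q_elliptic) Q_laws.
  have := environment_ae Theta_iid G_countable (measurableI _ _ mlaws mell)
    (@measurable_support_core _ Qt) Q1 (support_core1 Qt_laws).
  by apply: filterS => e h; split=> x; have [[? ?] ?] := h x.
split => [mstar_le|mstar_gt].
  have rho0 : 0 < rho.
    by rewrite -invr_gt0 (lt_trans ltr01)// -lte_fin (lt_le_trans mstar_gt1).
  have br_ae := branching_site_ae Theta_iid G_countable G_infinite
    (branching_probability_gt0 mstar_gt1).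
  apply: filterS3 good rho_spectral br_ae => e [law ell core] rhoE [x0 br].
  have off x : offspring_laws R (env_offspring e x) by case: (core x).
  suff mle x : fine (mean (env_offspring e x)) <= rho^-1.
    exact: (env_transient G_countable gamma_gt0 S'_sub S'_generates law ell off
      rho0 rhoE mle br).
  have : (mean (env_offspring e x) <= (rho^-1)%:E)%E.
    apply: le_trans mstar_le; apply: ereal_sup_ubound.
    by exists (env_offspring e x) => //; exact: support_core_sub.
  have [_ nu_ge0 _ mfin] := off x; rewrite -lee_fin fineK// ge0_fin_numE//.
  by apply: nneseries_ge0 => k _ _; rewrite lee_fin mulr_ge0.
(* The bound 1 makes litters larger than 1 occur at seeds with a uniform rate ([kap]), and the bound
   1/rho makes the killed process supercritical. *)
have [L [beta [B [beta0 hmL mB B0 betaB]]]] :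
    exists (L : nat) (beta : nat -> R) (B : set (offspring_space R)),
    [/\ forall k, 0 <= beta k, Num.max 1 rho^-1 < \sum_(k < L) k%:R * beta k,
        measurable B, (0 < Qt B)%E &
        forall nu, offspring_laws R nu -> B nu ->
          forall k, (k < L)%N -> beta k <= nu k].
  apply: offspring_lower; first by rewrite le_max ler01.
  by rewrite EFin_max gt_max mstar_gt1.
set mL := \sum_(k < L) _ in hmL.
have /andP[mL1 mLrho] : (1 < mL) && (rho^-1 < mL) by rewrite -gt_max.
have mL0 : 0 < mL by exact: lt_trans mL1.
have law : {ae Theta, forall e, forall x, step_laws R S (env_step e x)}.
  by apply: filterS good => e [].
have [|n [a [n0 a0 X1 Qa]]] := step_lower Theta_iid mL1 law.
  apply: filterS2 good rho_spectral => e [elaw ell _] rhoE.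
  apply: (spectral_radius_gt (env_kernel_ge0 elaw)); first by rewrite invr_ge0 ltW.
  have := env_spectral_radius_gt0 G_infinite gamma_gt0 S'_sub S'_generates elaw ell.
  rewrite rhoE !lte_fin => rho0.
  by rewrite -[rho]invrK ltf_pV2// posrE invr_gt0.
pose A y : set (step_space R S * offspring_space R) := step_above a y `*` B.
have mA y : measurable (A y) by apply: measurableX => //; exact: measurable_step_above.
have [c [cF cE]] := exists_cells (word_ball1 S n).
(* The seed asks for finitely many independent site events of positive probability, so its own
   probability is a positive real. *)
have [del del0 delE] : exists2 del, 0 < del &
    (\prod_(y <- word_ball S n) (Q \x Qt) (A y) = del%:E)%E.
  rewrite big_seq.
  apply: (big_ind (fun z => exists2 r : R, 0 < r & z = r%:E)) => [|_ _ [r r0 ->] [s s0 ->]|y yF].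
  - by exists 1.
  - by exists (r * s); [exact: mulr_gt0|rewrite EFinM].
  - have -> : (Q \x Qt)%E (A y) = (Q (step_above a y) * Qt B)%E.
      by apply: product_measure1E => //; exact: measurable_step_above.
    have Qy := Qa y yF.
    have Qfin : Q (step_above a y) \is a fin_num.
      by apply: fin_num_measure; exact: measurable_step_above.
    have Bfin : Qt B \is a fin_num by exact: fin_num_measure.
    exists (fine (Q (step_above a y)) * fine (Qt B)); last by rewrite EFinM !fineK.
    by rewrite mulr_gt0// fine_gt0// ltey_eq ?Qfin ?Bfin ?Qy ?B0.
have trap_ae := env_trap_cvg0 Theta_iid cF mA delE G_countable del0.
apply: filterS2 good trap_ae => e [elaw ell core] untrapped.
apply: (env_recurrent G_infinite G_countable gamma_gt0 S'_sub S'_generates elaw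
  ell _ n0 a0 beta0 mL1 X1 betaB cE untrapped) => x.
by case: (core x).
Qed.
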